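(* Let $c\in\mathbb{C}$ with $\operatorname{Re}(c)>0$ and $\operatorname{Im}(c)>0$, let $H_c=-\frac{d^2}{dx^2}+cx^2$ be the complex harmonic oscillator acting in $L^2(\mathbb{R})$, let $b>0$ and let $0<p\le\frac13$. Then $$\lim_{\eta\to+\infty}\|(H_c-(b\eta+c\eta^p))^{-1}\|=0.$$
   Context: $H_c$ is the m-sectorial operator in $L^2(\mathbb{R})$ associated (via the representation theorem for closed sectorial forms) with the closed sectorial form $h_c(f,g)=\int_{\mathbb{R}}f'(x)\overline{g'(x)}\,dx+c\int_{\mathbb{R}}x^2f(x)\overline{g(x)}\,dx$ on the form domain $W^{1,2}(\mathbb{R})\cap\{f\in L^2(\mathbb{R}):\int_{\mathbb{R}}x^2|f(x)|^2dx<\infty\}$. The norm is the operator norm on $L^2(\mathbb{R})$, with the convention $\|(H_c-zI)^{-1}\|=\infty$ when $z$ is in the spectrum of $H_c$. *)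

(* Defs.v *)
From mathcomp Require Import all_boot all_order all_algebra.
From mathcomp Require Import all_classical all_reals all_analysis.
From mathcomp Require Import complex.

Set Implicit Arguments.
Unset Strict Implicit.
Unset Printing Implicit Defensive.

Import Order.TTheory GRing.Theory Num.Theory.
Import numFieldNormedType.Exports.

Local Open Scope classical_set_scope.
Local Open Scope ring_scope.
Local Open Scope complex_scope.

(* Elements of L^2(R; C) are represented by functions R -> R[i]; two functions
   that agree almost everywhere represent the same element. *)
Section L2.
Context {R : realType}.
Implicit Types f g : R -> R[i].
Local Notation mu := (@lebesgue_measure R).

Definition Cmeasurable f : Prop :=
  measurable_fun setT (fun x => complex.Re (f x)) /\
  measurable_fun setT (fun x => complex.Im (f x)).

(* Only meaningful when the real and imaginary parts are integrable. *)
Definition Cintegral f : R[i] :=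
  (\int[mu]_x complex.Re (f x)) +i* (\int[mu]_x complex.Im (f x)).

Definition L2norm f : \bar R :=
  ('N[mu]_(2%:E)[EFin \o (fun x => ComplexField.Normc.normc (f x))])%E.

Definition L2 : set (R -> R[i]) :=
  [set f | Cmeasurable f /\ (L2norm f < +oo)%E].

Definition L2inner f g : R[i] := Cintegral (fun x => f x * conjc (g x)).

End L2.

Section Sobolev.
Context {R : realType}.
Implicit Types f g : R -> R[i].

Definition test_function (phi : R -> R) : Prop :=
  (forall (n : nat) (x : R), derivable (derive1n n phi) x 1) /\
  (exists M : R, forall x, M < `|x| -> phi x = 0).

(* By linearity, real-valued test functions are enough to determine the
   distributional derivative of a complex-valued function. *)
Definition is_weak_derivative f g : Prop :=
  forall phi : R -> R, test_function phi ->
    Cintegral (fun x => f x * (derive1 phi x)%:C) =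
    - Cintegral (fun x => g x * (phi x)%:C).

Definition W12 : set (R -> R[i]) :=
  [set f | L2 f /\ exists g, L2 g /\ is_weak_derivative f g].

(* An L^2 weak derivative, unique up to almost everywhere equality; the
   default value 0 is irrelevant for f in W12. *)
Definition weak_derivative f : R -> R[i] :=
  xget (fun=> 0) [set g | L2 g /\ is_weak_derivative f g].

End Sobolev.

(* Unbounded operators in L^2 are given by their graphs: T f u means that f is
   in the domain of T and that T f = u. *)
Section Operators.
Context {R : realType}.
Local Notation fct := (R -> R[i]).
Local Notation mu := (@lebesgue_measure R).

(* The operator associated with the form h of domain D by the representation
   theorem: f is in its domain iff h(f, .) = <u, .> on D for some u in L^2,
   and its value at f is then u. *)
Definition form_operator (D : set fct) (h : fct -> fct -> R[i])
    (f u : fct) : Prop :=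
  [/\ D f, L2 u & forall g, D g -> h f g = L2inner u g].

(* The graph of T - zI: T f = v + z f. *)
Definition shift_operator (T : fct -> fct -> Prop) (z : R[i])
    (f v : fct) : Prop :=
  T f (fun x => v x + z * f x).

Definition in_resolvent_set (T : fct -> fct -> Prop) (z : R[i]) : Prop :=
  [/\ forall v, L2 v -> exists f, shift_operator T z f v,
      forall f1 f2 v, shift_operator T z f1 v -> shift_operator T z f2 v ->
        {ae mu, forall x, f1 x = f2 x}
    & exists M : R, forall f v, shift_operator T z f v ->
        (L2norm f <= M%:E * L2norm v)%E].

(* The operator norm of (T - zI)^-1, with value +oo on the spectrum of T. *)
Definition resolvent_norm (T : fct -> fct -> Prop) (z : R[i]) : \bar R :=
  if `[< in_resolvent_set T z >] then
    ereal_sup [set L2norm f | f in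
      [set f | exists v, shift_operator T z f v /\ (L2norm v <= 1)%E]]
  else +oo%E.

End Operators.

Section ComplexHarmonicOscillator.
Context {R : realType}.
Local Notation mu := (@lebesgue_measure R).

Definition oscillator_form_domain : set (R -> R[i]) :=
  [set f | W12 f /\
    (\int[mu]_x (x ^+ 2 * ComplexField.Normc.normc (f x) ^+ 2)%:E < +oo)%E].

Definition oscillator_form (c : R[i]) (f g : R -> R[i]) : R[i] :=
  Cintegral (fun x => weak_derivative f x * conjc (weak_derivative g x)) +
  c * Cintegral (fun x => (x ^+ 2)%:C * f x * conjc (g x)).

Definition complex_oscillator (c : R[i]) : (R -> R[i]) -> (R -> R[i]) -> Prop :=
  form_operator oscillator_form_domain (oscillator_form c).

End ComplexHarmonicOscillator.

(* Main.v *)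
Require Import Defs.
From mathcomp Require Import all_boot all_order all_algebra.
From mathcomp Require Import all_classical all_reals all_analysis.
From mathcomp Require Import measurable_realfun.
From mathcomp Require Import complex.
From mathcomp Require Import ring lra.

Set Implicit Arguments.
Unset Strict Implicit.
Unset Printing Implicit Defensive.

Import Order.TTheory GRing.Theory Num.Theory.
Import numFieldNormedType.Exports.

Local Open Scope classical_set_scope.
Local Open Scope ring_scope.

(** Write c = alpha^2 with alpha in the open first quadrant. The space of the
    functions f = P(x) exp(- alpha x^2 / 2), P a polynomial, is dense in L^2: a
    function orthogonal to it is, up to a Gaussian factor, a function with
    exponential decay and vanishing moments. On this space H_c - z is triangular
    with diagonal entries alpha (2 n + 1) - z, hence onto for the z in question.

    The theorem thus reduces to the a priori bound |f| <= C r^-2 |(H_c - z) f|,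
    with r = eta^(1/6), for these f. Put k = sqrt (b eta) = sqrt b r^3. Plane
    waves of frequency k and - k nearly solve the equation where x is at most of
    order r, and are damped by Im c x^2 - Im c eta^p beyond that; the latter
    term, of order at most r^2, has the wrong sign near the origin. Multiplying
    by cosh(m) f and sinh(m) f' / k with m = la * atan(x / r) differentiates the
    flux of the two waves with weights exp(m) and exp(- m), and for a suitable la
    the term in m' outweighs the wrong sign.

    Since H_c - z is symmetric for the bilinear pairing of f and g by the
    integral of f g, testing against the dense space turns the a priori bound
    into uniqueness and into the bound of the resolvent norm. The same energy
    identities bound f' and x f, so that the solutions obtained by density
    converge in the form domain. *)

(** * Integration and square-integrable functions on the line *)

Section RealIntegrals.
Context {R : realType}.
Local Notation mu := (@lebesgue_measure R).
Implicit Types u v w : R -> R.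

(** For large eta the point b eta + c eta^p lies inside the numerical range of H_c, so the form
    alone gives no bound: testing v = (H_c - z) f against f leaves Im c (x^2 - t) |f|^2, t = eta^p,
    negative near the origin. The length r comes from a balance. A weight that varies over a length
    l gains k / l from the flux of a wave of frequency k, against a loss Im c t; at l = r the gain
    has order r^2, and t <= r^2 is what p <= 1/3 provides. The damping also has order r^2 from |x| =
    r on, so the weight may flatten there, and the arctangent keeps it bounded above and below
    uniformly in r. Waves of frequency k and - k carry flux in opposite directions, so a single
    weight would gain from one and lose from the other; hence two weights. With la = 4 Im c / sqrt
    b, gain and damping exceed the loss by at least Im c r^2, the source of the factor r^-2. The
    remaining errors contain f' and powers of x / r but no positive power of r; cruder identities
    bound them by |f|^2 and |v|^2 with constants independent of r, and a large r absorbs them. *)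

Lemma ae_imp (P Q : R -> Prop) : (forall x, P x -> Q x) ->
  {ae mu, forall x, P x} -> {ae mu, forall x, Q x}.
Proof. by move=> PQ; exact: (@filterS _ _ (ae_filter_ringOfSetsType mu)). Qed.

Lemma ae_imp2 (P Q S : R -> Prop) : (forall x, P x -> Q x -> S x) ->
  {ae mu, forall x, P x} -> {ae mu, forall x, Q x} -> {ae mu, forall x, S x}.
Proof. by move=> PQ; exact: (@filterS2 _ _ (ae_filter_ringOfSetsType mu)). Qed.

Definition Rintegrable u : Prop := mu.-integrable setT (EFin \o u).
Definition itg u : R := \int[mu]_x u x.

Lemma Rintegrable_measurable u : Rintegrable u -> measurable_fun setT u.
Proof. by move=> /measurable_int /measurable_EFinP. Qed.

Lemma le_Rintegrable u v : measurable_fun setT u ->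
  (forall x, `|u x| <= v x) -> Rintegrable v -> Rintegrable u.
Proof.
move=> mu' uv iv; rewrite /Rintegrable; apply: (@le_integrable _ _ _ mu _ measurableT _ (EFin \o v)) => //.
- exact/measurable_EFinP.
- move=> x _ /=; rewrite lee_fin; apply: (le_trans (uv x)); exact: ler_norm.
Qed.

Lemma eq_Rintegrable u v : u =1 v -> Rintegrable u -> Rintegrable v.
Proof. by move=> /funext ->. Qed.

Lemma RintegrableD u v : Rintegrable u -> Rintegrable v -> Rintegrable (fun x => u x + v x).
Proof. by move=> iu iv; exact: (integrableD measurableT iu iv). Qed.

Lemma RintegrableZ (k : R) u : Rintegrable u -> Rintegrable (fun x => k * u x).
Proof. by move=> iu; exact: (integrableZl measurableT k iu). Qed.

Lemma RintegrableN u : Rintegrable u -> Rintegrable (fun x => - u x).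
Proof.
by move=> /(RintegrableZ (-1)); apply: eq_Rintegrable => x; rewrite mulN1r.
Qed.

Lemma RintegrableB u v : Rintegrable u -> Rintegrable v -> Rintegrable (fun x => u x - v x).
Proof. by move=> iu iv; apply: RintegrableD => //; exact: RintegrableN. Qed.

Lemma Rintegrable0 : Rintegrable (fun=> 0).
Proof. exact: integrable0. Qed.

Lemma Rintegrable_norm u : Rintegrable u -> Rintegrable (fun x => `|u x|).
Proof. exact: integrable_norm. Qed.

Lemma itgD u v : Rintegrable u -> Rintegrable v ->
  itg (fun x => u x + v x) = itg u + itg v.
Proof. exact: RintegralD. Qed.

Lemma itgB u v : Rintegrable u -> Rintegrable v ->
  itg (fun x => u x - v x) = itg u - itg v.
Proof. exact: RintegralB. Qed.

Lemma itgZ (k : R) u : Rintegrable u -> itg (fun x => k * u x) = k * itg u.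
Proof. by move=> iu; exact: RintegralZl. Qed.

Lemma itgN u : Rintegrable u -> itg (fun x => - u x) = - itg u.
Proof.
move=> iu; rewrite -mulN1r -itgZ//; congr itg; apply/funext => x.
by rewrite mulN1r.
Qed.

Lemma itg0 : itg (fun=> 0) = 0.
Proof. by rewrite /itg /Rintegral integral0. Qed.

Lemma itg_ge0 u : (forall x, 0 <= u x) -> 0 <= itg u.
Proof. by move=> u0; apply: Rintegral_ge0 => x _. Qed.

Lemma le_itg u v : Rintegrable u -> Rintegrable v -> (forall x, u x <= v x) ->
  itg u <= itg v.
Proof. by move=> iu iv uv; apply: le_Rintegral => // x _. Qed.

Lemma itgE u : Rintegrable u -> (\int[mu]_x (u x)%:E)%E = (itg u)%:E.
Proof. by move=> iu; rewrite /itg /Rintegral fineK//; exact: integrable_fin_num. Qed.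

Lemma ge0_Rintegrable u : measurable_fun setT u -> (forall x, 0 <= u x) ->
  Rintegrable u <-> (\int[mu]_x (u x)%:E < +oo)%E.
Proof.
move=> mu' u0; split => [iu|iu]; first by rewrite itgE// ltry.
apply/integrableP; split; first exact/measurable_EFinP.
by under eq_integral => x _ do rewrite /= ger0_norm//.
Qed.

Lemma ae_eq_itg u v : measurable_fun setT u -> measurable_fun setT v ->
  {ae mu, forall x, u x = v x} -> itg u = itg v.
Proof.
move=> mu' mv uv; rewrite /itg /Rintegral; congr fine.
apply: ae_eq_integral => //; [exact/measurable_EFinP|exact/measurable_EFinP|].
by apply: ae_imp uv => x /= ->.
Qed.

Lemma ae_eq_Rintegrable u v : measurable_fun setT v ->
  {ae mu, forall x, u x = v x} -> Rintegrable u -> Rintegrable v.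
Proof.
move=> mv uv iu; have mu' := Rintegrable_measurable iu.
have /integrableP[_ iu2] := iu.
apply/integrableP; split; first exact/measurable_EFinP.
apply: le_lt_trans iu2; rewrite le_eqVlt; apply/orP; left; apply/eqP.
apply: ae_eq_integral => //.
- by apply: measurableT_comp => //; exact/measurable_EFinP.
- by apply: measurableT_comp => //; exact/measurable_EFinP.
- by apply: ae_imp uv => x /= ->.
Qed.

Lemma itg_eq0 u : Rintegrable u -> (forall x, 0 <= u x) -> itg u = 0 ->
  {ae mu, forall x, u x = 0}.
Proof.
move=> iu u0 iu0.
have mEu : measurable_fun setT (EFin \o u).
  by apply/measurable_EFinP; exact: Rintegrable_measurable.
have /(iffLR (ae_eq_integral_abs mu measurableT mEu)) :
    (\int[mu]_x `|(EFin \o u) x| = 0)%E.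
  under eq_integral => x _ do rewrite /= ger0_norm//.
  by rewrite itgE// iu0.
by apply: ae_imp => x /(_ I) /= [].
Qed.

Lemma ae_dominated_itg (u_ : nat -> R -> R) u w :
  (forall n, measurable_fun setT (u_ n)) -> measurable_fun setT u ->
  {ae mu, forall x, u_ n x @[n --> \oo] --> u x} -> Rintegrable w ->
  (forall n x, `|u_ n x| <= w x) ->
  Rintegrable u /\ itg (u_ n) @[n --> \oo] --> itg u.
Proof.
move=> mu_ mu' uu iw uw.
have mEu_ n : measurable_fun setT (EFin \o u_ n) by exact/measurable_EFinP.
have mEu : measurable_fun setT (EFin \o u) by exact/measurable_EFinP.
have [||iu _ cu] := @dominated_convergence _ _ _ mu _ measurableT _ _
  (EFin \o w) mEu_ mEu _ iw.
- apply: ae_imp uu => x uux _; apply: cvg_EFin; [exact: nearW|exact: uux].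
- by apply: aeW => x n _; rewrite lee_fin.
split => //.
have iu_ n : Rintegrable (u_ n) by exact: (le_Rintegrable _ (uw n)).
move: cu; rewrite itgE//.
under eq_fun => n do rewrite /= itgE//.
by move/fine_cvgP => [_].
Qed.

Lemma dominated_itg (u_ : nat -> R -> R) u w :
  (forall n, measurable_fun setT (u_ n)) ->
  (forall x, u_ n x @[n --> \oo] --> u x) -> Rintegrable w ->
  (forall n x, `|u_ n x| <= w x) ->
  Rintegrable u /\ itg (u_ n) @[n --> \oo] --> itg u.
Proof.
move=> mu_ uu; apply: ae_dominated_itg => //; last exact: aeW.
by apply: (measurable_fun_cvg mu_) => x _; exact: uu.
Qed.

End RealIntegrals.

(** * Real square-integrable functions: Cauchy-Schwarz and completeness *)

Section RealL2.
Context {R : realType}.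
Local Notation mu := (@lebesgue_measure R).
Implicit Types u v w : R -> R.

Definition l2 u : Prop :=
  measurable_fun setT u /\ Rintegrable (fun x => u x ^+ 2).

Lemma l2_measurable u : l2 u -> measurable_fun setT u.
Proof. by case. Qed.

Lemma l2M u v : l2 u -> l2 v -> Rintegrable (fun x => u x * v x).
Proof.
move=> [mu' iu] [mv iv].
apply: (@le_Rintegrable _ _ (fun x => u x ^+ 2 + v x ^+ 2)).
- exact: measurable_funM.
- by move=> x; rewrite ler_norml; apply/andP; split; nra.
- exact: RintegrableD.
Qed.

Lemma le_l2 u v : measurable_fun setT u -> (forall x, `|u x| <= `|v x|) ->
  l2 v -> l2 u.
Proof.
move=> mu' uv [mv iv]; split => //.
apply: (@le_Rintegrable _ _ (fun x => v x ^+ 2)) => //.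
- exact: measurable_funX.
- by move=> x; rewrite normrX -(real_normK (num_real (v x))) lerXn2r// nnegrE.
Qed.

Lemma l2D u v : l2 u -> l2 v -> l2 (fun x => u x + v x).
Proof.
move=> [mu' iu] [mv iv]; split; first exact: measurable_funD.
apply: (@le_Rintegrable _ _ (fun x => 2 * (u x ^+ 2 + v x ^+ 2))).
- by apply: measurable_funX; exact: measurable_funD.
- by move=> x; rewrite ger0_norm ?sqr_ge0//; have := sqr_ge0 (u x - v x); nra.
- by apply: RintegrableZ; exact: RintegrableD.
Qed.

Lemma l2Z (k : R) u : l2 u -> l2 (fun x => k * u x).
Proof.
move=> [mu' iu]; split; first exact: measurable_funM.
by apply: (eq_Rintegrable _ (RintegrableZ (k ^+ 2) iu)) => x; rewrite exprMn.
Qed.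

Lemma l2N u : l2 u -> l2 (fun x => - u x).
Proof.
move=> /(l2Z (-1)); congr l2; apply/funext => x; exact: mulN1r.
Qed.

Lemma l2B u v : l2 u -> l2 v -> l2 (fun x => u x - v x).
Proof. by move=> l2u l2v; apply: l2D => //; exact: l2N. Qed.

Lemma l20 : l2 (fun=> 0).
Proof.
split; first exact: measurable_cst.
by apply: (eq_Rintegrable _ Rintegrable0) => x; rewrite expr0n.
Qed.

Lemma l2_bM (b u : R -> R) (C : R) : measurable_fun setT b ->
  (forall x, `|b x| <= C) -> l2 u -> l2 (fun x => b x * u x).
Proof.
move=> mb bC l2u; apply: (le_l2 _ _ (l2Z C l2u)).
- by apply: measurable_funM => //; exact: l2_measurable.
- move=> x; rewrite !normrM ler_wpM2r//.
  by rewrite (le_trans (bC x))// ler_norm.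
Qed.

Lemma ae_eq_l2 u v : measurable_fun setT v ->
  {ae mu, forall x, u x = v x} -> l2 u -> l2 v.
Proof.
move=> mv uv [mu' iu]; split => //.
apply: ae_eq_Rintegrable iu; first exact: measurable_funX.
by apply: ae_imp uv => x ->.
Qed.

Lemma cauchy_schwarz u v : l2 u -> l2 v ->
  itg (fun x => u x * v x) ^+ 2 <=
  itg (fun x => u x ^+ 2) * itg (fun x => v x ^+ 2).
Proof.
move=> l2u l2v.
have uv := l2M l2u l2v; have uu := l2u.2; have vv := l2v.2.
set A := itg (fun x => u x ^+ 2); set B := itg _; set C := itg (fun x => v x ^+ 2).
have A0 : 0 <= A by apply: itg_ge0 => x; exact: sqr_ge0.
have C0 : 0 <= C by apply: itg_ge0 => x; exact: sqr_ge0.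
have H s : 0 <= s ^+ 2 * A + (2 * s * B + C).
  have : 0 <= itg (fun x => (s * u x + v x) ^+ 2).
    by apply: itg_ge0 => x; exact: sqr_ge0.
  have -> : (fun x => (s * u x + v x) ^+ 2) =
    fun x => s ^+ 2 * (u x ^+ 2) + (2 * s * (u x * v x) + v x ^+ 2).
    by apply/funext => x; ring.
  rewrite itgD ?itgZ//; last 2 first.
    exact: RintegrableZ.
    by apply: RintegrableD => //; exact: RintegrableZ.
  by rewrite itgD ?itgZ//; exact: RintegrableZ.
have [A1|A1] := ltP 0 A.
  (* The minimiser of the quadratic in [s]. *)
  have := H (- B / A).
  rewrite (_ : _ + _ = (A * C - B ^+ 2) / A); last by field; rewrite gt_eqF.
  by rewrite pmulr_lge0 ?invr_gt0// subr_ge0.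
have -> : A = 0 by apply/eqP; rewrite eq_le A1.
rewrite mul0r; have [->|B0] := eqVneq B 0; first by rewrite expr0n.
(* With [A = 0] the quadratic is affine in [s] with slope [2 * B]; at this point it would equal -
   1. *)
have := H (- (C + 1) / (2 * B)).
have -> : A = 0 by apply/eqP; rewrite eq_le A1.
rewrite (_ : _ + _ = - 1); first by rewrite oppr_ge0 ler10.
by field.
Qed.

Lemma itgM_cvg (u_ : nat -> R -> R) u v : (forall n, l2 (u_ n)) -> l2 u ->
  l2 v -> itg (fun x => (u_ n x - u x) ^+ 2) @[n --> \oo] --> 0 ->
  itg (fun x => u_ n x * v x) @[n --> \oo] --> itg (fun x => u x * v x).
Proof.
move=> l2u_ l2u l2v cu.
pose V := itg (fun x => v x ^+ 2).
have V0 : 0 <= V by apply: itg_ge0 => x; exact: sqr_ge0.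
apply/cvgrPdist_lt => e e0.
have d0 : 0 < e ^+ 2 / (V + 1) by rewrite divr_gt0 ?exprn_gt0// ltr_wpDl.
move/cvgrPdist_lt : cu => /(_ _ d0); apply: filterS => n.
set D := itg _; rewrite sub0r normrN => Dlt.
rewrite distrC -itgB; [|exact: l2M|exact: l2M].
have -> : (fun x => u_ n x * v x - u x * v x) = (fun x => (u_ n x - u x) * v x).
  by apply/funext => x; rewrite mulrBl.
rewrite -(ltr_pXn2r (n := 2))// ?nnegrE ?ltW// real_normK ?num_real//.
apply: (le_lt_trans (cauchy_schwarz (l2B (l2u_ n) l2u) l2v)).
rewrite -/V -/D.
have D0 : 0 <= D by apply: itg_ge0 => x; exact: sqr_ge0.
rewrite ger0_norm// ltr_pdivlMr in Dlt; last by rewrite ltr_wpDl.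
by apply: le_lt_trans Dlt; rewrite ler_wpM2l// lerDl.
Qed.

(** Cauchy-Schwarz for the telescoping sum with weights 2^k, since the sum of 2^-k over k >= n is 2
    / 2^n. It makes the sequence Cauchy wherever the weighted sum of squared increments is
    finite. *)
Lemma fast_cauchy_sum (a : nat -> R) (n j : nat) :
  (a (n + j)%N - a n) ^+ 2 <=
  2 / 2 ^+ n * \sum_(n <= k < n + j) 2 ^+ k * (a k.+1 - a k) ^+ 2.
Proof.
elim: j n => [n|j IH n].
  by rewrite addn0 subrr expr0n mulr_ge0// sumr_ge0// => k _; rewrite mulr_ge0 ?sqr_ge0.
rewrite big_ltn; last by rewrite addnS ltnS leq_addr.
rewrite addnS -addSn.
have := IH n.+1; set S := \sum_(_ <= _ < _) _; move=> IHn.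
have p0 : 0 < 2 ^+ n :> R by rewrite exprn_gt0.
rewrite mulrDr mulrA (_ : 2 / _ * _ = 2); last by field; rewrite gt_eqF.
have e : 2 / 2 ^+ n.+1 * S = (2 / 2 ^+ n * S) / 2.
  by rewrite exprS; field; rewrite gt_eqF.
rewrite e in IHn; move: IHn.
set x := a (n.+1 + j)%N; set y := a n.+1; set z := a n; set w := _ * S => IHn.
have := sqr_ge0 ((x - y) - (y - z)).
nra.
Qed.

(** The Riesz-Fischer argument for a rapidly converging sequence. The rate 4^-n leaves room for the
    weights 2^k: the weighted sum [H] of squared increments has integral at most 2 K. Where [H] is
    finite, the squared distance to the limit is at most 2 / 2^n [H], and the integral of this bound
    tends to 0. *)
Lemma l2_complete (u_ : nat -> R -> R) (K : R) : (forall n, l2 (u_ n)) ->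
  (forall n, itg (fun x => (u_ n.+1 x - u_ n x) ^+ 2) <= K / 4 ^+ n) ->
  exists2 u, l2 u & itg (fun x => (u_ n x - u x) ^+ 2) @[n --> \oo] --> 0.
Proof.
move=> l2u uK.
pose d k x := 2 ^+ k * (u_ k.+1 x - u_ k x) ^+ 2.
have d0 k x : 0 <= d k x by rewrite mulr_ge0 ?sqr_ge0.
have id k : Rintegrable (d k) by apply: RintegrableZ; exact: (l2B (l2u _) (l2u _)).2.
(* H is finite almost everywhere, and there the u_ k x form a Cauchy sequence *)
pose H x : \bar R := (\sum_(0 <= k <oo) (d k x)%:E)%E.
have H0 x : (0 <= H x)%E by apply: nneseries_ge0 => k _ _; rewrite lee_fin.
have mdE k : measurable_fun setT (fun x => (d k x)%:E).
  by apply/measurable_EFinP; exact: Rintegrable_measurable.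
have K0 : 0 <= K.
  have := uK 0%N; rewrite expr0 divr1; apply: le_trans.
  by apply: itg_ge0 => x; exact: sqr_ge0.
have IH : (\int[mu]_x H x <= (2 * K)%:E)%E.
  rewrite /H integral_nneseries//; last by move=> k x _; rewrite lee_fin.
  apply: lime_le.
    by apply: is_cvg_nneseries => k _ _; apply: integral_ge0 => x _; rewrite lee_fin.
  apply: nearW => n /=.
  under eq_bigr => k _ do rewrite itgE//.
  rewrite sumEFin lee_fin.
  suff : forall m, \sum_(0 <= k < m) itg (d k) <= K * (2 - 2 / 2 ^+ m).
    move=> /(_ n) /le_trans; apply; rewrite [leRHS]mulrC ler_wpM2l//.
    by rewrite lerBlDr lerDl divr_ge0.
  elim=> [|m IHm]; first by rewrite big_nil expr0 divr1 subrr mulr0.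
  rewrite big_nat_recr//=.
  have : itg (d m) <= K / 2 ^+ m.
    rewrite itgZ; last exact: (l2B (l2u _) (l2u _)).2.
    apply: (le_trans (ler_wpM2l _ (uK m))) => //.
    rewrite (_ : 4 = 2 * 2 :> R); last by ring.
    by rewrite exprMn le_eqVlt; apply/orP; left; apply/eqP; field.
  move=> dm; apply: (le_trans (lerD IHm dm)).
  rewrite -mulrDr ler_wpM2l// exprS.
  by rewrite le_eqVlt; apply/orP; left; apply/eqP; field.
have mH : measurable_fun setT H.
  by apply: ge0_emeasurable_sum => // k x _ _; rewrite lee_fin.
have iH : mu.-integrable setT H.
  apply/integrableP; split => //.
  by under eq_integral => x _ do rewrite gee0_abs//; rewrite (le_lt_trans IH)// ltry.
pose h x := fine (H x).
have mh : measurable_fun setT h by exact: measurableT_comp.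
have aeH : {ae mu, forall x, H x = (h x)%:E}.
  by apply: ae_imp (integrable_ae measurableT iH) => x /(_ I) /fineK.
have ih : Rintegrable h.
  apply/ge0_Rintegrable => //; first by move=> x; exact: fine_ge0.
  apply: le_lt_trans (ltry (2 * K)); apply: le_trans IH.
  rewrite le_eqVlt; apply/orP; left; apply/eqP.
  apply: ae_eq_integral => //; first by apply/measurable_EFinP.
  by apply: ae_imp aeH => x ->.
pose A := [set x | H x \is a fin_num].
have mA : measurable A.
  have := emeasurable_fin_num measurableT mH; by rewrite setTI.
(* Setting the functions to 0 where [H] is infinite makes the sequence converge at every point, so
   that its limit is measurable. *)
pose g n x := u_ n x * \1_A x.
have mg n : measurable_fun setT (g n).
  by apply: measurable_funM; [exact: l2_measurable | exact: measurable_indic].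
have sumle n m x : A x -> \sum_(n <= k < m) d k x <= h x.
  move=> Ax; rewrite -lee_fin -sumEFin fineK//.
  apply: (@le_trans _ _ (\sum_(0 <= k < m) (d k x)%:E)%E); last first.
    by apply: nneseries_lim_ge => k _ _; rewrite lee_fin.
  have [nm|/ltnW mn] := leqP n m; last first.
    by rewrite big_geq// sume_ge0// => k _; rewrite lee_fin.
  rewrite [leRHS](big_cat_nat (leq0n n) nm)/= leeDr//.
  by apply: sume_ge0 => k _; rewrite lee_fin.
have gdist n j x : (g (n + j)%N x - g n x) ^+ 2 <= 2 / 2 ^+ n * h x.
  rewrite /g -mulrBl exprMn.
  have [xA|xA] := pselect (A x); last first.
    by rewrite indicE memNset// expr0n mulr0 mulr_ge0 ?divr_ge0// fine_ge0.
  rewrite indicE mem_set// expr1n mulr1.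
  apply: (le_trans (fast_cauchy_sum (u_^~ x) n j)).
  rewrite ler_wpM2l ?divr_ge0//; exact: sumle.
have cvg0 x : 2 / 2 ^+ n * h x @[n --> \oo] --> (0 : R).
  rewrite -(mul0r (h x)); apply: cvgMl.
  rewrite -(mulr0 2); apply: cvgMr.
  under eq_fun do rewrite -exprVn.
  by apply: cvg_expr; rewrite ger0_norm// invf_lt1// ltr1n.
have cg x : cvgn (g ^~ x).
  apply: cauchy_cvg; apply: cauchy_exP => e e0.
  have e20 : 0 < e ^+ 2 by rewrite exprn_gt0.
  have /cvgrPdist_lt/(_ _ e20)[N _ HN] := cvg0 x.
  exists (g N x), N => //= m /= /subnKC <-; rewrite -ball_normE /= distrC.
  rewrite -(ltr_pXn2r (n := 2))// ?nnegrE ?ltW//.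
  rewrite real_normK ?num_real//; apply: (le_lt_trans (gdist _ _ _)).
  by have := HN N (leqnn _); rewrite /= sub0r normrN; apply: le_lt_trans; exact: ler_norm.
pose u x := limn (g ^~ x).
have mu' : measurable_fun setT u.
  by apply: (measurable_fun_cvg mg) => x _; exact: cg.
have udist n x : (u x - g n x) ^+ 2 <= 2 / 2 ^+ n * h x.
  have cc : (g (j + n)%N x - g n x) ^+ 2 @[j --> \oo] --> (u x - g n x) ^+ 2.
    have c1 : g (j + n)%N x - g n x @[j --> \oo] --> (u x - g n x).
      apply: cvgB; last exact: cvg_cst.
      by rewrite (cvg_shiftn n (g ^~ x)); exact: cg.
    by under eq_fun do rewrite expr2; rewrite expr2; exact: cvgM.
  rewrite -(cvg_lim _ cc)//; apply: limr_le; first by apply/cvg_ex; eexists; exact: cc.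
  by apply: nearW => j; rewrite addnC.
have aeg n : {ae mu, forall x, g n x = u_ n x}.
  apply: ae_imp aeH => x Hx; rewrite /g indicE mem_set ?mulr1//.
  by rewrite /A /= Hx.
have l2g n : l2 (g n).
  apply: (@ae_eq_l2 (u_ n)) => //.
  by apply: ae_imp (aeg n) => x ->.
have l2ug n : l2 (fun x => u x - g n x).
  split; first exact: measurable_funB.
  apply: (@le_Rintegrable _ _ (fun x => 2 / 2 ^+ n * h x)).
  - by apply: measurable_funX; exact: measurable_funB.
  - by move=> x; rewrite ger0_norm ?sqr_ge0.
  - exact: RintegrableZ.
have l2u' : l2 u.
  have := l2D (l2ug 0%N) (l2g 0%N); congr l2; apply/funext => x; exact: subrK.
exists u => //.
have bound n : 0 <= itg (fun x => (u_ n x - u x) ^+ 2) <= 2 / 2 ^+ n * itg h.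
  rewrite itg_ge0/=; last by move=> x; exact: sqr_ge0.
  rewrite -itgZ//.
  rewrite (_ : itg _ = itg (fun x => (u x - g n x) ^+ 2)).
    by apply: le_itg => //; [exact: (l2ug n).2|exact: RintegrableZ].
  apply: ae_eq_itg.
  - by apply: measurable_funX; apply: measurable_funB => //; exact: l2_measurable.
  - by apply: measurable_funX; exact: measurable_funB.
  - by apply: ae_imp (aeg n) => x ->; ring.
have c2 : 2 / 2 ^+ n * itg h @[n --> \oo] --> (0 : R).
  rewrite -(mul0r (itg h)); apply: cvgMl.
  rewrite -(mulr0 2); apply: cvgMr.
  under eq_fun do rewrite -exprVn.
  by apply: cvg_expr; rewrite ger0_norm// invf_lt1// ltr1n.
by apply: (squeeze_cvgr _ (cvg_cst 0) c2); exact: nearW.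
Qed.

End RealL2.

(** * Calculus with rapidly decreasing functions *)

Section Calculus.
Context {R : realType}.
Local Notation mu := (@lebesgue_measure R).
Implicit Types u v w F G : R -> R.

Definition has_deriv F G : Prop := forall x : R, is_derive x 1 F (G x).

Lemma eq_has_deriv F G G' : has_deriv F G -> G =1 G' -> has_deriv F G'.
Proof. by move=> FG e x; rewrite -e. Qed.

Lemma has_deriv_cst (c : R) : has_deriv (fun=> c) (fun=> 0).
Proof. by move=> x; exact: is_derive_cst. Qed.

Lemma has_deriv_id : has_deriv (fun x => x) (fun=> 1).
Proof. by move=> x; exact: is_derive_id. Qed.

Lemma has_derivD u v u' v' : has_deriv u u' -> has_deriv v v' ->
  has_deriv (fun x => u x + v x) (fun x => u' x + v' x).
Proof. by move=> hu hv x; apply: is_deriveD. Qed.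

Lemma has_derivN u u' : has_deriv u u' ->
  has_deriv (fun x => - u x) (fun x => - u' x).
Proof. by move=> hu x; apply: is_deriveN. Qed.

Lemma has_derivM u v u' v' : has_deriv u u' -> has_deriv v v' ->
  has_deriv (fun x => u x * v x) (fun x => u' x * v x + u x * v' x).
Proof.
move=> hu hv x; have := is_deriveM (hu x) (hv x).
by move=> h; apply: is_derive_eq h _; rewrite /GRing.scale /=; ring.
Qed.

Lemma has_deriv_comp u v u' v' : has_deriv u u' -> has_deriv v v' ->
  has_deriv (fun x => u (v x)) (fun x => u' (v x) * v' x).
Proof. by move=> hu hv x; apply: is_derive1_comp. Qed.

Lemma has_derivX (n : nat) u u' : has_deriv u u' ->
  has_deriv (fun x => u x ^+ n.+1) (fun x => n.+1%:R * u x ^+ n * u' x).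
Proof.
move=> hu; elim: n => [|n IH].
  by apply: (eq_has_deriv hu) => x; rewrite expr0 !mul1r.
have -> : (fun x => u x ^+ n.+2) = (fun x => u x * u x ^+ n.+1).
  by apply/funext => x; rewrite exprS.
apply: (eq_has_deriv (has_derivM hu IH)) => x.
by rewrite -[in RHS]natr1 exprS; ring.
Qed.

Lemma has_deriv_expR u u' : has_deriv u u' ->
  has_deriv (fun x => expR (u x)) (fun x => expR (u x) * u' x).
Proof. by move=> hu; apply: has_deriv_comp => // x; exact: is_derive_expR. Qed.

Lemma has_deriv_cos u u' : has_deriv u u' ->
  has_deriv (fun x => cos (u x)) (fun x => - sin (u x) * u' x).
Proof. by move=> hu; apply: (has_deriv_comp (u' := fun x => - sin x)) => // x; exact: is_derive_cos. Qed.

Lemma has_deriv_sin u u' : has_deriv u u' ->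
  has_deriv (fun x => sin (u x)) (fun x => cos (u x) * u' x).
Proof. by move=> hu; apply: has_deriv_comp => // x; exact: is_derive_sin. Qed.

Lemma has_deriv_atan u u' : has_deriv u u' ->
  has_deriv (fun x => atan (u x)) (fun x => (1 + u x ^+ 2)^-1 * u' x).
Proof. by move=> hu; apply: (has_deriv_comp (u' := fun x => (1 + x ^+ 2)^-1)) => // x; exact: is_derive1_atan. Qed.

Lemma has_deriv_continuous u u' : has_deriv u u' -> continuous u.
Proof.
move=> hu x; apply: differentiable_continuous; apply/derivable1_diffP.
exact: ex_derive.
Qed.

Lemma has_deriv_derive1 u u' : has_deriv u u' -> u^`()%classic = u'.
Proof. by move=> hu; apply/funext => x; rewrite derive1E; exact: derive_val. Qed.

Lemma Rintegrable_oneDsqrV : Rintegrable (fun x : R => (1 + x ^+ 2)^-1).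
Proof.
have p (x : R) : 0 < 1 + x ^+ 2 by rewrite ltr_pwDl// sqr_ge0.
have c : continuous (fun x : R => (1 + x ^+ 2)^-1) by exact: continuous_oneDsqrV.
apply/ge0_Rintegrable; first exact: continuous_measurable_fun.
  by move=> x; rewrite invr_ge0 ltW.
rewrite ge0_symfun_integralT//.
- rewrite (_ : [set x : R | 0 <= x] = `[0, +oo[%classic); last first.
    by rewrite set_itvE.
  by rewrite (@integral0y_oneDsqr R) -EFinM ltry.
- by move=> x; rewrite invr_ge0 ltW.
- by move=> x /=; rewrite sqrrN.
Qed.

(** The fundamental theorem on the intervals [- (n + 1), n + 1], nondegenerate also for n = 0,
    followed by dominated convergence. *)
Lemma itg_has_deriv F G : has_deriv F G -> continuous G -> Rintegrable G ->
  F x @[x --> +oo] --> 0 -> F x @[x --> -oo] --> 0 -> itg G = 0.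
Proof.
move=> FG cG iG Fy FNy.
pose g n x := G x * \1_(`[- (n.+1%:R), n.+1%:R]%classic : set R) x.
have mG := Rintegrable_measurable iG.
have [|||_ cg] := @dominated_itg R g G (fun x => `|G x|) _ _ (Rintegrable_norm iG).
- by move=> n; apply: measurable_funM => //; exact: measurable_indic.
- move=> x; apply/cvgrPdist_le => e e0.
  near=> n; rewrite /g indicE mem_set ?mulr1 ?subrr ?normr0 ?ltW//.
  rewrite /= in_itv/= -ler_norml.
  have : `|x| <= n%:R by near: n; exact: nbhs_infty_ger.
  by move=> /le_trans; apply; rewrite ler_nat.
- move=> n x; rewrite /g normrM ler_piMr// indicE.
  by case: (_ \in _) => /=; rewrite ?normr1 ?normr0.
have gE n : itg (g n) = F n.+1%:R - F (- n.+1%:R).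
  have -> : itg (g n) = \int[mu]_(x in `[- n.+1%:R, n.+1%:R]) G x.
    rewrite Rintegral_mkcond /itg; congr Rintegral; apply/funext => x.
    by rewrite /g patchE indicE; case: ifPn => _; rewrite ?mulr1 ?mulr0.
  rewrite /Rintegral (@continuous_FTC2 _ G F)//=.
  - by rewrite gtrN// ltr0n.
  - exact: continuous_subspaceT.
  - have cF := has_deriv_continuous FG.
    split; first by move=> x _; exact: ex_derive.
    + by apply: cvg_at_right_filter; exact: cF.
    + by apply: cvg_at_left_filter; exact: cF.
  - by move=> x _; rewrite (has_deriv_derive1 FG).
have c2 : itg (g n) @[n --> \oo] --> (0 : R).
  under eq_fun do rewrite gE.
  rewrite -(subr0 0); apply: cvgB.
    apply: (cvg_comp _ _ _ Fy).
    by apply/cvgryPge => A; near=> n; rewrite (@le_trans _ _ n%:R) ?ler_nat//;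
       near: n; exact: nbhs_infty_ger.
  apply: (cvg_comp _ _ _ FNy).
  apply/cvgrNyPle => A; near=> n; rewrite lerNl (@le_trans _ _ n%:R) ?ler_nat//.
  by near: n; exact: nbhs_infty_ger.
by rewrite -(cvg_lim _ cg)// (cvg_lim _ c2).
Unshelve. all: by end_near. Qed.

(** Nothing is required of derivatives: the derivatives that occur in an identity are functions of
    their own with their own decay hypotheses. Rapid functions absorb factors of polynomial growth,
    so that integrability can be read off the shape of an expression. *)
Definition rapid u : Prop :=
  continuous u /\ forall n : nat, exists C : R, forall x, `|x| ^+ n * `|u x| <= C.

Definition tempered u : Prop :=
  continuous u /\ exists (n : nat) (C : R), forall x, `|u x| <= C * (1 + `|x| ^+ n).

Lemma temperedM_rapid u v : tempered u -> rapid v -> rapid (fun x => u x * v x).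
Proof.
move=> [cu [m [K uK]]] [cv rv]; split; first by move=> x; exact: cvgM (cu x) (cv x).
move=> n; have [C1 h1] := rv n; have [C2 h2] := rv (n + m)%N.
exists (`|K| * (C1 + C2)) => x.
have := h1 x; have := h2 x; have := uK x; rewrite exprD normrM.
have : 0 <= `|x| ^+ n * `|v x| by rewrite mulr_ge0// exprn_ge0.
set a := `|x| ^+ n; set b := `|x| ^+ m => av ux h2x h1x.
have b0 : 0 <= b by rewrite exprn_ge0.
have ux' : `|u x| <= `|K| * (1 + b).
  by rewrite (le_trans ux)// ler_wpM2r ?addr_ge0// ler_norm.
rewrite (_ : a * _ = `|u x| * (a * `|v x|)); last by ring.
apply: (le_trans (ler_wpM2r av ux')).
rewrite -mulrA ler_wpM2l// mulrDl mul1r lerD//.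
by apply: le_trans h2x; rewrite le_eqVlt; apply/orP; left; apply/eqP; ring.
Qed.

Lemma tempered_cst (c : R) : tempered (fun=> c).
Proof.
split; first exact: cst_continuous.
by exists 0%N, `|c| => x; rewrite expr0 ler_peMr// lerDl.
Qed.

Lemma tempered_id : tempered (fun x => x).
Proof.
split; first by move=> x.
by exists 1%N, 1 => x; rewrite expr1 mul1r lerDr.
Qed.

Lemma temperedD u v : tempered u -> tempered v -> tempered (fun x => u x + v x).
Proof.
move=> [cu [m [K uK]]] [cv [n [L vL]]]; split.
  by move=> x; exact: cvgD (cu x) (cv x).
exists (m + n)%N, (2 * (`|K| + `|L|)) => x.
have P (i j : nat) : 1 + `|x| ^+ i <= 2 * (1 + `|x| ^+ (i + j)).
  have [x1|x1] := leP 1 `|x|.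
    have : `|x| ^+ i <= `|x| ^+ (i + j) by rewrite ler_weXn2l// leq_addr.
    have : 0 <= `|x| ^+ i by rewrite exprn_ge0.
    lra.
  have : `|x| ^+ i <= 1 by rewrite exprn_ile1// ltW.
  have : 0 <= `|x| ^+ (i + j) by rewrite exprn_ge0.
  lra.
have P2 := P m n; have P1 := P n m; rewrite (addnC n m) in P1.
have := uK x; have := vL x.
set a := 1 + `|x| ^+ n in P1 P2 *; set b := 1 + `|x| ^+ m in P1 P2 *.
set c := 1 + `|x| ^+ (m + n) in P1 P2 * => hv hu.
have a0 : 0 <= a by rewrite addr_ge0// exprn_ge0.
have b0 : 0 <= b by rewrite addr_ge0// exprn_ge0.
have hu' : `|u x| <= `|K| * b by apply: (le_trans hu); rewrite ler_wpM2r// ler_norm.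
have hv' : `|v x| <= `|L| * a by apply: (le_trans hv); rewrite ler_wpM2r// ler_norm.
apply: (le_trans (ler_normD _ _)); apply: (le_trans (lerD hu' hv')).
have k1 := ler_wpM2l (normr_ge0 K) P2.
have k2 := ler_wpM2l (normr_ge0 L) P1.
by apply: (le_trans (lerD k1 k2)); rewrite le_eqVlt; apply/orP; left; apply/eqP; ring.
Qed.

Lemma temperedM u v : tempered u -> tempered v -> tempered (fun x => u x * v x).
Proof.
move=> [cu [m [K uK]]] [cv [n [L vL]]]; split.
  by move=> x; exact: cvgM (cu x) (cv x).
exists (m + n)%N, (`|K| * `|L| * 4) => x.
have := uK x; have := vL x; rewrite normrM.
have x0 : 0 <= `|x| by [].
move: x0; set y := `|x| => y0 hv hu.
have hu' : `|u x| <= `|K| * (1 + y ^+ m).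
  by rewrite (le_trans hu)// ler_wpM2r ?ler_norm// addr_ge0// exprn_ge0.
have hv' : `|v x| <= `|L| * (1 + y ^+ n).
  by rewrite (le_trans hv)// ler_wpM2r ?ler_norm// addr_ge0// exprn_ge0.
apply: (le_trans (ler_pM _ _ hu' hv')) => //.
rewrite mulrACA -[leRHS]mulrA ler_wpM2l ?mulr_ge0// exprD.
have p0 : 0 <= y ^+ m by rewrite exprn_ge0.
have q0 : 0 <= y ^+ n by rewrite exprn_ge0.
have [y1|y1] := leP 1 y.
  have : 1 <= y ^+ m by rewrite exprn_ege1.
  have : 1 <= y ^+ n by rewrite exprn_ege1.
  nra.
have : y ^+ m <= 1 by rewrite exprn_ile1// ltW.
have : y ^+ n <= 1 by rewrite exprn_ile1// ltW.
nra.
Qed.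

Lemma temperedN u : tempered u -> tempered (fun x => - u x).
Proof.
move=> [cu [m [K uK]]]; split; first by move=> x; exact: cvgN (cu x).
by exists m, K => x; rewrite normrN.
Qed.

Lemma temperedX (n : nat) u : tempered u -> tempered (fun x => u x ^+ n).
Proof.
move=> tu; elim: n => [|n IH]; first exact: tempered_cst.
have -> : (fun x => u x ^+ n.+1) = (fun x => u x * u x ^+ n).
  by apply/funext => x; rewrite exprS.
exact: temperedM.
Qed.

Lemma bounded_tempered u (C : R) : continuous u -> (forall x, `|u x| <= C) ->
  tempered u.
Proof.
move=> cu uC; split => //; exists 0%N, `|C| => x.
rewrite expr0 (le_trans (uC x))// (le_trans (ler_norm C))//.
by rewrite ler_peMr// lerDl.
Qed.

Lemma rapid_tempered u : rapid u -> tempered u.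
Proof.
move=> [cu /(_ 0%N)[C h]]; apply: (@bounded_tempered _ C) => // x.
by have := h x; rewrite expr0 mul1r.
Qed.

Lemma rapidD u v : rapid u -> rapid v -> rapid (fun x => u x + v x).
Proof.
move=> [cu ru] [cv rv]; split; first by move=> x; exact: cvgD (cu x) (cv x).
move=> n; have [C1 h1] := ru n; have [C2 h2] := rv n.
exists (C1 + C2) => x; apply: le_trans (lerD (h1 x) (h2 x)).
by rewrite -mulrDr ler_wpM2l ?exprn_ge0// ler_normD.
Qed.

Lemma rapidMr u v : rapid u -> tempered v -> rapid (fun x => u x * v x).
Proof.
move=> ru tv; have := temperedM_rapid tv ru.
by congr rapid; apply/funext => x; rewrite mulrC.
Qed.

Lemma rapidN u : rapid u -> rapid (fun x => - u x).
Proof.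
move=> ru; have := temperedM_rapid (tempered_cst (-1)) ru.
by congr rapid; apply/funext => x; rewrite mulN1r.
Qed.

Lemma rapidX (n : nat) u : rapid u -> rapid (fun x => u x ^+ n.+1).
Proof.
move=> ru; have := rapidMr ru (temperedX n (rapid_tempered ru)).
by congr rapid; apply/funext => x; rewrite exprS.
Qed.

Lemma rapid_bound u : rapid u ->
  exists C : R, forall x, `|u x| <= C * (1 + x ^+ 2)^-1.
Proof.
move=> [cu ru]; have [C1 h1] := ru 0%N; have [C2 h2] := ru 2%N.
exists (C1 + C2) => x; rewrite ler_pdivlMr; last by rewrite ltr_pwDl// sqr_ge0.
have := h1 x; have := h2 x; rewrite expr0 mul1r real_normK ?num_real//.
lra.
Qed.

Lemma rapid_Rintegrable u : rapid u -> Rintegrable u.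
Proof.
move=> ru; have [C h] := rapid_bound ru.
apply: (le_Rintegrable _ h); first exact: continuous_measurable_fun ru.1.
exact/RintegrableZ/Rintegrable_oneDsqrV.
Qed.

Lemma rapid_l2 u : rapid u -> l2 u.
Proof.
move=> ru; split; first exact: continuous_measurable_fun ru.1.
by apply: rapid_Rintegrable; exact: rapidX.
Qed.

Lemma rapid_cvg0 u : rapid u ->
  u x @[x --> +oo] --> 0 /\ u x @[x --> -oo] --> 0.
Proof.
move=> [cu /(_ 1%N)[C h]].
have C0 : 0 <= C by have := h 0; apply: le_trans; rewrite mulr_ge0.
have K (x e : R) : 0 < e -> C / e < `|x| -> `|u x| < e.
  move=> e0 xC; have x0 : 0 < `|x| by rewrite (le_lt_trans _ xC)// divr_ge0// ltW.
  have := h x; rewrite expr1 mulrC -ler_pdivlMr// => /le_lt_trans; apply.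
  by rewrite ltr_pdivrMr// mulrC -ltr_pdivrMr.
split; apply/cvgrPdist_lt => e e0; near=> x; rewrite sub0r normrN; apply: K => //.
  apply: lt_le_trans (ler_norm _); near: x; apply: nbhs_pinfty_gt; exact: num_real.
rewrite -normrN; apply: lt_le_trans (ler_norm _); rewrite ltrNr.
near: x; apply: nbhs_ninfty_lt; exact: num_real.
Unshelve. all: by end_near. Qed.

(** Every integration by parts of the a priori estimate passes through this form: the boundary terms
    vanish. *)
Lemma itg_rapid_deriv F G : has_deriv F G -> rapid F -> rapid G -> itg G = 0.
Proof.
move=> FG rF rG; have [Fy FNy] := rapid_cvg0 rF.
by apply: (itg_has_deriv FG) => //; [exact: rG.1|exact: rapid_Rintegrable].
Qed.

End Calculus.

(** * The a priori estimate *)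

Section Pointwise.
Context {R : realType}.
Implicit Types a b s : R.

(** The parameter [s] decides which factor pays: it is tied to the main coefficient when the first
    factor has to be absorbed, and 1 when both squares are harmless. *)
Lemma young_dot (th M s x1 x2 y1 y2 : R) : `|th| <= M -> 0 < s ->
  th * (x1 * y1 + x2 * y2) <=
  M / 2 * (s * (x1 ^+ 2 + x2 ^+ 2) + (y1 ^+ 2 + y2 ^+ 2) / s).
Proof.
move=> thM s0.
apply: (le_trans (ler_norm _)); rewrite normrM.
have M0 : 0 <= M by exact: le_trans thM.
have N0 : `|x1 * y1 + x2 * y2| <=
    (s * (x1 ^+ 2 + x2 ^+ 2) + (y1 ^+ 2 + y2 ^+ 2) / s) / 2.
  have e (x y : R) : s * x ^+ 2 + y ^+ 2 / s = (s * x - y) ^+ 2 / s + 2 * (x * y).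
    by field; rewrite gt_eqF.
  have e' (x y : R) : s * x ^+ 2 + y ^+ 2 / s = (s * x + y) ^+ 2 / s - 2 * (x * y).
    by field; rewrite gt_eqF.
  rewrite (_ : s * _ + _ = (s * x1 ^+ 2 + y1 ^+ 2 / s) + (s * x2 ^+ 2 + y2 ^+ 2 / s)); last by ring.
  rewrite ler_norml; apply/andP; split.
    have : 0 <= (s * x1 + y1) ^+ 2 / s by rewrite divr_ge0 ?sqr_ge0 ?ltW.
    have : 0 <= (s * x2 + y2) ^+ 2 / s by rewrite divr_ge0 ?sqr_ge0 ?ltW.
    by rewrite !e'; lra.
  have : 0 <= (s * x1 - y1) ^+ 2 / s by rewrite divr_ge0 ?sqr_ge0 ?ltW.
  have : 0 <= (s * x2 - y2) ^+ 2 / s by rewrite divr_ge0 ?sqr_ge0 ?ltW.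
  by rewrite !e; lra.
apply: (le_trans (ler_pM _ _ thM N0)) => //.
by rewrite le_eqVlt; apply/orP; left; apply/eqP; ring.
Qed.

(* Here y = x / r, f = u1 + i u2, P = f' / r ^ 3, x ^ 2 - t = r ^ 2 (y ^ 2 - tau),
   k = be r ^ 3, v = - f'' + (a1 + i a2) (x ^ 2 - t) f - k ^ 2 f, and A, S are
   the hyperbolic cosine and sine of m = (4 a2 / be) atan y. The right side comes
   from pairing v with A f and S f' / k; the resulting flux gives the frequencies
   k and - k the weights exp m and exp (- m). *)
Definition multiplier_inequality (a1 a2 be M K : R) : Prop :=
  forall r y tau nu A S u1 u2 P1 P2 v1 v2 : R,
  1 <= r -> 0 <= tau <= 1 -> 0 <= nu -> nu * (1 + y ^+ 2) = 4 * a2 / be ->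
  M^-1 <= A - `|S| -> A <= M ->
  a2 / (4 * M) * r ^+ 4 * (u1 ^+ 2 + u2 ^+ 2)
    - K * (v1 ^+ 2 + v2 ^+ 2 + (1 + y ^+ 2 + y ^+ 4) * (u1 ^+ 2 + u2 ^+ 2)
           + (P1 ^+ 2 + P2 ^+ 2)) <=
  r ^+ 4 * (be * nu + a2 * (y ^+ 2 - tau)) *
    (A * ((P1 ^+ 2 + P2 ^+ 2) / be ^+ 2 + (u1 ^+ 2 + u2 ^+ 2)) / 2
     + S * (u1 * P2 - u2 * P1) / be)
  - r ^+ 2 * A * (v2 * u1 - v1 * u2) - r ^+ 2 * S * (v1 * P1 + v2 * P2) / be
  - a2 / (2 * be ^+ 2 * r ^+ 2) * (y ^+ 2 - tau) * A * (v1 * u1 + v2 * u2)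
  + a2 / (2 * be ^+ 2) * (2 * y * A + (y ^+ 2 - tau) * nu * S) * (P1 * u1 + P2 * u2)
  - a1 / (2 * be) * (2 * y * S + (y ^+ 2 - tau) * nu * A) * (u1 ^+ 2 + u2 ^+ 2).

(** The first product on the right is the main term: its scalar factor is at least [a2] r^4 and its
    quadratic form at least [M^-1 * E / 2]. Of the two terms of order r^2 that contain v, one costs
    a quarter of the |u|^2 part of this bound, the other a quarter of the |P|^2 part. The rest
    carries no positive power of r and goes into [K]. *)
Lemma multiplier_pointwise (a1 a2 be M : R) : 0 < a1 -> 0 < a2 -> 0 < be ->
  1 <= M -> exists K : R, 0 <= K /\ multiplier_inequality a1 a2 be M K.
Proof.
move=> a10 a20 be0 M1.
pose la := 4 * a2 / be.
have la0 : 0 < la by rewrite divr_gt0// mulr_gt0.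
have M0 : 0 < M by rewrite (lt_le_trans _ M1).
(* [K1] collects what Young's inequality leaves of the two terms of order r^2; [K2], [K3] and [K4]
   belong to the last three terms of the inequality, in their order. *)
pose K1 := 4 * M ^+ 3 / a2.
pose K2 := a2 * M / (4 * be ^+ 2) * 2.
pose K3 := a2 * M / (2 * be ^+ 2) * (1 + la).
pose K4 := a1 * M / (2 * be) * (1 + la).
have K10 : 0 <= K1 by rewrite divr_ge0 ?mulr_ge0 ?exprn_ge0// ltW.
have be20 : 0 < be ^+ 2 by rewrite exprn_gt0.
have K20 : 0 <= K2 by rewrite mulr_ge0// divr_ge0 ?mulr_ge0 ?ltW.
have c2 : 0 <= a2 * M / (4 * be ^+ 2).
  by apply: divr_ge0; apply: mulr_ge0; rewrite ?ltW.
have c3 : 0 <= a2 * M / (2 * be ^+ 2).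
  by apply: divr_ge0; apply: mulr_ge0; rewrite ?ltW.
have c4 : 0 <= a1 * M / (2 * be).
  by apply: divr_ge0; apply: mulr_ge0; rewrite ?ltW.
have la1 : 0 <= 1 + la by rewrite addr_ge0// ltW.
have K30 : 0 <= K3 by rewrite mulr_ge0// divr_ge0 ?mulr_ge0 ?ltW.
have K40 : 0 <= K4 by rewrite mulr_ge0// divr_ge0 ?mulr_ge0 ?ltW.
exists (K1 + K2 + K3 + K4); split; first by rewrite !addr_ge0.
move=> r y tau nu A S u1 u2 P1 P2 v1 v2 r1 /andP[tau0 tau1] nu0 nuE AS AM.
pose U := u1 ^+ 2 + u2 ^+ 2; pose P := P1 ^+ 2 + P2 ^+ 2.
pose V := v1 ^+ 2 + v2 ^+ 2; pose q := y ^+ 2 - tau.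
pose N := V + (1 + y ^+ 2 + y ^+ 4) * U + P.
have U0 : 0 <= U by rewrite addr_ge0 ?sqr_ge0.
have P0 : 0 <= P by rewrite addr_ge0 ?sqr_ge0.
have V0 : 0 <= V by rewrite addr_ge0 ?sqr_ge0.
have y20 : 0 <= y ^+ 2 by exact: sqr_ge0.
have y4E : y ^+ 4 = y ^+ 2 * y ^+ 2 by ring.
have r0 : 0 < r by rewrite (lt_le_trans _ r1).
have Mi0 : 0 < M^-1 by rewrite invr_gt0.
have S_A : `|S| <= A by lra.
have A0 : 0 <= A by exact: le_trans S_A.
have absA : `|A| <= M by rewrite ger0_norm.
have absS : `|S| <= M by rewrite (le_trans S_A).
have qnu : `|q * nu| <= la.
  rewrite normrM (ger0_norm nu0) /la -nuE [leRHS]mulrC ler_wpM2r// /q ler_norml.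
  by apply/andP; split; lra.
have y0 : 0 <= y ^+ 2 * U by rewrite mulr_ge0.
have y40 : 0 <= y ^+ 4 * U by rewrite y4E -mulrA mulr_ge0.
have NU : N = V + U + y ^+ 2 * U + y ^+ 4 * U + P by rewrite /N; ring.
have N0 : 0 <= N by rewrite NU; lra.
(* AM-GM: 4 / (1 + y ^ 2) + (1 + y ^ 2) >= 4 *)
have mainc : a2 <= be * nu + a2 * q.
  have s0 : 0 < 1 + y ^+ 2 by rewrite ltr_pwDl.
  have -> : nu = 4 * a2 / be / (1 + y ^+ 2) by rewrite -nuE mulfK ?gt_eqF.
  have -> : be * (4 * a2 / be / (1 + y ^+ 2)) + a2 * q =
    a2 * ((y ^+ 2 - 1) ^+ 2 / (1 + y ^+ 2) + 3 - tau).
    by rewrite /q; field; rewrite !gt_eqF.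
  rewrite ler_peMr// ?ltW//.
  have : 0 <= (y ^+ 2 - 1) ^+ 2 / (1 + y ^+ 2) by rewrite divr_ge0 ?sqr_ge0// ltW.
  lra.
pose E := P / be ^+ 2 + U.
have E0 : 0 <= E by rewrite addr_ge0// divr_ge0// ltW.
(* In the variables u and P / be this form has the double eigenvalues (A + S) / 2 and (A - S) / 2,
   one for each wave; both are at least (A - |S|) / 2. *)
have form : M^-1 * E / 2 <= A * E / 2 + S * (u1 * P2 - u2 * P1) / be.
  have := @young_dot (- S) `|S| 1 u1 u2 (P2 / be) (- P1 / be).
  rewrite normrN lexx ltr01 => /(_ isT isT).
  rewrite (_ : - S * _ = - (S * (u1 * P2 - u2 * P1) / be)); last first.
    by field; rewrite gt_eqF.
  rewrite (_ : `|S| / 2 * _ = `|S| * E / 2); last first.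
    by rewrite /E /P /U; field; rewrite gt_eqF.
  have : M^-1 * E <= (A - `|S|) * E by rewrite ler_wpM2r.
  lra.
have T0 : r ^+ 4 * a2 * (M^-1 * E / 2) <= r ^+ 4 * (be * nu + a2 * q) *
    (A * E / 2 + S * (u1 * P2 - u2 * P1) / be).
  apply: ler_pM => //.
  - by apply: mulr_ge0; [exact/exprn_ge0/ltW|exact: ltW].
  - by apply: divr_ge0 => //; apply: mulr_ge0 => //; exact: ltW.
  - by apply: ler_wpM2l => //; exact/exprn_ge0/ltW.
(* With this [s] Young's inequality uses the coefficient a2 / (8 M) of r^4, a quarter of the
   available a2 / (2 M). *)
pose s := a2 / (4 * M ^+ 2).
have s0 : 0 < s by rewrite divr_gt0// mulr_gt0 ?exprn_gt0.
have T1 : r ^+ 2 * A * (v2 * u1 - v1 * u2) <=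
    a2 / (8 * M) * r ^+ 4 * U + 2 * M ^+ 3 / a2 * V.
  have := @young_dot A M s (r ^+ 2 * u1) (r ^+ 2 * u2) v2 (- v1) absA s0.
  rewrite (_ : A * _ = r ^+ 2 * A * (v2 * u1 - v1 * u2)); last by ring.
  move=> /le_trans; apply; rewrite le_eqVlt; apply/orP; left; apply/eqP.
  by rewrite /s /U /V; field; rewrite !gt_eqF.
have T2 : r ^+ 2 * S * (v1 * P1 + v2 * P2) / be <=
    a2 / (8 * M) * r ^+ 4 * (P / be ^+ 2) + 2 * M ^+ 3 / a2 * V.
  have := @young_dot S M s (r ^+ 2 * P1 / be) (r ^+ 2 * P2 / be) v1 v2 absS s0.
  rewrite (_ : S * _ = r ^+ 2 * S * (v1 * P1 + v2 * P2) / be); last by ring.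
  move=> /le_trans; apply; rewrite le_eqVlt; apply/orP; left; apply/eqP.
  by rewrite /s /P /V; field; rewrite !gt_eqF.
have T3 : a2 / (2 * be ^+ 2 * r ^+ 2) * q * A * (v1 * u1 + v2 * u2) <= K2 * N.
  have c0 : 0 <= a2 / (2 * be ^+ 2) by rewrite divr_ge0 ?mulr_ge0 ?ltW.
  have := @young_dot (A / r ^+ 2) M 1 v1 v2 (q * u1) (q * u2).
  rewrite normrM (ger0_norm A0) => /(_ _ ltr01) H.
  have rr : `|r ^- 2| <= 1.
    rewrite ger0_norm; last by rewrite invr_ge0 exprn_ge0 ?ltW.
    by rewrite invf_le1 ?exprn_gt0// exprn_ege1.
  have {}H := ler_wpM2l c0 (H (le_trans (ler_piMr A0 rr) AM)).
  apply: le_trans (le_trans H _).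
    by rewrite le_eqVlt; apply/orP; left; apply/eqP; field; rewrite !gt_eqF.
  rewrite /K2 (_ : a2 / (2 * be ^+ 2) * _ = a2 * M / (4 * be ^+ 2) *
    (V + q ^+ 2 * U)); last by rewrite /V /U; field; rewrite !gt_eqF.
  rewrite -[leRHS]mulrA ler_wpM2l ?c2 ?c3//.
  have : q ^+ 2 * U <= (2 + 2 * y ^+ 4) * U.
    by rewrite ler_wpM2r// /q y4E; have := sqr_ge0 (y ^+ 2 - 1); nra.
  rewrite NU; lra.
have T4 : - (a2 / (2 * be ^+ 2) * (2 * y * A + q * nu * S) * (P1 * u1 + P2 * u2))
    <= K3 * N.
  have c0 : 0 <= a2 / (2 * be ^+ 2) by rewrite divr_ge0 ?mulr_ge0 ?ltW.
  have absNA : `|- A| <= M by rewrite normrN.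
  have H1 := @young_dot (- A) M 1 P1 P2 (y * u1) (y * u2) absNA ltr01.
  have H2 := @young_dot (- (q * nu * S)) (la * M) 1 P1 P2 u1 u2.
  rewrite normrN normrM (ler_pM _ _ qnu absS)// in H2.
  have {}H2 := H2 isT ltr01.
  have H := ler_wpM2l c0 (lerD (lerD H1 H1) H2).
  apply: le_trans (le_trans H _).
    by rewrite le_eqVlt; apply/orP; left; apply/eqP; field; rewrite !gt_eqF.
  rewrite /K3 [leLHS](_ : _ = a2 * M / (2 * be ^+ 2) *
     ((P + y ^+ 2 * U) + la / 2 * (P + U))); last first.
    by rewrite /P /U; field; rewrite !gt_eqF.
  rewrite -[leRHS]mulrA ler_wpM2l ?c2 ?c3// [leRHS]mulrDl mul1r lerD//.
    by rewrite NU; lra.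
  by rewrite -mulrA ler_wpM2l ?(ltW la0)//; rewrite NU; lra.
have T5 : a1 / (2 * be) * (2 * y * S + q * nu * A) * U <= K4 * N.
  have c0 : 0 <= a1 / (2 * be) by rewrite divr_ge0 ?mulr_ge0 ?ltW.
  have H1 : 2 * y * S + q * nu * A <= M * (1 + y ^+ 2 + la).
    have h1 : 2 * y * S <= M * (1 + y ^+ 2).
      apply: (le_trans (ler_norm _)); rewrite normrM mulrC.
      apply: ler_pM => //; rewrite ler_norml; apply/andP; split.
        by have := sqr_ge0 (y + 1); lra.
      by have := sqr_ge0 (y - 1); lra.
    have h2 : q * nu * A <= M * la.
      by apply: (le_trans (ler_norm _)); rewrite normrM mulrC ler_pM.
    by rewrite mulrDr lerD.
  rewrite -mulrA; apply: (le_trans (ler_wpM2l c0 (ler_wpM2r U0 H1))).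
  rewrite /K4 [leLHS](_ : _ = a1 * M / (2 * be) * ((1 + y ^+ 2) * U + la * U)); last first.
    by ring.
  rewrite -[leRHS]mulrA ler_wpM2l ?c4// [leRHS]mulrDl mul1r lerD//.
    by rewrite NU; lra.
  by rewrite ler_wpM2l ?(ltW la0)//; rewrite NU; lra.
have T12 : K1 * V <= K1 * N by rewrite ler_wpM2l// NU; lra.
have K1E : K1 * V = 2 * M ^+ 3 / a2 * V + 2 * M ^+ 3 / a2 * V by rewrite /K1; ring.
have c5 : 0 <= a2 / (8 * M) * r ^+ 4.
  by apply: mulr_ge0; [apply: divr_ge0; rewrite ?mulr_ge0// ltW|exact/exprn_ge0/ltW].
have Pb : 0 <= a2 / (8 * M) * r ^+ 4 * (P / be ^+ 2).
  by apply: mulr_ge0 => //; apply: divr_ge0 => //; exact: ltW.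
have Ub : 0 <= a2 / (8 * M) * r ^+ 4 * U by exact: mulr_ge0.
have EE : r ^+ 4 * a2 * (M^-1 * E / 2) =
    4 * (a2 / (8 * M) * r ^+ 4 * (P / be ^+ 2)) + 4 * (a2 / (8 * M) * r ^+ 4 * U).
  by rewrite /E; field; rewrite !gt_eqF.
have UE : a2 / (4 * M) * r ^+ 4 * U = 2 * (a2 / (8 * M) * r ^+ 4 * U).
  by field; rewrite gt_eqF.
rewrite -/U -/P -/V -/q -/N -/E UE.
rewrite EE in T0; rewrite K1E in T12.
move: T0 T1 T2 T3 T4 T5 T12 Pb Ub.
rewrite !(mulrDl _ _ N).
set X0 := r ^+ 4 * (be * nu + a2 * q) * _.
set X1 := r ^+ 2 * A * _; set X2 := r ^+ 2 * S * _ / be.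
set X3 := a2 / (2 * be ^+ 2 * r ^+ 2) * _ * _ * _.
set X4 := a2 / (2 * be ^+ 2) * _ * _.
set X5 := a1 / (2 * be) * _ * _.
lra.
Qed.

End Pointwise.

(** * Syntax-directed proofs of derivatives, polynomial growth and rapid decay *)

Ltac derive1 :=
  match goal with
  | H : has_deriv ?f _ |- has_deriv ?f _ => exact H
  | |- has_deriv (fun x => x) _ => apply has_deriv_id
  | |- has_deriv (fun x => ?f x) _ => match goal with H : has_deriv f _ |- _ => exact H end
  | |- has_deriv (fun _ => ?c) _ => apply (has_deriv_cst c)
  | |- has_deriv (fun x => @?u x + @?v x) _ => eapply (@has_derivD _ u v)
  | |- has_deriv (fun x => - @?u x) _ => eapply (@has_derivN _ u)
  | |- has_deriv (fun x => @?u x * @?v x) _ => eapply (@has_derivM _ u v)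
  | |- has_deriv (fun x => @?u x ^+ ?n.+1) _ => eapply (@has_derivX _ n u)
  end.
Ltac derive := repeat derive1.
Ltac tempered1 :=
  match goal with
  | H : tempered ?f |- tempered ?f => exact H
  | H : rapid ?f |- tempered ?f => exact (rapid_tempered H)
  | |- tempered (fun x => x) => apply tempered_id
  | |- tempered (fun x => ?f x) => match goal with
       H : tempered f |- _ => exact H | H : rapid f |- _ => exact (rapid_tempered H) end
  | |- tempered (fun _ => ?c) => apply (tempered_cst c)
  | |- tempered (fun x => @?u x + @?v x) => apply (@temperedD _ u v)
  | |- tempered (fun x => - @?u x) => apply (@temperedN _ u)
  | |- tempered (fun x => @?u x * @?v x) => apply (@temperedM _ u v)
  | |- tempered (fun x => @?u x ^+ ?n) => apply (@temperedX _ n u)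
  end.
Ltac rapid1 :=
  match goal with
  | H : rapid ?f |- rapid ?f => exact H
  | |- rapid (fun x => ?f x) => match goal with H : rapid f |- _ => exact H end
  | |- rapid (fun x => @?u x + @?v x) => apply (@rapidD _ u v); rapid1
  | |- rapid (fun x => - @?u x) => apply (@rapidN _ u); rapid1
  | |- rapid (fun x => @?u x * @?v x) =>
      first [ apply (@rapidMr _ u v); [rapid1 | solve [repeat tempered1]]
            | apply (@temperedM_rapid _ u v); [solve [repeat tempered1] | rapid1] ]
  | |- rapid (fun x => @?u x ^+ ?n.+1) => apply (@rapidX _ n u); rapid1
  end.

Section Apriori.
Context {R : realType}.
Local Notation mu := (@lebesgue_measure R).

Lemma Rintegrable_itg_lin5 (c0 c1 c2 c3 c4 : R) (f0 f1 f2 f3 f4 : R -> R) :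
  Rintegrable f0 -> Rintegrable f1 -> Rintegrable f2 -> Rintegrable f3 -> Rintegrable f4 ->
  let f := fun x => c0 * f0 x + (c1 * f1 x + (c2 * f2 x + (c3 * f3 x + c4 * f4 x))) in
  Rintegrable f /\
  itg f = c0 * itg f0 + (c1 * itg f1 + (c2 * itg f2 + (c3 * itg f3 + c4 * itg f4))).
Proof.
move=> i0 i1 i2 i3 i4 f.
have {}i0' := RintegrableZ c0 i0; have {}i1' := RintegrableZ c1 i1.
have {}i2' := RintegrableZ c2 i2; have {}i3' := RintegrableZ c3 i3.
have {}i4' := RintegrableZ c4 i4.
have j3 := RintegrableD i3' i4'; have j2 := RintegrableD i2' j3.
have j1 := RintegrableD i1' j2; have j0 := RintegrableD i0' j1.
by split => //; rewrite /f !itgD// !itgZ.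
Qed.

(* Each integral identity of the energy method is used as a pointwise bound by
   a total derivative G. *)
Lemma itg_lin5_le0 (c0 c1 c2 c3 c4 : R) (f0 f1 f2 f3 f4 F G : R -> R) :
  Rintegrable f0 -> Rintegrable f1 -> Rintegrable f2 -> Rintegrable f3 -> Rintegrable f4 ->
  has_deriv F G -> rapid F -> rapid G ->
  (forall x, c0 * f0 x + (c1 * f1 x + (c2 * f2 x + (c3 * f3 x + c4 * f4 x))) <= G x) ->
  c0 * itg f0 + (c1 * itg f1 + (c2 * itg f2 + (c3 * itg f3 + c4 * itg f4))) <= 0.
Proof.
move=> i0 i1 i2 i3 i4 FG rF rG h.
have [sf <-] := Rintegrable_itg_lin5 c0 c1 c2 c3 c4 i0 i1 i2 i3 i4.
rewrite -(itg_rapid_deriv FG rF rG); apply: le_itg => //.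
exact: rapid_Rintegrable.
Qed.

(* the hyperbolic cosine and sine of la * atan (x / r) *)
Lemma hyperbolic_weights (la : R) : 0 < la -> exists M : R, 1 <= M /\
  forall r : R, 0 < r -> exists A S nu : R -> R,
  [/\ has_deriv A (fun x => nu x / r * S x), has_deriv S (fun x => nu x / r * A x),
      continuous nu,
      forall x, 0 <= nu x /\ nu x * (1 + (x / r) ^+ 2) = la
    & forall x, M^-1 <= A x - `|S x| /\ A x <= M].
Proof.
move=> la0; pose M := expR (la * (pi / 2)).
have M1 : 1 <= M.
  by rewrite -expR0 ler_expR mulr_ge0 ?divr_ge0 ?pi_ge0// ltW.
exists M; split => // r r0.
pose m (x : R) := la * atan (x * r^-1).
pose nu (x : R) := la * (1 + (x * r^-1) ^+ 2)^-1.
have s0 (x : R) : 0 < 1 + (x * r^-1) ^+ 2 by rewrite ltr_pwDl// sqr_ge0.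
have hm : has_deriv m (fun x => nu x / r).
  apply: eq_has_deriv.
    apply: has_derivM; first exact: has_deriv_cst.
    by apply: has_deriv_atan; derive.
  by move=> x; rewrite /nu /=; ring.
have hp : has_deriv (fun x => expR (m x)) (fun x => expR (m x) * (nu x / r)).
  exact: has_deriv_expR.
have hn : has_deriv (fun x => expR (- m x)) (fun x => - expR (- m x) * (nu x / r)).
  by apply: (eq_has_deriv (has_deriv_expR (has_derivN hm))) => x; ring.
exists (fun x => (expR (m x) + expR (- m x)) * 2^-1).
exists (fun x => (expR (m x) + - expR (- m x)) * 2^-1), nu; split.
- by apply: eq_has_deriv; [derive|move=> x /=; ring].
- by apply: eq_has_deriv; [derive|move=> x /=; ring].
- suff h : has_deriv (fun x => (1 + (x * r^-1) ^+ 2)^-1)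
      (fun x => - (1 + (x * r^-1) ^+ 2) ^- 2 * (2 * (x * r^-1) * r^-1)).
    move=> x; apply: cvgM; first exact: cvg_cst.
    exact: (has_deriv_continuous h).
  move=> x; apply: is_deriveV; first by rewrite gt_eqF.
  have /(_ x) : has_deriv (fun y => 1 + (y * r^-1) ^+ 2) (fun y => 2 * (y * r^-1) * r^-1).
    by apply: eq_has_deriv; [derive|move=> y /=; ring].
  by [].
- move=> x; split; first by rewrite /nu mulr_ge0 ?invr_ge0// ltW.
  by rewrite /nu mulfVK// gt_eqF.
- move=> x.
  have mb : `|m x| <= la * (pi / 2).
    rewrite normrM gtr0_norm// ler_wpM2l ?(ltW la0)// ler_norml; apply/andP; split; apply: ltW.
      exact: atan_gtNpi2.
    exact: atan_ltpi2.
  have Mi : M^-1 = expR (- (la * (pi / 2))) by rewrite expRN.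
  move: mb; rewrite ler_norml => /andP[mb1 mb2].
  have e1 : expR (m x) <= M by rewrite ler_expR.
  have e2 : expR (- m x) <= M by rewrite ler_expR lerNl.
  have e3 : M^-1 <= expR (m x) by rewrite Mi ler_expR.
  have e4 : M^-1 <= expR (- m x) by rewrite Mi ler_expR lerN2.
  split; last by lra.
  by have [?|?] := ger0P ((expR (m x) + - expR (- m x)) * 2^-1); lra.
Qed.

(** * The four integral estimates for one rapidly decreasing function *)

Section Estimate.
Variables (a1 a2 be : R) (a10 : 0 < a1) (a20 : 0 < a2) (be0 : 0 < be).

Section FixedFunction.
Variables (r t : R) (r1 : 1 <= r) (t0 : 0 <= t) (tr : t <= r ^+ 2).
Variables u1 u2 p1 p2 q1 q2 : R -> R.
Hypotheses (hu1 : has_deriv u1 p1) (hu2 : has_deriv u2 p2)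
  (hp1 : has_deriv p1 q1) (hp2 : has_deriv p2 q2)
  (ru1 : rapid u1) (ru2 : rapid u2) (rp1 : rapid p1) (rp2 : rapid p2)
  (rq1 : rapid q1) (rq2 : rapid q2).
Let ka := (be * r ^+ 3) ^+ 2.
Let v1 x := - q1 x + (x ^+ 2 + - t) * (a1 * u1 x + - (a2 * u2 x)) + - (ka * u1 x).
Let v2 x := - q2 x + (x ^+ 2 + - t) * (a1 * u2 x + a2 * u1 x) + - (ka * u2 x).
Let y x := x * r^-1.
Let P1 x := p1 x * r ^- 3.
Let P2 x := p2 x * r ^- 3.
Let n0 x := u1 x ^+ 2 + u2 x ^+ 2.
Let n2 x := y x ^+ 2 * n0 x.
Let n4 x := y x ^+ 4 * n0 x.
Let nP x := P1 x ^+ 2 + P2 x ^+ 2.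
Let nV x := v1 x ^+ 2 + v2 x ^+ 2.
Let r0 : 0 < r. Proof. exact: lt_le_trans r1. Qed.
Let rn0 : r != 0. Proof. by rewrite gt_eqF. Qed.

Let rv1 : rapid v1. Proof. rewrite /v1; rapid1. Qed.
Let rv2 : rapid v2. Proof. rewrite /v2; rapid1. Qed.
Let s0 : Rintegrable n0. Proof. apply: rapid_Rintegrable; rewrite /n0; rapid1. Qed.
Let s2 : Rintegrable n2. Proof. apply: rapid_Rintegrable; rewrite /n2 /n0 /y; rapid1. Qed.
Let s4 : Rintegrable n4. Proof. apply: rapid_Rintegrable; rewrite /n4 /n0 /y; rapid1. Qed.
Let sP : Rintegrable nP. Proof. apply: rapid_Rintegrable; rewrite /nP /P1 /P2; rapid1. Qed.
Let sV : Rintegrable nV. Proof. apply: rapid_Rintegrable; rewrite /nV; rapid1. Qed.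

Let w x := u1 x * p2 x + - (u2 x * p1 x).
Let hw : has_deriv w (fun x => u1 x * q2 x + - (u2 x * q1 x)).
Proof. by rewrite /w; apply: eq_has_deriv; [derive|move=> x /=; ring]. Qed.
Let rw : rapid w.
Proof. by rewrite /w; rapid1. Qed.

Let ri2 : r ^- 2 <= 1. Proof. by rewrite invf_le1 ?exprn_gt0// exprn_ege1. Qed.

(** The imaginary part of the pairing of v with f, in which f'' contributes only the derivative of
    the flux [w] = Im (conj f f'). The wrong sign for x^2 < t is moved to the right as |f|^2, by t
    <= r^2. *)
Lemma weight2_estimate :
  1 * itg n2 + (- (1 + 1 / (2 * a2)) * itg n0 + (- (1 / (2 * a2)) * itg nV
    + (0 * itg n4 + 0 * itg nP))) <= 0.
Proof.
apply: (itg_lin5_le0 (F := fun x => (a2 * r ^+ 2)^-1 * w x)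
  (G := fun x => (a2 * r ^+ 2)^-1 * (u1 x * q2 x + - (u2 x * q1 x))) s2 s0 sV s4 sP).
- by apply: eq_has_deriv; [derive|move=> x /=; ring].
- by rapid1.
- by rapid1.
move=> x.
have -> : (a2 * r ^+ 2)^-1 * (u1 x * q2 x - u2 x * q1 x) =
    n2 x - t * r ^- 2 * n0 x - r ^- 2 * (v2 x * u1 x - v1 x * u2 x) / a2.
  by rewrite /n2 /n0 /y /v1 /v2; field; rewrite rn0 gt_eqF.
have tt : t * r ^- 2 * n0 x <= n0 x.
  rewrite ler_piMl ?addr_ge0 ?sqr_ge0//.
  by rewrite ler_pdivrMr ?exprn_gt0// mul1r.
have h : r ^- 2 * (v2 x * u1 x - v1 x * u2 x) <= (n0 x + nV x) / 2.
  have := @young_dot R (r ^- 2) 1 1 (u1 x) (u2 x) (v2 x) (- v1 x).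
  rewrite ger0_norm ?invr_ge0 ?exprn_ge0// ?(ltW r0)// => /(_ ri2 ltr01).
  by rewrite /n0 /nV; lra.
have {}h : r ^- 2 * (v2 x * u1 x - v1 x * u2 x) / a2 <= (n0 x + nV x) / 2 / a2.
  by rewrite ler_wpM2r// invr_ge0 ltW.
have e : (n0 x + nV x) / 2 / a2 = 1 / (2 * a2) * n0 x + 1 / (2 * a2) * nV x.
  by field; rewrite gt_eqF.
rewrite e in h; rewrite !mul0r; lra.
Qed.

(** The real part of the pairing of v with f. As a1 > 0, the term a1 x^2 |f|^2 has the favourable
    sign and is dropped; dividing by r^6, the order of k^2, makes the constants independent of r. *)
Lemma energy_estimate :
  1 * itg nP + (- (be ^+ 2 + a1 + 1 / 2) * itg n0 + (- (1 / 2) * itg nV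
    + (0 * itg n4 + 0 * itg n2))) <= 0.
Proof.
apply: (itg_lin5_le0 (F := fun x => r ^- 6 * (p1 x * u1 x + p2 x * u2 x))
  (G := fun x => r ^- 6 * (q1 x * u1 x + p1 x * p1 x + (q2 x * u2 x + p2 x * p2 x))) sP s0 sV s4 s2).
- by apply: eq_has_deriv; [derive|move=> x /=; ring].
- by rapid1.
- by rapid1.
move=> x.
have -> : r ^- 6 * (q1 x * u1 x + p1 x * p1 x + (q2 x * u2 x + p2 x * p2 x)) =
   nP x - be ^+ 2 * n0 x + a1 * (r ^- 6 * (x ^+ 2 - t) * n0 x)
   - r ^- 6 * (v1 x * u1 x + v2 x * u2 x).
  by rewrite /nP /n0 /P1 /P2 /v1 /v2 /ka; field.
have ri6 : r ^- 6 <= 1 by rewrite invf_le1 ?exprn_gt0// exprn_ege1.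
have h : r ^- 6 * (v1 x * u1 x + v2 x * u2 x) <= (n0 x + nV x) / 2.
  have := @young_dot R (r ^- 6) 1 1 (u1 x) (u2 x) (v1 x) (v2 x).
  rewrite ger0_norm ?invr_ge0 ?exprn_ge0// ?(ltW r0)// => /(_ ri6 ltr01).
  by rewrite /n0 /nV; lra.
have n00 : 0 <= n0 x by rewrite addr_ge0 ?sqr_ge0.
have h2 : - n0 x <= r ^- 6 * (x ^+ 2 - t) * n0 x.
  rewrite -mulN1r ler_wpM2r// -[leLHS]mulr1.
  have r60 : 0 <= r ^- 6 by rewrite invr_ge0 exprn_ge0// ltW.
  have r24 : r ^- 6 * r ^+ 2 <= 1.
    rewrite (_ : r ^- 6 * r ^+ 2 = r ^- 4); last by field.
    by rewrite invf_le1 ?exprn_gt0// exprn_ege1.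
  have : r ^- 6 * t <= r ^- 6 * r ^+ 2 by rewrite ler_wpM2l.
  have : 0 <= r ^- 6 * x ^+ 2 by rewrite mulr_ge0// sqr_ge0.
  lra.
have := ler_wpM2l (ltW a10) h2.
rewrite !mul0r; lra.
Qed.

(** The imaginary part of the pairing of v with x^2 f, wanted because the multiplier leaves an error
    y^4 |f|^2. The variable weight produces 2 x [w], which y f and P control. Young's inequality
    with s = a2 / 2 spends a quarter of the coefficient a2, whence 3 a2 / 4. *)
Lemma weight4_estimate :
  3 * a2 / 4 * itg n4 + (- (a2 + 1) * itg n2 + (- a2^-1 * itg nV
    + (- 1 * itg nP + 0 * itg n0))) <= 0.
Proof.
apply: (itg_lin5_le0 (F := fun x => r ^- 4 * (x ^+ 2 * w x))
  (G := fun x => r ^- 4 * (2 * x * w x + x ^+ 2 * (u1 x * q2 x + - (u2 x * q1 x)))) s4 s2 sV sP s0).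
- by apply: eq_has_deriv; [derive|move=> x /=; ring].
- by rapid1.
- by rapid1.
move=> x.
have -> : r ^- 4 * (2 * x * w x + x ^+ 2 * (u1 x * q2 x + - (u2 x * q1 x))) =
   a2 * n4 x - a2 * (t * r ^- 2 * n2 x)
   - r ^- 2 * (y x ^+ 2 * (v2 x * u1 x - v1 x * u2 x))
   + 2 * y x * (u1 x * P2 x - u2 x * P1 x).
  by rewrite /n4 /n2 /n0 /w /P1 /P2 /y /v1 /v2; field.
have n00 : 0 <= n0 x by rewrite addr_ge0 ?sqr_ge0.
have n20 : 0 <= n2 x by rewrite mulr_ge0 ?sqr_ge0.
have tt : t * r ^- 2 * n2 x <= n2 x.
  by rewrite ler_piMl// ler_pdivrMr ?exprn_gt0// mul1r.
have h : r ^- 2 * (y x ^+ 2 * (v2 x * u1 x - v1 x * u2 x)) <=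
    a2 / 4 * n4 x + a2^-1 * nV x.
  have a220 : 0 < a2 / 2 by rewrite divr_gt0.
  have := @young_dot R (r ^- 2) 1 (a2 / 2) (y x ^+ 2 * u1 x) (y x ^+ 2 * u2 x) (v2 x) (- v1 x).
  rewrite ger0_norm ?invr_ge0 ?exprn_ge0// ?(ltW r0)// => /(_ ri2 a220).
  rewrite (_ : r ^- 2 * _ = r ^- 2 * (y x ^+ 2 * (v2 x * u1 x - v1 x * u2 x))); last by ring.
  move=> /le_trans; apply; rewrite le_eqVlt; apply/orP; left; apply/eqP.
  by rewrite /n4 /n0 /nV; field; rewrite gt_eqF.
have h2 : - (2 * y x * (u1 x * P2 x - u2 x * P1 x)) <= n2 x + nP x.
  have := @young_dot R (- 2) 2 1 (y x * u1 x) (y x * u2 x) (P2 x) (- P1 x).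
  rewrite normrN ger0_norm// lexx => /(_ isT ltr01).
  by rewrite /n2 /n0 /nP; lra.
have := ler_wpM2l (ltW a20) tt.
rewrite mul0r; lra.
Qed.

Lemma multiplier_estimate (M K : R) (A S nu : R -> R) :
  has_deriv A (fun x => nu x / r * S x) -> has_deriv S (fun x => nu x / r * A x) ->
  continuous nu ->
  (forall x, 0 <= nu x /\ nu x * (1 + (x / r) ^+ 2) = 4 * a2 / be) ->
  (forall x, M^-1 <= A x - `|S x| /\ A x <= M) -> 0 < M ->
  multiplier_inequality a1 a2 be M K ->
  (a2 / (4 * M) * r ^+ 4 - K) * itg n0 + (- K * itg nV + (- K * itg n2
    + (- K * itg n4 + - K * itg nP))) <= 0.
Proof.
move=> hA hS cnu nuE AS M0 main.
have tA : tempered A.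
  apply: (@bounded_tempered _ _ M); first exact: has_deriv_continuous hA.
  move=> x; have [h1 h2] := AS x; rewrite ger0_norm//.
  have : 0 < M^-1 by rewrite invr_gt0.
  by have := normr_ge0 (S x); lra.
have tS : tempered S.
  apply: (@bounded_tempered _ _ M); first exact: has_deriv_continuous hS.
  move=> x; have [h1 h2] := AS x.
  have : 0 < M^-1 by rewrite invr_gt0.
  lra.
have tnu : tempered nu.
  apply: (@bounded_tempered _ _ (4 * a2 / be)) => // x.
  have [h1 <-] := nuE x; rewrite ger0_norm// ler_peMr// lerDl sqr_ge0//.
pose k := be * r ^+ 3.
have k0 : k != 0 by rewrite mulf_neq0 ?expf_neq0// gt_eqF.
pose Q x := x ^+ 2 + - t.
(* The last two terms are the weighted flux of the two waves. The first replaces half of a2 Q A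
   |f|^2 by a2 Q A |f'|^2 / (2 k^2), so that Q multiplies the same quadratic form as the derivative
   of m does. The second cancels a1 Q S Re (conj f f') / k. *)
pose F x := r ^+ 2 * (a2 / (2 * ka) * (Q x * A x * (p1 x * u1 x + p2 x * u2 x))
  + - (a1 / (2 * k) * (S x * Q x * (u1 x ^+ 2 + u2 x ^+ 2)))
  + A x * w x + (2 * k)^-1 * (S x * (p1 x ^+ 2 + p2 x ^+ 2 + ka * (u1 x ^+ 2 + u2 x ^+ 2)))).
pose G x := r ^+ 2 * (a2 / (2 * ka) *
     ((2 * x * A x + Q x * (nu x / r * S x)) * (p1 x * u1 x + p2 x * u2 x)
      + Q x * A x * (q1 x * u1 x + p1 x ^+ 2 + q2 x * u2 x + p2 x ^+ 2))
  + - (a1 / (2 * k) * ((nu x / r * A x * Q x + S x * (2 * x)) * (u1 x ^+ 2 + u2 x ^+ 2)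
      + S x * Q x * (2 * (u1 x * p1 x) + 2 * (u2 x * p2 x))))
  + (nu x / r * S x * w x + A x * (u1 x * q2 x + - (u2 x * q1 x)))
  + (2 * k)^-1 * (nu x / r * A x * (p1 x ^+ 2 + p2 x ^+ 2 + ka * (u1 x ^+ 2 + u2 x ^+ 2))
     + S x * (2 * (p1 x * q1 x) + 2 * (p2 x * q2 x) + ka * (2 * (u1 x * p1 x) + 2 * (u2 x * p2 x))))).
apply: (itg_lin5_le0 (F := F) (G := G) s0 sV s2 s4 sP).
- by rewrite /F /G /Q; apply: eq_has_deriv; [derive|move=> x /=; ring].
- by rewrite /F /Q; rapid1.
- by rewrite /G /Q; rapid1.
move=> x.
have [nu0 nu1] := nuE x; have [AS1 AS2] := AS x.
have tau01 : 0 <= t * r ^- 2 <= 1.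
  rewrite divr_ge0 ?exprn_ge0// ?(ltW r0)//=.
  by rewrite ler_pdivrMr ?exprn_gt0// mul1r.
have := main r (y x) (t * r ^- 2) (nu x) (A x) (S x) (u1 x) (u2 x) (P1 x) (P2 x)
  (v1 x) (v2 x) r1 tau01 nu0 nu1 AS1 AS2.
set lhs := (X in X <= _ -> _); set rhs := (X in _ <= X -> _) => h.
have -> : (a2 / (4 * M) * r ^+ 4 - K) * n0 x +
   (- K * nV x + (- K * n2 x + (- K * n4 x + - K * nP x))) = lhs.
  by rewrite /lhs /n2 /n4 /nV /nP /n0; ring.
(* The first term of [F] also meets the potential inside f'', which yields this multiple of Q^2
   |f|^2; it is nonnegative since a1 and a2 are positive. *)
pose drop := a1 * a2 / (2 * be ^+ 2 * r ^+ 4) * (Q x ^+ 2 * A x * n0 x).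
have drop0 : 0 <= drop.
  have A0 : 0 <= A x.
    have : 0 < M^-1 by rewrite invr_gt0.
    by have := normr_ge0 (S x); lra.
  apply: mulr_ge0.
    apply: divr_ge0; first by rewrite mulr_ge0 ?ltW.
    by apply: mulr_ge0; rewrite ?exprn_ge0 ?(ltW r0)// mulr_ge0// exprn_ge0// ltW.
  apply: mulr_ge0; first by apply: mulr_ge0 => //; exact: sqr_ge0.
  by rewrite addr_ge0 ?sqr_ge0.
apply: (le_trans h).
suff e : rhs + drop = G x by rewrite -e lerDl.
rewrite /rhs /drop /G /n0 /P1 /P2 /y /v1 /v2 /w /Q /ka /k; field.
by rewrite rn0 gt_eqF.
Qed.

End FixedFunction.
End Estimate.
End Apriori.

Ltac pos := repeat first [ assumption | exact: ltr01 | by rewrite ltr0n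
  | simple apply ltW | apply: addr_gt0 | apply: mulr_gt0 | rewrite invr_gt0 ].

Section AprioriBound.
Context {R : realType}.

(* f = u1 + i u2 is rapidly decreasing, p = f' and
   v = - f'' + (a1 + i a2) (x ^ 2 - t) f - ka f *)
Definition rapid_solution (a1 a2 ka t : R)
    (u1 u2 p1 p2 v1 v2 : R -> R) : Prop :=
  exists q1 q2 : R -> R,
  [/\ [/\ has_deriv u1 p1, has_deriv u2 p2, has_deriv p1 q1 & has_deriv p2 q2],
      [/\ rapid u1, rapid u2, rapid p1, rapid p2 & rapid q1 /\ rapid q2],
      v1 = (fun x => - q1 x + (x ^+ 2 + - t) * (a1 * u1 x + - (a2 * u2 x)) + - (ka * u1 x))
    & v2 = (fun x => - q2 x + (x ^+ 2 + - t) * (a1 * u2 x + a2 * u1 x) + - (ka * u2 x))].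

(** The auxiliary estimates turn the multiplier estimate into c r^4 I <= K (m0 I + mV V), where I
    and V are the integrals of |f|^2 and |v|^2; beyond [r0] half of the left side absorbs the term
    in I. The constant [C] may depend on r and t: it serves only the convergence in the form
    domain. *)
Lemma apriori_bound (a1 a2 be : R) : 0 < a1 -> 0 < a2 -> 0 < be ->
  exists K r0 : R, [/\ 0 < K, 1 <= r0 &
  forall r t : R, r0 <= r -> 0 <= t -> t <= r ^+ 2 ->
  (forall u1 u2 p1 p2 v1 v2 : R -> R,
    rapid_solution a1 a2 ((be * r ^+ 3) ^+ 2) t u1 u2 p1 p2 v1 v2 ->
    r ^+ 4 * itg (fun x => u1 x ^+ 2 + u2 x ^+ 2) <=
    K * itg (fun x => v1 x ^+ 2 + v2 x ^+ 2)) /\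
  exists C : R, 0 <= C /\ forall u1 u2 p1 p2 v1 v2 : R -> R,
    rapid_solution a1 a2 ((be * r ^+ 3) ^+ 2) t u1 u2 p1 p2 v1 v2 ->
    itg (fun x => p1 x ^+ 2 + p2 x ^+ 2) <=
      C * itg (fun x => v1 x ^+ 2 + v2 x ^+ 2) /\
    itg (fun x => x ^+ 2 * (u1 x ^+ 2 + u2 x ^+ 2)) <=
      C * itg (fun x => v1 x ^+ 2 + v2 x ^+ 2)].
Proof.
move=> a10 a20 be0.
have la0 : 0 < 4 * a2 / be by rewrite divr_gt0// mulr_gt0.
have [M [M1 weights]] := hyperbolic_weights la0.
have M0 : 0 < M by rewrite (lt_le_trans _ M1).
have [K [K0 main]] := multiplier_pointwise a10 a20 be0 M1.
pose c := a2 / (4 * M).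
have c0 : 0 < c by rewrite divr_gt0// mulr_gt0.
(* [e0], [eV] and [g0] are the constants of [weight2_estimate] and [energy_estimate], and [h] is the
   inverse of 3 a2 / 4 in [weight4_estimate]; [m0] and [mV] add up the resulting coefficients of I
   and V. *)
pose e0 := 1 + 1 / (2 * a2); pose eV := 1 / (2 * a2).
pose g0 := be ^+ 2 + a1 + 1 / 2.
have a2i : 0 < a2^-1 by rewrite invr_gt0.
have eV0 : 0 < eV by rewrite divr_gt0// mulr_gt0.
have e00 : 0 < e0 by rewrite addr_gt0.
have be20 : 0 < be ^+ 2 by rewrite exprn_gt0.
have g00 : 0 < g0 by rewrite !addr_gt0// divr_gt0.
pose h := 4 / (3 * a2).
have h0 : 0 < h by rewrite divr_gt0// mulr_gt0.
pose m0 := 1 + e0 + g0 + h * ((a2 + 1) * e0 + g0).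
pose mV := 1 + eV + 1 / 2 + h * ((a2 + 1) * eV + a2^-1 + 1 / 2).
have a21 : 0 < a2 + 1 by rewrite addr_gt0.
have m00 : 0 < m0 by rewrite /m0; pos.
have mV0 : 0 < mV by rewrite /mV; pos.
have D0 : 0 < 2 * (K * mV + 1) / c.
  apply: divr_gt0 => //; apply: mulr_gt0 => //; apply: ltr_pwDr => //.
  by apply: mulr_ge0 => //; exact: ltW.
have R0 : 0 <= 2 * K * m0 / c.
  by apply: divr_ge0; [apply: mulr_ge0; [exact: mulr_ge0|exact: ltW]|exact: ltW].
exists (2 * (K * mV + 1) / c), (1 + 2 * K * m0 / c); split.
- exact: D0.
- by rewrite lerDl.
move=> r t rr t0 tr.
have r1 : 1 <= r.
  by apply: le_trans rr; rewrite lerDl.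
have r0 : 0 < r by rewrite (lt_le_trans _ r1).
have r4 : 2 * (K * m0) <= c * r ^+ 4.
  have h1 : 2 * K * m0 / c <= r by lra.
  rewrite ler_pdivrMr// mulrC mulrA in h1.
  have : c * r <= c * r ^+ 4.
    by rewrite ler_wpM2l ?(ltW c0)// -[leLHS]expr1 ler_weXn2l.
  by rewrite mulrC; lra.
have key (u1 u2 p1 p2 v1 v2 : R -> R) :
    rapid_solution a1 a2 ((be * r ^+ 3) ^+ 2) t u1 u2 p1 p2 v1 v2 ->
    let I := itg (fun x => u1 x ^+ 2 + u2 x ^+ 2) in
    let V := itg (fun x => v1 x ^+ 2 + v2 x ^+ 2) in
    [/\ r ^+ 4 * I <= 2 * (K * mV + 1) / c * V,
    itg (fun x => p1 x ^+ 2 + p2 x ^+ 2) <= r ^+ 6 * (g0 * I + V / 2) &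
    itg (fun x => x ^+ 2 * (u1 x ^+ 2 + u2 x ^+ 2)) <= r ^+ 2 * (e0 * I + eV * V)].
  move=> [q1 [q2 [[hu1 hu2 hp1 hp2] [ru1 ru2 rp1 rp2 [rq1 rq2]] -> ->]]] I V.
  have [A [S [nu [hA hS cnu nuE AS]]]] := weights r r0.
  have H1 := @weight2_estimate _ a1 a2 be a20 r t r1 tr u1 u2 p1 p2 q1 q2 hu1 hu2 hp1 hp2 ru1 ru2 rp1 rp2 rq1 rq2.
  have H2 := @energy_estimate _ a1 a2 be a10 r t r1 tr u1 u2 p1 p2 q1 q2 hu1 hu2 hp1 hp2 ru1 ru2 rp1 rp2 rq1 rq2.
  have H3 := @weight4_estimate _ a1 a2 be a20 r t r1 tr u1 u2 p1 p2 q1 q2 hu1 hu2 hp1 hp2 ru1 ru2 rp1 rp2 rq1 rq2.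
  have H4 := @multiplier_estimate _ a1 a2 be a10 a20 be0 r t r1 t0 tr u1 u2 p1 p2 q1 q2 hu1 hu2 hp1 hp2 ru1 ru2
    rp1 rp2 rq1 rq2 M K A S nu hA hS cnu nuE AS M0 main.
  move: H1 H2 H3 H4; rewrite -/I -/V -/c.
  set N2 := itg (fun x => (x * r^-1) ^+ 2 * _).
  set N4 := itg (fun x => (x * r^-1) ^+ 4 * _).
  set NP := itg (fun x => (p1 x * r ^- 3) ^+ 2 + _).
  move=> H1 H2 H3 H4.
  have I0 : 0 <= I by apply: itg_ge0 => x; rewrite addr_ge0 ?sqr_ge0.
  have V0 : 0 <= V by apply: itg_ge0 => x; rewrite addr_ge0 ?sqr_ge0.
  have N2b : N2 <= e0 * I + eV * V by rewrite /e0 /eV; lra.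
  have NPb : NP <= g0 * I + V / 2 by rewrite /g0; lra.
  have N4b : N4 <= h * ((a2 + 1) * N2 + a2^-1 * V + NP).
    have -> : N4 = h * (3 * a2 / 4 * N4) by rewrite /h; field; rewrite gt_eqF.
    by rewrite ler_wpM2l ?(ltW h0)//; lra.
  have sumb : V + I + N2 + N4 + NP <= m0 * I + mV * V.
    have h1 := ler_wpM2l (ltW a21) N2b.
    have h2 : h * ((a2 + 1) * N2 + a2^-1 * V + NP) <=
       h * ((a2 + 1) * (e0 * I + eV * V) + a2^-1 * V + (g0 * I + V / 2)).
      by rewrite ler_wpM2l ?(ltW h0)//; lra.
    apply: (@le_trans _ _ (V + I + (e0 * I + eV * V) +
       h * ((a2 + 1) * (e0 * I + eV * V) + a2^-1 * V + (g0 * I + V / 2)) +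
       (g0 * I + V / 2))); first by lra.
    by rewrite le_eqVlt; apply/orP; left; apply/eqP; rewrite /m0 /mV; ring.
  split.
  - have h1 := ler_wpM2l K0 sumb.
    have h2 := ler_wpM2r I0 r4.
    have h3 : c * (r ^+ 4 * I) <= 2 * (K * mV) * V by lra.
    rewrite (_ : _ / c * V = (2 * (K * mV + 1)) * V / c); last by ring.
    by rewrite ler_pdivlMr// mulrC; lra.
  - have sP : rapid (fun x => (p1 x * r ^- 3) ^+ 2 + (p2 x * r ^- 3) ^+ 2) by rapid1.
    rewrite (_ : (fun x => _) = (fun x => r ^+ 6 *
        ((p1 x * r ^- 3) ^+ 2 + (p2 x * r ^- 3) ^+ 2))); last first.
      by apply/funext => x; field; rewrite gt_eqF.
    rewrite itgZ; last exact: rapid_Rintegrable.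
    by rewrite ler_wpM2l// exprn_ge0// ltW.
  - have sP : rapid (fun x => (x * r^-1) ^+ 2 * (u1 x ^+ 2 + u2 x ^+ 2)) by rapid1.
    rewrite (_ : (fun x => _) = (fun x => r ^+ 2 *
        ((x * r^-1) ^+ 2 * (u1 x ^+ 2 + u2 x ^+ 2)))); last first.
      by apply/funext => x; field; rewrite gt_eqF.
    rewrite itgZ; last exact: rapid_Rintegrable.
    by rewrite ler_wpM2l// exprn_ge0// ltW.
split; first by move=> u1 u2 p1 p2 v1 v2 /key[].
pose D := 2 * (K * mV + 1) / c.
have D0' : 0 <= D by exact: ltW.
have r6 : 0 <= r ^+ 6 by rewrite exprn_ge0// ltW.
have r2 : 0 <= r ^+ 2 by rewrite exprn_ge0// ltW.
have C10 : 0 <= r ^+ 6 * (g0 * D + 1 / 2).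
  apply: mulr_ge0 => //; apply: addr_ge0; last exact: divr_ge0.
  by apply: mulr_ge0 => //; exact: ltW.
have C20 : 0 <= r ^+ 2 * (e0 * D + eV).
  apply: mulr_ge0 => //; apply: addr_ge0; last exact: ltW.
  by apply: mulr_ge0 => //; exact: ltW.
exists (r ^+ 6 * (g0 * D + 1 / 2) + r ^+ 2 * (e0 * D + eV)).
split; first exact: addr_ge0.
move=> u1 u2 p1 p2 v1 v2 /key [].
set I := itg (fun x => u1 x ^+ 2 + _); set V := itg (fun x => v1 x ^+ 2 + _).
rewrite -/D => h1 h2 h3.
have I0 : 0 <= I by apply: itg_ge0 => x; rewrite addr_ge0 ?sqr_ge0.
have V0 : 0 <= V by apply: itg_ge0 => x; rewrite addr_ge0 ?sqr_ge0.
have ID : I <= D * V.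
  by apply: le_trans h1; rewrite ler_peMl// exprn_ege1.
have C1V := mulr_ge0 C10 V0; have C2V := mulr_ge0 C20 V0.
rewrite mulrDl; split.
  apply: (le_trans h2); rewrite -[leLHS]addr0; apply: lerD => //.
  rewrite -mulrA; apply: ler_wpM2l => //.
  by have := ler_wpM2l (ltW g00) ID; lra.
apply: (le_trans h3); rewrite -[leLHS]add0r; apply: lerD => //.
rewrite -mulrA; apply: ler_wpM2l => //.
by have := ler_wpM2l (ltW e00) ID; lra.
Qed.

End AprioriBound.

(** * The moment problem *)

Section Moments.
Context {R : realType}.
Local Notation mu := (@lebesgue_measure R).

(** Coefficients bounded by 1 cover the series of sin and cos at once; the bound is uniform in [N],
    as dominated convergence requires. *)
Lemma partial_exp_le (s : nat -> R) (y : R) (N : nat) : (forall k, `|s k| <= 1) ->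
  `|\sum_(0 <= k < N) s k * y ^+ k / k`!%:R| <= expR `|y|.
Proof.
move=> s1; apply: (le_trans (ler_norm_sum _ _ _)).
apply: (@le_trans _ _ (series (exp_coeff `|y|) N)).
  rewrite /series /=; apply: ler_sum => k _.
  rewrite /exp_coeff /= !normrM normrX normfV (ger0_norm (ler0n _ _)).
  by rewrite ler_wpM2r ?invr_ge0// ler_piMl// exprn_ge0.
apply: nondecreasing_cvgn_le; last exact: is_cvg_series_exp_coeff.
apply: nondecreasing_series => k _ _.
by rewrite /exp_coeff /= divr_ge0// exprn_ge0.
Qed.

Variable w : R -> R.
Hypothesis wexp : forall s : R, Rintegrable (fun x => w x * expR (s * `|x|)).
Hypothesis wmom : forall n, itg (fun x => w x * x ^+ n) = 0.

Let mw : measurable_fun setT w.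
Proof.
have := Rintegrable_measurable (wexp 0).
by congr measurable_fun; apply/funext => x; rewrite mul0r expR0 mulr1.
Qed.

(** All moments of w f are asked to vanish because partial sums of a power series multiply f by
    polynomials; boundedness of f keeps these products integrable. *)
Definition annihilated (f : R -> R) : Prop :=
  [/\ continuous f, exists C : R, forall x, `|f x| <= C
    & forall n, itg (fun x => w x * (x ^+ n * f x)) = 0].

Let bound_pow (n : nat) (x : R) : `|x| ^+ n <= n`!%:R * expR `|x|.
Proof.
rewrite mulrC -ler_pdivrMr ?ltr0n ?fact_gt0//.
have := @expR_ge1Dxn R `|x| n.-1 (normr_ge0 _).
case: n => [|n /=]; last by apply: le_trans; rewrite lerDr.
move=> _; rewrite expr0 fact0 divr1.
by have := @expR_ge1Dx R `|x|; apply: le_trans; rewrite lerDl.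
Qed.

Let summable_pow (n : nat) (s C : R) (g : R -> R) : 0 <= s -> continuous g ->
  (forall x, `|g x| <= C * expR (s * `|x|)) ->
  Rintegrable (fun x => w x * (x ^+ n * g x)).
Proof.
move=> s0 cg gC.
apply: (@le_Rintegrable _ _ (fun x => (n`!%:R * `|C|) * `|w x * expR ((1 + s) * `|x|)|)).
- apply: measurable_funM => //; apply: measurable_funM.
    by apply: measurable_funX; exact: measurable_id.
  exact: continuous_measurable_fun.
- move=> x; rewrite !normrM normrX (ger0_norm (expR_ge0 _)) mulrDl mul1r expRD.
  have h1 := bound_pow n x.
  have h2 : `|g x| <= `|C| * expR (s * `|x|).
    by apply: (le_trans (gC x)); rewrite ler_wpM2r ?expR_ge0// ler_norm.
  have h := ler_pM (exprn_ge0 n (normr_ge0 x)) (normr_ge0 _) h1 h2.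
  apply: (le_trans (ler_wpM2l (normr_ge0 (w x)) h)).
  by rewrite le_eqVlt; apply/orP; left; apply/eqP; ring.
- by apply: RintegrableZ; apply: Rintegrable_norm; exact: wexp.
Qed.

Lemma annihilated1 : annihilated (fun=> 1).
Proof.
split; first exact: cst_continuous.
  by exists 1 => x; rewrite normr1.
move=> n; rewrite -[RHS](wmom n); congr itg; apply/funext => x.
by rewrite mulr1.
Qed.

Let summ_ann (f : R -> R) n : annihilated f -> Rintegrable (fun x => w x * (x ^+ n * f x)).
Proof.
move=> [cf [C fC] _]; apply: (@summable_pow _ 0 C) => // x.
by rewrite mul0r expR0 mulr1.
Qed.

Lemma annihilatedD f g : annihilated f -> annihilated g ->
  annihilated (fun x => f x + g x).
Proof.
move=> nf ng; have [cf [C fC] f0] := nf; have [cg [D gD] g0] := ng.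
split; first by move=> x; exact: cvgD (cf x) (cg x).
  by exists (C + D) => x; apply: (le_trans (ler_normD _ _)); exact: lerD.
move=> n; have -> : (fun x => w x * (x ^+ n * (f x + g x))) =
  (fun x => w x * (x ^+ n * f x) + w x * (x ^+ n * g x)).
  by apply/funext => x; ring.
by rewrite itgD ?f0 ?g0 ?addr0//; exact: summ_ann.
Qed.

Lemma annihilatedZ (k : R) f : annihilated f -> annihilated (fun x => k * f x).
Proof.
move=> nf; have [cf [C fC] f0] := nf.
split; first by move=> x; exact: cvgM (cvg_cst _) (cf x).
  by exists (`|k| * C) => x; rewrite normrM ler_wpM2l.
move=> n; have -> : (fun x => w x * (x ^+ n * (k * f x))) =
  (fun x => k * (w x * (x ^+ n * f x))).
  by apply/funext => x; ring.
by rewrite itgZ ?f0 ?mulr0//; exact: summ_ann.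
Qed.

(** A partial sum of the power series keeps all moments zero, and the products are dominated by |w|
    |x|^n C exp (|xi| |x|), which is integrable because w decays faster than every exponential in
    the mean. *)
Lemma annihilatedM_entire (s : nat -> R) (e : R -> R) (xi : R) f :
  continuous e -> (forall k, `|s k| <= 1) -> (forall y, `|e y| <= 1) ->
  (forall y, \sum_(0 <= k < N) s k * y ^+ k / k`!%:R @[N --> \oo] --> e y) ->
  annihilated f -> annihilated (fun x => f x * e (xi * x)).
Proof.
move=> ce s1 e1 se nf; have [cf [C fC] f0] := nf.
have C0 : 0 <= C by exact: le_trans (fC 0).
have cex : continuous (fun x => e (xi * x)).
  move=> x; apply: (@continuous_comp _ _ _ (fun x => xi * x) e); last exact: ce.
  by apply: cvgM; [exact: cvg_cst|exact: cvg_id].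
split; first by move=> x; exact: cvgM (cf x) (cex x).
  by exists C => x; rewrite normrM (le_trans _ (fC x))// ler_piMr.
move=> n.
pose S N y := \sum_(0 <= k < N) s k * y ^+ k / k`!%:R.
have cS N : continuous (fun x => S N (xi * x)).
  elim: N => [|N IH].
    rewrite (_ : (fun _ => _) = fun=> 0); first exact: cst_continuous.
    by apply/funext => x; rewrite /S big_nil.
  rewrite (_ : (fun _ => _) = fun x => S N (xi * x) +
     (s N / N`!%:R * xi ^+ N) * x ^+ N); last first.
    by apply/funext => x; rewrite /S big_nat_recr//= exprMn; congr (_ + _); ring.
  move=> x; apply: cvgD; first exact: IH.
  by apply: cvgM; [exact: cvg_cst|exact: exprn_continuous].
have bS N x : `|f x * S N (xi * x)| <= C * expR (`|xi| * `|x|).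
  by rewrite normrM ler_pM// -normrM partial_exp_le.
have cfS N : continuous (fun x => f x * S N (xi * x)).
  by move=> x; exact: cvgM (cf x) (cS N x).
pose g N x := w x * (x ^+ n * (f x * S N (xi * x))).
have ig N : Rintegrable (g N) by exact: (@summable_pow _ `|xi| C).
have g0 N : itg (g N) = 0.
  have : forall m, itg (fun x => w x * (x ^+ m * (f x * S N (xi * x)))) = 0.
    elim: N => [|N IH] m.
      rewrite -[RHS]itg0; congr itg; apply/funext => x.
      by rewrite /S big_nil !mulr0.
    have -> : (fun x => w x * (x ^+ m * (f x * S N.+1 (xi * x)))) =
      (fun x => w x * (x ^+ m * (f x * S N (xi * x))) +
        (s N / N`!%:R * xi ^+ N) * (w x * (x ^+ (m + N) * f x))).
      apply/funext => x; rewrite /S big_nat_recr//= exprMn exprD.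
      set A := \sum_(_ <= _ < _) _; by ring.
    rewrite itgD ?IH ?add0r ?itgZ ?f0 ?mulr0//; try exact: summ_ann.
      exact: (@summable_pow _ `|xi| C).
    by apply: RintegrableZ; exact: summ_ann.
  exact.
pose G x := `|w x * (x ^+ n * (C * expR (`|xi| * `|x|)))|.
have iG : Rintegrable G.
  apply: Rintegrable_norm; apply: (@summable_pow _ `|xi| C) => //.
    move=> x; apply: cvgM; first exact: cvg_cst.
    apply: (@continuous_comp _ _ _ (fun x => `|xi| * `|x|) expR); last exact: continuous_expR.
    by apply: cvgM; [exact: cvg_cst|exact: norm_continuous].
  by move=> x; rewrite normrM (ger0_norm C0) (ger0_norm (expR_ge0 _)).
have [|||_] := @dominated_itg R g (fun x => w x * (x ^+ n * (f x * e (xi * x)))) G _ _ iG.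
- by move=> N; exact: Rintegrable_measurable.
- move=> x; apply: cvgM; first exact: cvg_cst.
  apply: cvgM; first exact: cvg_cst.
  by apply: cvgM; [exact: cvg_cst|exact: se].
- move=> N x; rewrite /g /G !normrM ler_wpM2l// ler_wpM2l//.
  have := bS N x; rewrite normrM => /le_trans; apply.
  by rewrite -normrM ler_norm.
by under eq_fun do rewrite g0; move=> /cvg_lim <- //; rewrite lim_cst.
Qed.

Lemma annihilated_sin (xi th : R) f : annihilated f ->
  annihilated (fun x => f x * sin (xi * x + th)).
Proof.
move=> nf.
have -> : (fun x => f x * sin (xi * x + th)) =
  (fun x => cos th * (f x * sin (xi * x)) + sin th * (f x * cos (xi * x))).
  by apply/funext => x; rewrite sinD; ring.
apply: annihilatedD; apply: annihilatedZ.
- apply: (@annihilatedM_entire (fun k => (odd k)%:R * (-1) ^+ k.-1./2)) => //.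
  + exact: continuous_sin.
  + by move=> k; rewrite normrM normrX normrN1 expr1n mulr1; case: odd; rewrite ?normr1 ?normr0.
  + by move=> y; rewrite ler_norml sin_geN1 sin_le1.
  + move=> y; have -> : sin y = limn (series (sin_coeff y)) by rewrite unlock.
    exact: is_cvg_series_sin_coeff.
- apply: (@annihilatedM_entire (fun k => (~~ odd k)%:R * (-1) ^+ k./2)) => //.
  + exact: continuous_cos.
  + by move=> k; rewrite normrM normrX normrN1 expr1n mulr1; case: odd; rewrite ?normr1 ?normr0.
  + by move=> y; rewrite ler_norml cos_geN1 cos_le1.
  + move=> y; have -> : cos y = limn (series (cos_coeff y)) by rewrite unlock.
    exact: is_cvg_series_cos_coeff.
Qed.

Let Y (xi th x : R) : R := (1 + sin (xi * x + th)) / 2.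

(** [Y] is a sine rescaled to [0, 1]; these polynomials in it are the ones that approximate a
    step. *)
Lemma annihilated_onemXX (xi th : R) (m j : nat) :
  annihilated (fun x => (1 - Y xi th x ^+ m) ^+ j).
Proof.
have stepY f : annihilated f -> annihilated (fun x => f x * Y xi th x).
  move=> nf.
  have -> : (fun x => f x * Y xi th x) =
    (fun x => 2^-1 * f x + 2^-1 * (f x * sin (xi * x + th))).
    by apply/funext => x; rewrite /Y; ring.
  by apply: annihilatedD; apply: annihilatedZ => //; exact: annihilated_sin.
have stepYm f : annihilated f -> annihilated (fun x => f x * Y xi th x ^+ m).
  move=> nf; elim: m => [|k IH].
    by have := nf; congr annihilated; apply/funext => x; rewrite mulr1.
  by have := stepY _ IH; congr annihilated; apply/funext => x; rewrite exprSr mulrA.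
elim: j => [|j IH]; first exact: annihilated1.
have := annihilatedD IH (annihilatedZ (-1) (stepYm _ IH)).
by congr annihilated; apply/funext => x; rewrite exprSr; ring.
Qed.

Lemma bernoulli_ineq (a : R) n : -1 <= a -> 1 + n%:R * a <= (1 + a) ^+ n.
Proof.
move=> a1; elim: n => [|n IH]; first by rewrite mul0r addr0.
rewrite exprSr; have a10 : 0 <= 1 + a by lra.
apply: le_trans (ler_wpM2r a10 IH).
rewrite -natr1; have : 0 <= n%:R :> R by [].
by have := sqr_ge0 a; nra.
Qed.

(** From (1 - a) (1 + a) <= 1 and Bernoulli's inequality for (1 + a)^n. *)
Lemma onem_expr_le (a : R) n : 0 <= a <= 1 -> (1 - a) ^+ n <= (1 + n%:R * a)^-1.
Proof.
move=> /andP[a0 a1].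
have p : 0 < 1 + n%:R * a by rewrite ltr_pwDl// mulr_ge0.
rewrite -[leRHS]mul1r ler_pdivlMr//.
have h0 : 0 <= (1 - a) ^+ n by rewrite exprn_ge0// subr_ge0.
apply: (@le_trans _ _ ((1 - a) ^+ n * (1 + a) ^+ n)).
  by rewrite ler_wpM2l// bernoulli_ineq//; lra.
rewrite -exprMn exprn_ile1//.
  by rewrite mulr_ge0// ?subr_ge0// addr_ge0.
by have := sqr_ge0 a; nra.
Qed.

Lemma sin_lower : exists d : R, 0 < d <= 1 /\
  forall s : R, 0 <= s < d -> s / 2 <= sin s.
Proof.
have : \forall s \near (0 : R), 1 / 2 < cos s.
  apply: (@cvgr_gt R R (nbhs (0 : R)) _ cos (cos 0)); first exact: continuous_cos.
  by rewrite cos0 ltr_pdivrMr// mul1r ltr1n.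
move=> /nbhs_ballP[d /= d0 hd].
exists (Num.min d 1); rewrite lt_min d0 ltr01 ge_min lexx orbT; split => //.
move=> s /andP[]; rewrite le_eqVlt => /predU1P[<-|s0]; first by rewrite mul0r sin0.
rewrite lt_min => /andP[sd s1].
have [|c] := @MVT R sin cos 0 s s0 (fun x _ => is_derive_sin x).
  by apply: continuous_subspaceT; exact: continuous_sin.
rewrite sin0 !subr0 in_itv /= => /andP[c0 cs] ->.
have : 1 / 2 < cos c.
  by apply: hd; rewrite /ball /= sub0r normrN gtr0_norm// (lt_trans cs).
by move=> ?; rewrite mulrC ler_wpM2r ?(ltW s0)//; lra.
Qed.

(* (1 - y ^ m) ^ (2 ^ m) is close to 1 for y < 1/2 and to 0 for y > 1/2. With
   N = n + 1, m = N ^ 2 and y = (1 + sin ((x - p) / N)) / 2 it converges to the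
   indicator function of x < p, as m * sin ((x - p) / N) behaves like N (x - p). *)
Let g (p : R) (n : nat) (x : R) : R :=
  (1 - Y (n.+1%:R)^-1 (- p / n.+1%:R) x ^+ (n.+1 ^ 2)) ^+ (2 ^ (n.+1 ^ 2)).

Let Y01 xi th x : 0 <= Y xi th x <= 1.
Proof.
rewrite /Y; have := sin_geN1 (xi * x + th); have := sin_le1 (xi * x + th).
by move=> h1 h2; apply/andP; split; lra.
Qed.

Let g01 p n x : 0 <= g p n x <= 1.
Proof.
rewrite /g; set y := Y _ _ _; have /andP[y0 y1] := Y01 (n.+1%:R)^-1 (- p / n.+1%:R) x.
have h0 : 0 <= y ^+ (n.+1 ^ 2) by rewrite exprn_ge0.
have h1 : y ^+ (n.+1 ^ 2) <= 1 by rewrite exprn_ile1.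
by rewrite exprn_ge0 ?subr_ge0//= exprn_ile1// ?subr_ge0// gerBl.
Qed.

(** Here 2^m y^m = (1 + sin s)^m. To the right of p this is at least 1 + m sin s, and (1 -
    y^m)^(2^m) <= 1 / (1 + 2^m y^m). To the left, Bernoulli's inequality gives (1 - y^m)^(2^m) >= 1
    - (1 - |sin s|)^m. In both cases m |sin s| >= m |s| / 2 = N |x - p| / 2. *)
Let g_dist p n x s : s = (x - p) / n.+1%:R -> `|s| <= 1 ->
  (0 <= s -> s / 2 <= sin s -> g p n x <= (1 + n.+1%:R * (x - p) / 2)^-1) /\
  (s <= 0 -> - s / 2 <= - sin s -> 1 - (1 + n.+1%:R * (p - x) / 2)^-1 <= g p n x).
Proof.
move=> sE s1; rewrite /g; set m := (n.+1 ^ 2)%N.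
have N0 : 0 < n.+1%:R :> R by [].
have -> : Y (n.+1%:R)^-1 (- p / n.+1%:R) x = (1 + sin s) / 2.
  by rewrite /Y sE; congr ((1 + sin _) / 2); ring.
set y := (1 + sin s) / 2.
have mE : m%:R = n.+1%:R * n.+1%:R :> R by rewrite /m natrX expr2.
have sge := sin_geN1 s; have sle := sin_le1 s.
have y0 : 0 <= y by rewrite /y; lra.
have y1 : y <= 1 by rewrite /y; lra.
have ym0 : 0 <= y ^+ m by rewrite exprn_ge0.
have ym1 : y ^+ m <= 1 by rewrite exprn_ile1.
have e2 : 2 ^+ m * y ^+ m = (1 + sin s) ^+ m.
  by rewrite -exprMn; congr (_ ^+ _); rewrite /y; field.
have sN : n.+1%:R * s = x - p by rewrite sE; field; rewrite gt_eqF.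
split=> s0 sins.
- apply: (le_trans (@onem_expr_le (y ^+ m) _ _)); first by rewrite ym0.
  have mm : (1 + n.+1%:R * (x - p) / 2) <= 1 + (2 ^ m)%:R * y ^+ m.
    rewrite lerD2l natrX e2; apply: (le_trans _ (@bernoulli_ineq (sin s) m _)) => //.
    apply: (@le_trans _ _ (m%:R * (s / 2))).
      by rewrite mE -sN; rewrite le_eqVlt; apply/orP; left; apply/eqP; ring.
    apply: (@le_trans _ _ (m%:R * sin s)); first by rewrite ler_wpM2l.
    by rewrite lerDr.
  have pp : 0 < 1 + n.+1%:R * (x - p) / 2.
    by rewrite ltr_pwDl// -sN !mulr_ge0.
  by rewrite lef_pV2// posrE// (lt_le_trans pp).
- apply: (le_trans _ (@bernoulli_ineq (- y ^+ m) _ _)); last by rewrite lerN2.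
  rewrite natrX mulrN e2 lerD2l lerN2.
  have b0 : 0 <= - sin s <= 1 by apply/andP; split; lra.
  have := @onem_expr_le _ m b0; rewrite opprK => /le_trans; apply.
  have pp : 0 < 1 + n.+1%:R * (p - x) / 2.
    by rewrite ltr_pwDl// -opprB -sN -mulrN !mulr_ge0// oppr_ge0.
  have mm : 1 + n.+1%:R * (p - x) / 2 <= 1 + m%:R * - sin s.
    rewrite lerD2l; apply: (@le_trans _ _ (m%:R * (- s / 2))); last by rewrite ler_wpM2l.
    by rewrite mE -opprB -sN; rewrite le_eqVlt; apply/orP; left; apply/eqP; ring.
  by rewrite lef_pV2// posrE// (lt_le_trans pp).
Qed.

Let g_cvg p x : x != p -> g p n x @[n --> \oo] --> ((x <= p)%R%:R : R).
Proof.
move=> xp; have [d [/andP[d0 d1] sind]] := sin_lower.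
have tp : 0 < `|x - p| by rewrite normr_gt0 subr_eq0.
have c0 : (1 + n.+1%:R * `|x - p| / 2)^-1 @[n --> \oo] --> (0 : R).
  apply/gtr0_cvgV0; first by near=> n; rewrite ltr_pwDl// divr_ge0// mulr_ge0.
  apply/cvgryPge => A; near=> n.
  have : 2 * A / `|x - p| <= n%:R by near: n; exact: nbhs_infty_ger.
  rewrite ler_pdivrMr// => h.
  have : n%:R * `|x - p| <= n.+1%:R * `|x - p| by rewrite ler_wpM2r// ler_nat.
  by move=> h2; lra.
have ev : \forall n \near \oo, `|(x - p) / n.+1%:R| < d.
  near=> n; rewrite normrM normfV (ger0_norm (ler0n _ _)) ltr_pdivrMr//.
  have : `|x - p| / d <= n%:R by near: n; exact: nbhs_infty_ger.
  rewrite ler_pdivrMr// mulrC => /le_lt_trans; apply.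
  by rewrite ltr_pM2l// ltr_nat.
apply/cvgrPdist_le => e e0.
have ev2 : \forall n \near \oo, (1 + n.+1%:R * `|x - p| / 2)^-1 <= e.
  move/cvgrPdist_le : c0 => /(_ e e0); apply: filterS => n.
  by rewrite sub0r normrN; apply: le_trans; exact: ler_norm.
apply: filterS2 ev ev2 => n sd ce.
have s1 : `|(x - p) / n.+1%:R| <= 1 by rewrite ltW// (lt_le_trans sd).
have [h1 h2] := @g_dist p n x _ erefl s1.
have /andP[G0 G1] := g01 p n x.
have [xlp|px] := leP x p.
- have s0 : (x - p) / n.+1%:R <= 0 by rewrite ler_pdivrMr// mul0r subr_le0.
  have tE : `|x - p| = p - x by rewrite ler0_norm ?opprB// subr_le0.
  rewrite /= mulr1n ger0_norm ?subr_ge0//.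
  have : 1 - (1 + n.+1%:R * (p - x) / 2)^-1 <= g p n x.
    apply: h2 => //; rewrite -sinN; apply: sind.
    by rewrite oppr_ge0 s0 /= -(ler0_norm s0).
  rewrite tE in ce.
  by lra.
- have s0 : 0 <= (x - p) / n.+1%:R by rewrite divr_ge0// subr_ge0 ltW.
  have tE : `|x - p| = x - p by rewrite gtr0_norm// subr_gt0.
  rewrite /= mulr0n sub0r normrN ger0_norm//.
  have : g p n x <= (1 + n.+1%:R * (x - p) / 2)^-1.
    by apply: h1 => //; apply: sind; rewrite s0 /= -(ger0_norm s0).
  rewrite tE in ce.
  by lra.
Unshelve. all: by end_near. Qed.

Let iw : Rintegrable w.
Proof.
by have := wexp 0; congr Rintegrable; apply/funext => x; rewrite mul0r expR0 mulr1.
Qed.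

Let itg_half p : itg (fun x => w x * (x <= p)%R%:R) = 0.
Proof.
have mle : measurable_fun setT (fun x : R => (x <= p)%R%:R : R).
  rewrite (_ : (fun _ => _) = \1_(`]-oo, p]%classic : set R)).
    by apply: measurable_indic.
  by apply/funext => x; rewrite indicE; congr ((_ : bool)%:R); rewrite mem_setE in_itv.
have cg n : continuous (g p n) by have [] := annihilated_onemXX (n.+1%:R)^-1 (- p / n.+1%:R) (n.+1 ^ 2) (2 ^ (n.+1 ^ 2)).
have [||||_] := @ae_dominated_itg R (fun n x => w x * g p n x) (fun x => w x * (x <= p)%R%:R)
   (fun x => `|w x|) _ _ _ (Rintegrable_norm iw).
- by move=> n; apply: measurable_funM => //; exact: continuous_measurable_fun.
- exact: measurable_funM.
- exists [set p]; split => //; first exact: lebesgue_measure_set1.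
  move=> x /= h; apply: contrapT => /eqP xp; apply: h.
  by apply: cvgM; [exact: cvg_cst|exact: g_cvg].
- move=> n x; have /andP[G0 G1] := g01 p n x.
  by rewrite normrM ler_piMr// ger0_norm.
rewrite (_ : (fun n => itg (fun x => w x * g p n x)) = fun=> 0).
  by move/cvg_lim; rewrite lim_cst// => <-.
apply/funext => n.
have [_ _ /(_ 0%N)] := annihilated_onemXX (n.+1%:R)^-1 (- p / n.+1%:R) (n.+1 ^ 2) (2 ^ (n.+1 ^ 2)).
by move=> <-; congr itg; apply/funext => x; rewrite expr0 mul1r.
Qed.

(** Indicators of half-lines are bounded pointwise limits, off one point, of annihilated functions.
    Hence the primitive of w from minus infinity vanishes identically, and Lebesgue's
    differentiation theorem recovers w from it. *)
Lemma moments_eq0 : {ae mu, forall x, w x = 0}.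
Proof.
have iwT : mu.-integrable setT (EFin \o w) by exact: iw.
have iwy y : mu.-integrable `]-oo, y] (EFin \o w).
  by apply: integrableS iwT.
have lw : locally_integrable setT w by apply: open_integrable_locally iwT; exact: openT.
have F0 : (fun y => \int[mu]_(t in `]-oo, y]) w t) = cst 0.
  apply/funext => y; rewrite /= -[RHS](itg_half y) Rintegral_mkcond /itg.
  congr Rintegral; apply/funext => x; rewrite patchE mem_setE in_itv /=.
  by case: ifPn; rewrite ?mulr1 ?mulr0.
have := FTC1Ny iwy lw; rewrite /= F0.
by apply: ae_imp => x [_]; rewrite derive1_cst.
Qed.

End Moments.

(** * Polynomials times a complex Gaussian *)

Local Notation cRe := complex.Re.
Local Notation cIm := complex.Im.

Section ComplexCalculus.
Context {R : realType}.
Local Notation C := R[i].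
Implicit Types F G : R -> R[i].

Lemma ReD (z w : C) : cRe (z + w) = cRe z + cRe w.
Proof. by case: z w => [? ?] [? ?]. Qed.
Lemma ImD (z w : C) : cIm (z + w) = cIm z + cIm w.
Proof. by case: z w => [? ?] [? ?]. Qed.
Lemma ReN (z : C) : cRe (- z) = - cRe z.
Proof. by case: z. Qed.
Lemma ImN (z : C) : cIm (- z) = - cIm z.
Proof. by case: z. Qed.
Lemma ReM (z w : C) : cRe (z * w) = cRe z * cRe w - cIm z * cIm w.
Proof. by case: z w => [? ?] [? ?]. Qed.
Lemma ImM (z w : C) : cIm (z * w) = cRe z * cIm w + cIm z * cRe w.
Proof. by case: z w => [? ?] [? ?]. Qed.
Lemma ReC (x : R) : cRe (x%:C)%C = x. Proof. by []. Qed.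
Lemma ImC (x : R) : cIm (x%:C)%C = 0. Proof. by []. Qed.
Lemma ReJ (z : C) : cRe (conjc z) = cRe z. Proof. by case: z. Qed.
Lemma ImJ (z : C) : cIm (conjc z) = - cIm z. Proof. by case: z. Qed.
Lemma complexP (z w : C) : cRe z = cRe w -> cIm z = cIm w -> z = w.
Proof. by case: z w => [? ?] [? ?] /= -> ->. Qed.

Definition reim := (ReD, ImD, ReN, ImN, ReM, ImM, ReC, ImC, ReJ, ImJ).

Definition has_cderiv F G : Prop :=
  has_deriv (fun x => cRe (F x)) (fun x => cRe (G x)) /\
  has_deriv (fun x => cIm (F x)) (fun x => cIm (G x)).

Definition crapid F : Prop := rapid (fun x => cRe (F x)) /\ rapid (fun x => cIm (F x)).

Lemma eq_has_cderiv F G G' : has_cderiv F G -> G =1 G' -> has_cderiv F G'.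
Proof. by move=> FG /funext <-. Qed.

Lemma has_cderiv_cst (c : C) : has_cderiv (fun=> c) (fun=> 0).
Proof. by split; exact: has_deriv_cst. Qed.

Lemma has_cderiv_id : has_cderiv (fun x => x%:C%C) (fun=> 1).
Proof. by split; [exact: has_deriv_id|exact: has_deriv_cst]. Qed.

Lemma has_cderivD F G F' G' : has_cderiv F F' -> has_cderiv G G' ->
  has_cderiv (fun x => F x + G x) (fun x => F' x + G' x).
Proof.
move=> [f1 f2] [g1 g2]; split.
  by have := has_derivD f1 g1; congr has_deriv; apply/funext => x; rewrite reim.
by have := has_derivD f2 g2; congr has_deriv; apply/funext => x; rewrite reim.
Qed.

Lemma has_cderivM F G F' G' : has_cderiv F F' -> has_cderiv G G' ->
  has_cderiv (fun x => F x * G x) (fun x => F' x * G x + F x * G' x).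
Proof.
move=> [f1 f2] [g1 g2]; split.
  rewrite (_ : (fun _ => cRe _) = fun x => cRe (F x) * cRe (G x) + - (cIm (F x) * cIm (G x))).
    by apply: eq_has_deriv; [derive|move=> x /=; rewrite !reim; ring].
  by apply/funext => x; rewrite reim.
rewrite (_ : (fun _ => cIm _) = fun x => cRe (F x) * cIm (G x) + cIm (F x) * cRe (G x)).
  by apply: eq_has_deriv; [derive|move=> x /=; rewrite !reim; ring].
by apply/funext => x; rewrite reim.
Qed.

Lemma crapidD F G : crapid F -> crapid G -> crapid (fun x => F x + G x).
Proof.
move=> [f1 f2] [g1 g2]; split.
  by have := rapidD f1 g1; congr rapid; apply/funext => x; rewrite reim.
by have := rapidD f2 g2; congr rapid; apply/funext => x; rewrite reim.
Qed.

Lemma crapidZ (c : C) F : crapid F -> crapid (fun x => c * F x).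
Proof.
move=> [f1 f2]; split.
  rewrite (_ : (fun _ => cRe _) = fun x => cRe c * cRe (F x) + - (cIm c * cIm (F x))).
    by rapid1.
  by apply/funext => x; rewrite reim.
rewrite (_ : (fun _ => cIm _) = fun x => cRe c * cIm (F x) + cIm c * cRe (F x)).
  by rapid1.
by apply/funext => x; rewrite reim.
Qed.

Lemma crapidMx F : crapid F -> crapid (fun x => x%:C%C * F x).
Proof.
move=> [f1 f2]; split.
  rewrite (_ : (fun _ => cRe _) = fun x => x * cRe (F x)); first by rapid1.
  by apply/funext => x; rewrite !reim mul0r subr0.
rewrite (_ : (fun _ => cIm _) = fun x => x * cIm (F x)); first by rapid1.
by apply/funext => x; rewrite !reim mul0r addr0.
Qed.

Lemma has_cderiv_horner (P : {poly C}) :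
  has_cderiv (fun x : R => P.[x%:C%C]) (fun x => P^`().[x%:C%C]).
Proof.
elim/poly_ind: P => [|P c IH].
  rewrite deriv0 (_ : (fun _ => _) = fun=> 0); last by apply/funext => x; rewrite horner0.
  exact: has_cderiv_cst.
have := has_cderivD (has_cderivM IH has_cderiv_id) (has_cderiv_cst c).
rewrite (_ : (fun _ => _ + c) = (fun x => (P * 'X + c%:P).[x%:C%C])); last first.
  by apply/funext => x; rewrite hornerMXaddC.
move/eq_has_cderiv; apply => x.
by rewrite derivD derivM derivX derivC !hornerE.
Qed.

End ComplexCalculus.

(** * Gaussian polynomials and the conjugated operator *)

Section GaussianPolynomials.
Context {R : realType}.
Local Notation C := R[i].
Variables a s : R.
Hypothesis a0 : 0 < a.

(* a square root of the coefficient c of x ^ 2 *)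
Definition alpha : C := Complex a s.

(** This is exp (- alpha x^2 / 2), split into modulus and phase. *)
Definition gauss (x : R) : C :=
  (expR (- (a / 2 * x ^+ 2)))%:C%C *
  Complex (cos (s / 2 * x ^+ 2)) (- sin (s / 2 * x ^+ 2)).

Definition polygauss (P : {poly C}) (x : R) : C := P.[x%:C%C] * gauss x.

Lemma has_cderiv_gauss : has_cderiv gauss (fun x => - alpha * x%:C%C * gauss x).
Proof.
have h1 : has_deriv (fun x : R => a / 2 * x ^+ 2) (fun x => a * x).
  by apply: eq_has_deriv; [derive|move=> x /=; field].
have h2 : has_deriv (fun x : R => s / 2 * x ^+ 2) (fun x => s * x).
  by apply: eq_has_deriv; [derive|move=> x /=; field].
have he := has_deriv_expR (has_derivN h1).
have hc := has_deriv_cos h2.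
have hs := has_deriv_sin h2.
split; rewrite /gauss /alpha.
- rewrite (_ : (fun _ => cRe _) = fun x => expR (- (a / 2 * x ^+ 2)) * cos (s / 2 * x ^+ 2)).
    apply: eq_has_deriv; first exact: (has_derivM he hc).
    by move=> x /=; rewrite ?reim /=; ring.
  by apply/funext => x; rewrite !reim /=; ring.
- rewrite (_ : (fun _ => cIm _) = fun x => expR (- (a / 2 * x ^+ 2)) * - sin (s / 2 * x ^+ 2)).
    apply: eq_has_deriv; first exact: (has_derivM he (has_derivN hs)).
    by move=> x /=; rewrite ?reim /=; ring.
  by apply/funext => x; rewrite !reim /=; ring.
Qed.

Lemma normc_gauss x : cRe (gauss x) ^+ 2 + cIm (gauss x) ^+ 2 =
  expR (- (a / 2 * x ^+ 2)) ^+ 2.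
Proof.
rewrite /gauss !reim /= !mul0r subr0 addr0 !exprMn sqrrN -mulrDr.
by rewrite cos2Dsin2 mulr1.
Qed.

Lemma gauss_neq0 x : gauss x != 0.
Proof.
apply/eqP => g0; have := normc_gauss x; rewrite g0 /= expr0n addr0 => /esym/eqP.
by rewrite expf_eq0 /= gt_eqF ?expR_gt0.
Qed.

Lemma rapid_gaussian : rapid (fun x : R => expR (- (a / 2 * x ^+ 2))).
Proof.
have h1 : has_deriv (fun x : R => a / 2 * x ^+ 2) (fun x => a * x).
  by apply: eq_has_deriv; [derive|move=> x /=; field].
split; first exact: has_deriv_continuous (has_deriv_expR (has_derivN h1)).
move=> n.
have p0 : 0 < (a / 2) ^+ n.+1 by rewrite exprn_gt0// divr_gt0.
exists (1 + (n.+1)`!%:R / (a / 2) ^+ n.+1) => x.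
rewrite (ger0_norm (expR_ge0 _)) expRN ler_pdivrMr ?expR_gt0//.
have y0 : 0 <= a / 2 * x ^+ 2 by rewrite mulr_ge0 ?sqr_ge0// divr_ge0// ltW.
(* The term of order n + 1 of the exponential series supplies |x|^(2 (n + 1)), which exceeds |x|^n
   for |x| >= 1. *)
have h := @expR_ge1Dxn R _ n y0.
have e1 : 1 <= expR (a / 2 * x ^+ 2) by apply: le_trans (expR_ge1Dx _); rewrite lerDl.
have h2 : `|x| ^+ (2 * n.+1) <= (n.+1)`!%:R / (a / 2) ^+ n.+1 * expR (a / 2 * x ^+ 2).
  have f0 : 0 < (n.+1)`!%:R / (a / 2) ^+ n.+1 :> R by rewrite divr_gt0// ltr0n fact_gt0.
  apply: (le_trans _ (ler_wpM2l (ltW f0) h)).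
  rewrite (exprMn _ (a / 2)) exprM real_normK ?num_real//.
  have F0 : 0 < (n.+1)`!%:R :> R by rewrite ltr0n fact_gt0.
  move: F0 p0 f0; set F := _%:R; set p := (a / 2) ^+ _; set q := (x ^+ 2) ^+ _.
  move=> F0 p0 f0; rewrite (_ : F / p * (1 + p * q / F) = F / p + q) ?lerDr ?ltW//.
  by field; rewrite !gt_eqF.
rewrite mulrDl mul1r; apply: le_trans (lerD e1 h2).
have [x1|x1] := leP `|x| 1.
  by rewrite (@le_trans _ _ 1)// ?exprn_ile1// lerDl exprn_ge0.
rewrite (@le_trans _ _ (`|x| ^+ (2 * n.+1)))// ?lerDr// ler_weXn2l// ?ltW//.
by rewrite mul2n -addnn leqW// leq_addr.
Qed.

Lemma crapid_gauss : crapid gauss.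
Proof.
have h2 : has_deriv (fun x : R => s / 2 * x ^+ 2) (fun x => s * x).
  by apply: eq_has_deriv; [derive|move=> x /=; field].
have tc : tempered (fun x => cos (s / 2 * x ^+ 2)).
  apply: (@bounded_tempered _ _ 1); first exact: has_deriv_continuous (has_deriv_cos h2).
  by move=> x; rewrite ler_norml cos_geN1 cos_le1.
have ts : tempered (fun x => sin (s / 2 * x ^+ 2)).
  apply: (@bounded_tempered _ _ 1); first exact: has_deriv_continuous (has_deriv_sin h2).
  by move=> x; rewrite ler_norml sin_geN1 sin_le1.
have rg := rapid_gaussian.
split; rewrite /gauss.
  rewrite (_ : (fun _ => cRe _) = fun x => expR (- (a / 2 * x ^+ 2)) * cos (s / 2 * x ^+ 2)).
    exact: rapidMr.
  by apply/funext => x; rewrite !reim /=; ring.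
rewrite (_ : (fun _ => cIm _) = fun x => expR (- (a / 2 * x ^+ 2)) * - sin (s / 2 * x ^+ 2)).
  by apply: rapidMr => //; exact: temperedN.
by apply/funext => x; rewrite !reim /=; ring.
Qed.

Lemma crapid_polygauss P : crapid (polygauss P).
Proof.
elim/poly_ind: P => [|P c IH].
  have := crapidZ 0 crapid_gauss; congr crapid; apply/funext => x.
  by rewrite /polygauss horner0.
have := crapidD (crapidMx IH) (crapidZ c crapid_gauss); congr crapid.
by apply/funext => x; rewrite /polygauss hornerMXaddC; ring.
Qed.

(** Differentiation conjugated by the Gaussian. *)
Definition dpoly (P : {poly C}) : {poly C} := P^`() - alpha *: ('X * P).

Lemma has_cderiv_polygauss P : has_cderiv (polygauss P) (polygauss (dpoly P)).
Proof.
apply: (eq_has_cderiv (has_cderivM (has_cderiv_horner P) has_cderiv_gauss)) => x.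
by rewrite /polygauss /dpoly hornerD hornerN hornerZ hornerM hornerX; move: alpha => al; ring.
Qed.

Lemma polygaussD P Q x : polygauss (P + Q) x = polygauss P x + polygauss Q x.
Proof. by rewrite /polygauss hornerD mulrDl. Qed.

Lemma polygaussB P Q x : polygauss (P - Q) x = polygauss P x - polygauss Q x.
Proof. by rewrite /polygauss hornerD hornerN mulrBl. Qed.

Lemma polygaussZ c P x : polygauss (c *: P) x = c * polygauss P x.
Proof. by rewrite /polygauss hornerZ mulrA. Qed.

(** H_c - z conjugated by the Gaussian: alpha^2 = c cancels the quadratic potential, and a Hermite
    operator, which does not raise degrees, remains. *)
Definition lpoly (z : C) (P : {poly C}) : {poly C} :=
  - P^`()^`() + (2 * alpha) *: ('X * P^`()) + (alpha - z) *: P.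

Lemma lpolyB z P Q : lpoly z (P - Q) = lpoly z P - lpoly z Q.
Proof.
rewrite /lpoly !derivB mulrBr !scalerBr !opprB !opprD !opprK.
by rewrite -!mul_polyC; ring.
Qed.

Lemma lpolyD z P Q : lpoly z (P + Q) = lpoly z P + lpoly z Q.
Proof.
rewrite /lpoly !derivD mulrDr !scalerDr !opprD.
by rewrite -!mul_polyC; ring.
Qed.

Lemma polygauss_lpoly z P x : polygauss (lpoly z P) x =
  - polygauss (dpoly (dpoly P)) x + (alpha ^+ 2 * (x ^+ 2)%:C%C - z) * polygauss P x.
Proof.
rewrite /polygauss /lpoly /dpoly rmorphXn /= !(derivB, derivZ, derivM, derivX).
by rewrite !(hornerD, hornerN, hornerZ, hornerM, hornerX, hornerC); move: alpha => al; ring.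
Qed.

Lemma lpoly_surj z : (forall n : nat, alpha * (2 * n%:R + 1) != z) ->
  forall Q, exists P, lpoly z P = Q.
Proof.
move=> nz.
suff h n (Q : {poly C}) : (size Q <= n)%N -> exists P, lpoly z P = Q by move=> Q; exact: (h (size Q)).
elim: n Q => [|n IH] Q sQ.
  exists 0; move: sQ; rewrite leqn0 size_poly_eq0 => /eqP ->.
  by rewrite /lpoly !deriv0 !(mulr0, scaler0) oppr0 !addr0.
(* The monomial of degree n whose image has the top coefficient of [Q]; the difference has size at
   most n. *)
pose k := Q`_n / (alpha * (2 * n%:R + 1) - z).
have nz0 : alpha * (2 * n%:R + 1) - z != 0 by rewrite subr_eq0.
have [|P HP] := IH (Q - lpoly z (k *: 'X^n)).
  apply/leq_sizeP => j nj; rewrite coefB.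
  have -> : (lpoly z (k *: 'X^n))`_j = if j == n then Q`_n else 0.
    rewrite /lpoly !coefD coefN !coefZ coefXM !coef_deriv !coefZ !coefXn.
    have -> : (j.+2 == n) = false by apply/negP => /eqP e; move: nj; rewrite -e ltnNge leqnSn.
    case: j nj => [|j] nj /=.
      move: nj; rewrite leqn0 => /eqP n0; subst n => /=.
      rewrite mulr0 mul0rn mul0rn oppr0 add0r mulr0 add0r mulr1.
      have -> : alpha - z = alpha * (2 * 0 + 1) - z by ring.
      by rewrite mulrC divfK.
    rewrite mulr0 mul0rn mul0rn oppr0 add0r.
    have [jn|jn] := eqVneq j.+1 n; last first.
      by rewrite mulr0 mul0rn !mulr0 addr0.
    rewrite jn mulr1 -[k *+ _]mulr_natr.
    rewrite (_ : 2 * alpha * _ + _ = k * (alpha * (2 * n%:R + 1) - z)); last by ring.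
    by rewrite divfK.
  have [->|jn] := eqVneq j n; first by rewrite subrr.
  rewrite subr0; have /leq_sizeP := sQ; apply.
  by rewrite ltn_neqAle eq_sym jn.
by exists (P + k *: 'X^n); rewrite lpolyD HP subrK.
Qed.

End GaussianPolynomials.

(** * Cut-offs and smoothness *)

Section SmoothBump.
Context {R : realType}.

(** The standard flat function exp (- 1 / y) is the case k = 0; with the powers y^-k the family is
    closed under differentiation up to linear combinations, so that higher derivatives need no
    separate description. *)
Definition psi (k : nat) (y : R) : R := if 0 < y then y ^- k * expR (- y^-1) else 0.

Lemma psi_ge0 k y : 0 <= psi k y.
Proof. by rewrite /psi; case: ifP => // y0; rewrite mulr_ge0 ?expR_ge0// invr_ge0 exprn_ge0// ltW. Qed.

(** From exp (1 / y) >= y^-(k + 2) / (k + 2)!. Vanishing to second order makes the derivative at the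
    origin 0. *)
Lemma psi_le_sqr k y : psi k y <= (k.+2)`!%:R * y ^+ 2.
Proof.
rewrite /psi; case: ifPn => [y0|_]; last by rewrite mulr_ge0 ?sqr_ge0.
have u0 : 0 <= y^-1 by rewrite invr_ge0 ltW.
have h := @expR_ge1Dxn R _ k.+1 u0.
have f0 : 0 < (k.+2)`!%:R :> R by rewrite ltr0n fact_gt0.
rewrite expRN ler_pdivrMr ?expR_gt0// -mulrA.
apply: (@le_trans _ _ ((k.+2)`!%:R * (y ^+ 2 * (y^-1 ^+ k.+2 / (k.+2)`!%:R)))).
  move: f0; set F := _%:R => f0; rewrite [leRHS](_ : _ = y ^- k)//.
  by rewrite exprVn !exprS; field; rewrite !gt_eqF// exprn_gt0.
rewrite ler_wpM2l ?(ltW f0)// ler_wpM2l ?sqr_ge0//.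
by apply: le_trans h; rewrite lerDr.
Qed.

Lemma has_deriv_psi k :
  has_deriv (psi k) (fun y => - (k%:R * psi k.+1 y) + psi k.+2 y).
Proof.
move=> y; have [y0|y0|y0] := ltgtP y 0.
- have -> : - (k%:R * psi k.+1 y) + psi k.+2 y = 0.
    by rewrite /psi ltNge (ltW y0) /= mulr0 oppr0 addr0.
  apply: (@near_eq_is_derive R R R (cst 0)).
  near=> z; rewrite /psi /= ifF//; apply/negbTE; rewrite -leNgt ltW//.
  by near: z; exact: lt_nbhsl.
- have -> : - (k%:R * psi k.+1 y) + psi k.+2 y =
      - (k%:R * (y ^- k.+1 * expR (- y^-1))) + y ^- k.+2 * expR (- y^-1).
    by rewrite /psi y0.
  apply: (@near_eq_is_derive R R R (fun z => (z ^+ k)^-1 * expR (- z^-1))).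
    near=> z; rewrite /psi ifT//.
    by near: z; exact: lt_nbhsr.
  have yn0 : y != 0 by rewrite gt_eqF.
  have h1 : is_derive y 1 (fun z : R => z^-1) (- y ^- 2 * 1).
    by apply: (@is_deriveV R id y 1 1).
  have h2 : is_derive y 1 (fun z : R => expR (- z^-1)) (expR (- y^-1) * y ^- 2).
    have hn : is_derive y 1 (fun z : R => - z^-1) (- (- y ^- 2 * 1)) by apply: is_deriveN.
    have := @is_derive1_comp R expR (fun z => - z^-1) y _ _ (is_derive_expR _) hn.
    by rewrite mulr1 opprK.
  have h3 : is_derive y 1 (fun z : R => (z ^+ k)^-1) (- (k%:R * y ^- k.+1)).
    case: k => [|k].
      rewrite mul0r oppr0 (_ : (fun _ => _) = cst 1); first exact: is_derive_cst.
      by apply/funext => z; rewrite expr0 invr1.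
    have hx : is_derive y 1 (fun z : R => z ^+ k.+1) (k.+1%:R * y ^+ k * 1).
      exact: (has_derivX k (@has_deriv_id R)).
    have := @is_deriveV R (fun z => z ^+ k.+1) y _ 1 (expf_neq0 _ yn0) hx.
    move=> h; apply: is_derive_eq h _.
    by rewrite /GRing.scale /= !exprS; field; rewrite yn0 expf_neq0.
  have := is_deriveM h3 h2 => h; apply: is_derive_eq h _.
  by rewrite /GRing.scale /= !exprS; field; rewrite yn0 expf_neq0.
- rewrite y0 {y y0}.
  have p0 j : psi j 0 = 0 by rewrite /psi ltxx.
  rewrite !p0 mulr0 oppr0 addr0.
  pose F := (k.+2)`!%:R : R.
  have c : h^-1 *: (psi k (h *: 1 + 0) - psi k 0) @[h --> (0 : R)^'] --> (0 : R).
    rewrite p0; apply/cvgr0Pnorm_le => e e0.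
    have F0 : 0 < F by rewrite ltr0n fact_gt0.
    have eF : 0 < e / F by rewrite divr_gt0.
    near=> h.
    have h0 : h != 0 by near: h; exact: nbhs_dnbhs_neq.
    have he : `|h| <= e / F.
      near: h; apply: nbhs_dnbhs; apply/nbhs_ballP; exists (e / F) => //= z.
      by rewrite /ball /= sub0r normrN => /ltW.
    rewrite subr0 addr0 /GRing.scale /= mulr1 normrM normfV (ger0_norm (psi_ge0 _ _)).
    rewrite ler_pdivrMl ?normr_gt0// (le_trans (psi_le_sqr _ _))//.
    rewrite -/F -(real_normK (num_real h)) expr2 mulrCA ler_wpM2l//.
    by rewrite mulrC -ler_pdivlMr.
  by apply: DeriveDef; [apply/cvg_ex; exists 0|exact: cvg_lim].
Unshelve. all: by end_near. Qed.

(* closed under differentiation, hence made of smooth functions *)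
Inductive elementary : (R -> R) -> Prop :=
| elementary_cst c : elementary (fun=> c)
| elementary_id : elementary (fun x => x)
| elementaryD u v : elementary u -> elementary v -> elementary (fun x => u x + v x)
| elementaryM u v : elementary u -> elementary v -> elementary (fun x => u x * v x)
| elementary_expR u : elementary u -> elementary (fun x => expR (u x))
| elementary_cos u : elementary u -> elementary (fun x => cos (u x))
| elementary_sin u : elementary u -> elementary (fun x => sin (u x))
| elementary_psi k u : elementary u -> elementary (fun x => psi k (u x)).

Lemma elementaryN u : elementary u -> elementary (fun x => - u x).
Proof.
move=> eu; have := elementaryM (elementary_cst (-1)) eu.
by congr elementary; apply/funext => x; rewrite mulN1r.
Qed.

Lemma elementary_deriv u : elementary u -> exists2 v, elementary v & has_deriv u v.
Proof.
elim=> [c| |{}u v eu [u' eu' hu] ev [v' ev' hv]|{}u v eu [u' eu' hu] ev [v' ev' hv]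
  |{}u eu [u' eu' hu]|{}u eu [u' eu' hu]|{}u eu [u' eu' hu]|k {}u eu [u' eu' hu]].
- by exists (fun=> 0); [exact: elementary_cst|exact: has_deriv_cst].
- by exists (fun=> 1); [exact: elementary_cst|exact: has_deriv_id].
- by eexists; last exact: (has_derivD hu hv); exact: elementaryD.
- eexists; last exact: (has_derivM hu hv).
  by apply: elementaryD; exact: elementaryM.
- eexists; last exact: (has_deriv_expR hu).
  by apply: elementaryM => //; exact: elementary_expR.
- eexists; last exact: (has_deriv_cos hu).
  by apply: elementaryM => //; apply: elementaryN; exact: elementary_sin.
- eexists; last exact: (has_deriv_sin hu).
  by apply: elementaryM => //; exact: elementary_cos.
- eexists; last exact: (has_deriv_comp (has_deriv_psi k) hu).
  apply: elementaryM => //; apply: elementaryD; last exact: elementary_psi.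
  by apply: elementaryN; apply: elementaryM; [exact: elementary_cst|exact: elementary_psi].
Qed.

Lemma elementary_smooth u n x : elementary u -> derivable (derive1n n u) x 1.
Proof.
elim: n u => [|n IH] u eu; have [v ev hv] := elementary_deriv eu.
  by rewrite derive1n0; exact: ex_derive.
by rewrite derive1Sn (has_deriv_derive1 hv); exact: IH.
Qed.

(** The bump exp (1 - 1 / (1 - x^2)) on the open interval from - 1 to 1; the factor [expR 1] makes
    its value at 0 equal to 1, so that the dilated cut-offs tend to 1. *)
Definition chi (x : R) : R := expR 1 * psi 0 (1 + - (x * x)).

Definition chi' (x : R) : R := expR 1 * (psi 2 (1 + - (x * x)) * - (2 * x)).

Lemma has_deriv_chi : has_deriv chi chi'.
Proof.
have h1 : has_deriv (fun x : R => 1 + - (x * x)) (fun x => - (2 * x)).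
  by apply: eq_has_deriv; [derive|move=> x /=; ring].
have h2 := has_deriv_comp (has_deriv_psi 0) h1.
have h3 := has_derivM (has_deriv_cst (expR 1)) h2.
by apply: (eq_has_deriv h3) => x; rewrite /chi' mul0r; ring.
Qed.

Lemma continuous_chi' : continuous chi'.
Proof.
have [|u _ hu] := @elementary_deriv chi'; last exact: has_deriv_continuous hu.
apply: elementaryM; first exact: elementary_cst.
apply: elementaryM.
  apply: elementary_psi; apply: elementaryD; first exact: elementary_cst.
  by apply: elementaryN; apply: elementaryM; exact: elementary_id.
by apply: elementaryN; apply: elementaryM; [exact: elementary_cst|exact: elementary_id].
Qed.

Lemma chi_bound x : 0 <= chi x <= 1.
Proof.
rewrite /chi mulr_ge0 ?expR_ge0 ?psi_ge0//= /psi; case: ifPn => y0; last by rewrite mulr0.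
rewrite expr0 invr1 mul1r -expRD -[leRHS]expR0 ler_expR subr_le0.
rewrite -[leLHS]invr1 lef_pV2 ?posrE// gerBl.
by rewrite -expr2 sqr_ge0.
Qed.

Lemma chi0 : chi 0 = 1.
Proof.
by rewrite /chi mulr0 oppr0 addr0 /psi ltr01 expr0 !invr1 mul1r -expRD subrr expR0.
Qed.

Lemma chi_out x : 1 <= `|x| -> chi x = 0.
Proof.
move=> x1; rewrite /chi /psi ifF ?mulr0//; apply/negbTE; rewrite -leNgt subr_le0.
by rewrite -expr2 -(real_normK (num_real x)) exprn_ege1.
Qed.

Lemma chi'_bound x : `|chi' x| <= 48 * expR 1.
Proof.
rewrite /chi' normrM (ger0_norm (expR_ge0 _)) mulrC ler_wpM2r ?expR_ge0//.
have [x1|x1] := leP 1 `|x|.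
  rewrite /psi ifF ?mul0r ?normr0//; apply/negbTE; rewrite -leNgt subr_le0.
  by rewrite -expr2 -(real_normK (num_real x)) exprn_ege1.
rewrite normrM normrN normrM (ger0_norm (psi_ge0 _ _)) (ger0_norm (ler0n _ 2)).
have xx : x * x <= 1.
  by rewrite -expr2 -(real_normK (num_real x)) exprn_ile1// ltW.
have x0 : 0 <= x * x by rewrite -expr2 sqr_ge0.
(* 24 is the factorial in [psi_le_sqr], whose argument lies in [0, 1] here; the remaining factor 2
   comes from |2 x|. *)
have h : psi 2 (1 + - (x * x)) <= 24.
  apply: (le_trans (psi_le_sqr _ _)); rewrite -[leRHS]mulr1 (_ : 4`!%:R = 24)//.
  by rewrite ler_wpM2l// exprn_ile1//; lra.
rewrite (_ : 48 = 24 * 2 * 1); last by ring.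
rewrite -mulrA; apply: ler_pM => //; first exact: psi_ge0.
by rewrite ler_wpM2l// ltW.
Qed.

Lemma cut_test_function (n : nat) u : elementary u ->
  test_function (fun x => chi (x * (n.+1%:R)^-1) * u x).
Proof.
move=> eu; split.
  move=> k x; apply: elementary_smooth; apply: elementaryM => //.
  apply: elementaryM; first exact: elementary_cst.
  apply: elementary_psi; apply: elementaryD; first exact: elementary_cst.
  apply: elementaryN; apply: elementaryM; (apply: elementaryM; [exact: elementary_id|exact: elementary_cst]).
exists n.+1%:R => x nx; rewrite chi_out ?mul0r// normrM normfV (ger0_norm (ler0n _ _)).
by rewrite ler_pdivlMr// mul1r ltW.
Qed.

Lemma has_deriv_cut (n : nat) u u' : has_deriv u u' ->
  has_deriv (fun x => chi (x * (n.+1%:R)^-1) * u x)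
   (fun x => chi' (x * (n.+1%:R)^-1) * (n.+1%:R)^-1 * u x + chi (x * (n.+1%:R)^-1) * u' x).
Proof.
move=> hu.
have h1 : has_deriv (fun x : R => x * (n.+1%:R)^-1) (fun=> (n.+1%:R)^-1).
  by apply: eq_has_deriv; [derive|move=> x /=; ring].
exact: (has_derivM (has_deriv_comp has_deriv_chi h1) hu).
Qed.

Lemma cut_cvg x : chi (x * (n.+1%:R)^-1) @[n --> \oo] --> (1 : R).
Proof.
have h : x * (n.+1%:R)^-1 @[n --> \oo] --> (0 : R).
  rewrite -[X in _ --> X](mulr0 x); apply: cvgM; first exact: cvg_cst.
  exact: cvg_harmonic.
have cc : {for 0, continuous (chi)} by exact: (has_deriv_continuous has_deriv_chi).
by rewrite -[X in _ --> X]chi0; exact: (continuous_cvg _ cc h).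
Qed.

End SmoothBump.

Section ElementaryHermite.
Context {R : realType}.
Variables a s : R.

(** Through this, Gaussian polynomials times cut-offs are test functions. *)
Lemma elementary_polygauss (P : {poly R[i]}) :
  elementary (fun x => cRe (polygauss a s P x)) /\
  elementary (fun x => cIm (polygauss a s P x)).
Proof.
have ex2 (k : R) : elementary (fun x : R => k * x ^+ 2).
  apply: elementaryM; first exact: elementary_cst.
  by apply: elementaryM; exact: elementary_id.
have ee := elementary_expR (elementaryN (ex2 (a / 2))).
have eg : elementary (fun x => cRe (gauss a s x)) /\ elementary (fun x => cIm (gauss a s x)).
  split.
    have := elementaryM ee (elementary_cos (ex2 (s / 2))).
    by congr elementary; apply/funext => x; rewrite /gauss !reim /=; ring.
  have := elementaryM ee (elementaryN (elementary_sin (ex2 (s / 2)))).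
  by congr elementary; apply/funext => x; rewrite /gauss !reim /=; ring.
elim/poly_ind: P => [|P c [IH1 IH2]].
  by split; have := elementary_cst (0 : R); congr elementary; apply/funext => x;
    rewrite /polygauss horner0 mul0r.
have [g1 g2] := eg; split.
  have := elementaryD (elementaryM elementary_id IH1)
    (elementaryD (elementaryM (elementary_cst (cRe c)) g1)
      (elementaryN (elementaryM (elementary_cst (cIm c)) g2))).
  by congr elementary; apply/funext => x; rewrite /polygauss hornerMXaddC !reim; ring.
have := elementaryD (elementaryM elementary_id IH2)
  (elementaryD (elementaryM (elementary_cst (cRe c)) g2)
    (elementaryM (elementary_cst (cIm c)) g1)).
by congr elementary; apply/funext => x; rewrite /polygauss hornerMXaddC !reim; ring.
Qed.

End ElementaryHermite.

(** * Complex square-integrable functions and density *)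

Section ComplexL2.
Context {R : realType}.
Local Notation C := R[i].
Local Notation mu := (@lebesgue_measure R).
Implicit Types f g h : R -> R[i].

Definition nsq f : R := itg (fun x => cRe (f x) ^+ 2 + cIm (f x) ^+ 2).
(** The real part of the inner product: L^2 is treated as a real Hilbert space of pairs, and
    imaginary parts are recovered by testing against multiples by the imaginary unit. *)
Definition ip f g : R := itg (fun x => cRe (f x) * cRe (g x) + cIm (f x) * cIm (g x)).
Definition cL2 f : Prop := l2 (fun x => cRe (f x)) /\ l2 (fun x => cIm (f x)).

Lemma normc2 (z : C) : ComplexField.Normc.normc z ^+ 2 = cRe z ^+ 2 + cIm z ^+ 2.
Proof. by case: z => x y /=; rewrite sqr_sqrtr// addr_ge0 ?sqr_ge0. Qed.

Lemma L2norm_unlock f :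
  L2norm f = ((\int[mu]_x (cRe (f x) ^+ 2 + cIm (f x) ^+ 2)%:E) `^ 2^-1)%E.
Proof.
rewrite /L2norm unlock; congr (_ `^ _)%E.
apply: eq_integral => x _ /=.
rewrite ger0_norm; last by case: (f x) => u v /=; rewrite sqrtr_ge0.
by rewrite -normc2 powR_mulrn//; case: (f x) => u v /=; rewrite sqrtr_ge0.
Qed.

Lemma L2P f : L2 f <-> cL2 f.
Proof.
split.
  move=> [[m1 m2]]; rewrite L2norm_unlock.
  move=> /lty_poweRy; rewrite invr_eq0 pnatr_eq0 => /(_ isT) H.
  have s : Rintegrable (fun x => cRe (f x) ^+ 2 + cIm (f x) ^+ 2).
    apply/ge0_Rintegrable => //; last by move=> x; rewrite addr_ge0 ?sqr_ge0.
    by apply: measurable_funD; exact: measurable_funX.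
  split; split => //; apply: le_Rintegrable s; try exact: measurable_funX.
    by move=> x; rewrite ger0_norm ?sqr_ge0// lerDl sqr_ge0.
  by move=> x; rewrite ger0_norm ?sqr_ge0// lerDr sqr_ge0.
move=> [[m1 s1] [m2 s2]]; split => //.
rewrite L2norm_unlock poweR_lty// itgE ?ltry//.
exact: RintegrableD.
Qed.

Lemma L2normE f : cL2 f -> L2norm f = (Num.sqrt (nsq f))%:E.
Proof.
move=> [[m1 s1] [m2 s2]]; rewrite L2norm_unlock itgE; last exact: RintegrableD.
rewrite poweR_EFin powR12_sqrt//.
by apply: itg_ge0 => x; rewrite addr_ge0 ?sqr_ge0.
Qed.

Lemma nsq_ge0 f : 0 <= nsq f.
Proof. by apply: itg_ge0 => x; rewrite addr_ge0 ?sqr_ge0. Qed.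

Lemma nsqE f : nsq f = ip f f. Proof. by []. Qed.

Lemma ipC f g : ip f g = ip g f.
Proof. by congr itg; apply/funext => x; rewrite mulrC [X in _ + X]mulrC. Qed.

Lemma cL2D f g : cL2 f -> cL2 g -> cL2 (fun x => f x + g x).
Proof.
move=> [f1 f2] [g1 g2]; split.
  by have := l2D f1 g1; congr l2; apply/funext => x; rewrite reim.
by have := l2D f2 g2; congr l2; apply/funext => x; rewrite reim.
Qed.

Lemma cL2Z (c : C) f : cL2 f -> cL2 (fun x => c * f x).
Proof.
move=> [f1 f2]; split.
  have := l2B (l2Z (cRe c) f1) (l2Z (cIm c) f2).
  by congr l2; apply/funext => x; rewrite reim.
have := l2D (l2Z (cRe c) f2) (l2Z (cIm c) f1).
by congr l2; apply/funext => x; rewrite reim.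
Qed.

Lemma cL2B f g : cL2 f -> cL2 g -> cL2 (fun x => f x - g x).
Proof.
move=> lf lg; have := cL2D lf (cL2Z (-1) lg).
by congr cL2; apply/funext => x; rewrite mulN1r.
Qed.

Lemma cL2J f : cL2 f -> cL2 (fun x => conjc (f x)).
Proof.
move=> [f1 f2]; split.
  by move: f1; congr l2; apply/funext => x; rewrite reim.
by have := l2N f2; congr l2; apply/funext => x; rewrite reim.
Qed.

Lemma crapid_cL2 f : crapid f -> cL2 f.
Proof. by move=> [f1 f2]; split; exact: rapid_l2. Qed.

Lemma ip_summable f g : cL2 f -> cL2 g ->
  Rintegrable (fun x => cRe (f x) * cRe (g x) + cIm (f x) * cIm (g x)).
Proof. by move=> [f1 f2] [g1 g2]; apply: RintegrableD; exact: l2M. Qed.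

Lemma ipDl f g h : cL2 f -> cL2 g -> cL2 h ->
  ip (fun x => f x + g x) h = ip f h + ip g h.
Proof.
move=> lf lg lh; rewrite /ip -itgD; try exact: ip_summable.
by congr itg; apply/funext => x; rewrite !reim; ring.
Qed.

Lemma ipZl (k : R) f h : cL2 f -> cL2 h ->
  ip (fun x => k%:C%C * f x) h = k * ip f h.
Proof.
move=> lf lh; rewrite /ip -itgZ; last exact: ip_summable.
by congr itg; apply/funext => x; rewrite !reim; ring.
Qed.

Lemma ipBl f g h : cL2 f -> cL2 g -> cL2 h ->
  ip (fun x => f x - g x) h = ip f h - ip g h.
Proof.
move=> lf lg lh; rewrite /ip -itgB; try exact: ip_summable.
by congr itg; apply/funext => x; rewrite !reim; ring.
Qed.

Lemma nsqD f g : cL2 f -> cL2 g ->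
  nsq (fun x => f x + g x) = nsq f + 2 * ip f g + nsq g.
Proof.
move=> lf lg; have lfg := cL2D lf lg.
rewrite !nsqE ipDl// ![ip _ (fun x => f x + g x)]ipC !ipDl// [ip g f]ipC; ring.
Qed.

Lemma nsqB f g : cL2 f -> cL2 g ->
  nsq (fun x => f x - g x) = nsq f - 2 * ip f g + nsq g.
Proof.
move=> lf lg; have lfg := cL2B lf lg.
rewrite !nsqE ipBl// ![ip _ (fun x => f x - g x)]ipC !ipBl// [ip g f]ipC; ring.
Qed.

Lemma nsqZ (k : R) f : cL2 f -> nsq (fun x => k%:C%C * f x) = k ^+ 2 * nsq f.
Proof.
move=> lf; have lkf := cL2Z k%:C%C lf.
by rewrite !nsqE ipZl// ipC ipZl// mulrA expr2.
Qed.

Lemma nsqJ f : nsq (fun x => conjc (f x)) = nsq f.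
Proof. by congr itg; apply/funext => x; rewrite !reim sqrrN. Qed.

Lemma eq_nsq f g : f =1 g -> nsq f = nsq g.
Proof. by move=> /funext ->. Qed.

Lemma nsq_split f : cL2 f ->
  nsq f = itg (fun x => cRe (f x) ^+ 2) + itg (fun x => cIm (f x) ^+ 2).
Proof. by move=> [[_ s1] [_ s2]]; rewrite /nsq itgD. Qed.

Definition L2lim (f_ : nat -> R -> R[i]) f : Prop :=
  [/\ forall n, cL2 (f_ n), cL2 f & nsq (fun x => f_ n x - f x) @[n --> \oo] --> 0].

Lemma L2lim_parts (f_ : nat -> R -> R[i]) f : L2lim f_ f ->
  itg (fun x => (cRe (f_ n x) - cRe (f x)) ^+ 2) @[n --> \oo] --> 0 /\
  itg (fun x => (cIm (f_ n x) - cIm (f x)) ^+ 2) @[n --> \oo] --> 0.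
Proof.
move=> [lf_ lf c].
have e n : nsq (fun x => f_ n x - f x) =
    itg (fun x => (cRe (f_ n x) - cRe (f x)) ^+ 2) +
    itg (fun x => (cIm (f_ n x) - cIm (f x)) ^+ 2).
  rewrite nsq_split; last exact: cL2B.
  by congr (_ + _); congr itg; apply/funext => x; rewrite !reim.
have p1 n : 0 <= itg (fun x => (cRe (f_ n x) - cRe (f x)) ^+ 2).
  by apply: itg_ge0 => x; exact: sqr_ge0.
have p2 n : 0 <= itg (fun x => (cIm (f_ n x) - cIm (f x)) ^+ 2).
  by apply: itg_ge0 => x; exact: sqr_ge0.
split; apply: (squeeze_cvgr _ (cvg_cst 0) c); apply: nearW => n; rewrite e.
  by rewrite p1 lerDl p2.
by rewrite p2 lerDr p1.
Qed.

Lemma L2lim_of_parts (f_ : nat -> R -> R[i]) f : (forall n, cL2 (f_ n)) -> cL2 f ->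
  itg (fun x => (cRe (f_ n x) - cRe (f x)) ^+ 2) @[n --> \oo] --> 0 ->
  itg (fun x => (cIm (f_ n x) - cIm (f x)) ^+ 2) @[n --> \oo] --> 0 ->
  L2lim f_ f.
Proof.
move=> lf_ lf c1 c2; split => //.
rewrite (_ : (fun n => nsq _) = (fun n =>
  itg (fun x => (cRe (f_ n x) - cRe (f x)) ^+ 2) +
  itg (fun x => (cIm (f_ n x) - cIm (f x)) ^+ 2))).
  by rewrite -[X in _ --> X](addr0 (0 : R)); exact: cvgD.
apply/funext => n; rewrite nsq_split; last exact: cL2B.
by congr (_ + _); congr itg; apply/funext => x; rewrite !reim.
Qed.

Lemma L2_complete (f_ : nat -> R -> R[i]) (K : R) : (forall n, cL2 (f_ n)) ->
  (forall n, nsq (fun x => f_ n.+1 x - f_ n x) <= K / 4 ^+ n) ->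
  exists f, L2lim f_ f.
Proof.
move=> lf_ hK.
have e n : nsq (fun x => f_ n.+1 x - f_ n x) =
    itg (fun x => (cRe (f_ n.+1 x) - cRe (f_ n x)) ^+ 2) +
    itg (fun x => (cIm (f_ n.+1 x) - cIm (f_ n x)) ^+ 2).
  rewrite nsq_split; last exact: cL2B.
  by congr (_ + _); congr itg; apply/funext => x; rewrite !reim.
have [u lu cu] := @l2_complete R (fun n x => cRe (f_ n x)) K (fun n => (lf_ n).1)
  (fun n => le_trans (ler_wpDr (itg_ge0 (fun x => sqr_ge0 _)) (lexx _))
     (eq_ind _ (fun z => z <= _) (hK n) _ (e n))).
have [v lv cv] := @l2_complete R (fun n x => cIm (f_ n x)) K (fun n => (lf_ n).2)
  (fun n => le_trans (ler_wpDl (itg_ge0 (fun x => sqr_ge0 _)) (lexx _))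
     (eq_ind _ (fun z => z <= _) (hK n) _ (e n))).
by exists (fun x => Complex (u x) (v x)); exact: L2lim_of_parts.
Qed.

Lemma CintegralM_Re f g : cRe (Cintegral (fun x => f x * g x)) = ip f (fun x => conjc (g x)).
Proof. by congr itg; apply/funext => x; rewrite !reim mulrN. Qed.

(** The second argument on the right is the imaginary unit times the conjugate of g. Thus both parts
    of the bilinear pairing are real inner products, to which continuity along L^2 limits
    applies. *)
Lemma CintegralM_Im f g : cIm (Cintegral (fun x => f x * g x)) =
  ip f (fun x => Complex (cIm (g x)) (cRe (g x))).
Proof. by congr itg; apply/funext => x; rewrite !reim. Qed.

Lemma ip_cvg (f_ : nat -> R -> R[i]) f g : L2lim f_ f -> cL2 g ->
  ip (f_ n) g @[n --> \oo] --> ip f g.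
Proof.
move=> lim lg; have [c1 c2] := L2lim_parts lim; have [lf_ lf _] := lim.
have d1 := itgM_cvg (fun n => (lf_ n).1) lf.1 lg.1 c1.
have d2 := itgM_cvg (fun n => (lf_ n).2) lf.2 lg.2 c2.
rewrite /ip itgD; [|exact: l2M lf.1 lg.1|exact: l2M lf.2 lg.2].
rewrite (_ : (fun n => itg _) = (fun n => itg (fun x => cRe (f_ n x) * cRe (g x)) +
  itg (fun x => cIm (f_ n x) * cIm (g x)))); first exact: cvgD.
apply/funext => n; rewrite itgD//.
  exact: l2M (lf_ n).1 lg.1.
exact: l2M (lf_ n).2 lg.2.
Qed.

Lemma ae_eq_nsq0 f : cL2 f -> nsq f = 0 -> {ae mu, forall x, f x = 0}.
Proof.
move=> lf f0; have := @itg_eq0 R _ (RintegrableD lf.1.2 lf.2.2) _ f0.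
have p x : 0 <= cRe (f x) ^+ 2 + cIm (f x) ^+ 2 by rewrite addr_ge0 ?sqr_ge0.
move=> /(_ p); apply: ae_imp => x /eqP.
rewrite paddr_eq0 ?sqr_ge0// !sqrf_eq0 => /andP[/eqP h1 /eqP h2].
exact: complexP.
Qed.

Lemma ae_nsq f g : cL2 f -> cL2 g -> {ae mu, forall x, f x = g x} -> nsq f = nsq g.
Proof.
move=> lf lg fg; apply: ae_eq_itg.
- exact: Rintegrable_measurable (RintegrableD lf.1.2 lf.2.2).
- exact: Rintegrable_measurable (RintegrableD lg.1.2 lg.2.2).
- by apply: ae_imp fg => x ->.
Qed.

End ComplexL2.

(** * Density of the Gaussian polynomials *)

Section Density.
Context {R : realType}.
Local Notation C := R[i].
Local Notation mu := (@lebesgue_measure R).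
Variables a s : R.
Hypothesis a0 : 0 < a.
Local Notation polygauss := (polygauss a s).
Local Notation gauss := (gauss a s).

Lemma polygauss_cL2 P : cL2 (polygauss P).
Proof. exact: crapid_cL2 (crapid_polygauss s a0 P). Qed.

(** Completing the square: half of the Gaussian exponent absorbs t |x|, at the price of the factor
    exp (t^2 / a). *)
Let gaussian_exp (t : R) (g : R -> R) : continuous g ->
  (forall x, `|g x| <= expR (- (a / 2 * x ^+ 2))) -> l2 (fun x => g x * expR (t * `|x|)).
Proof.
move=> cg gb.
have a20 : 0 < a / 2 by rewrite divr_gt0.
have := rapid_l2 (rapid_gaussian a20) => /(l2Z (expR (t ^+ 2 / a))).
apply: le_l2.
  apply: continuous_measurable_fun => x; apply: cvgM; first exact: cg.
  apply: (@continuous_comp _ _ _ (fun x => t * `|x|) expR); last exact: continuous_expR.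
  by apply: cvgM; [exact: cvg_cst|exact: norm_continuous].
move=> x; rewrite !normrM !(ger0_norm (expR_ge0 _)).
apply: (le_trans (ler_wpM2r (expR_ge0 _) (gb x))).
rewrite -!expRD ler_expR -subr_ge0.
rewrite (_ : _ - _ = (t - a / 2 * `|x|) ^+ 2 / a).
  by rewrite divr_ge0 ?sqr_ge0// ltW.
by rewrite -(real_normK (num_real x)); field; rewrite gt_eqF.
Qed.

Let gauss_part x : `|cRe (gauss x)| <= expR (- (a / 2 * x ^+ 2)) /\
  `|cIm (gauss x)| <= expR (- (a / 2 * x ^+ 2)).
Proof.
have := normc_gauss a s x; set E := expR _ => h.
have E0 : 0 <= E by exact: expR_ge0.
split; rewrite -(ler_pXn2r (n := 2))// ?nnegrE// real_normK ?num_real// -h.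
  by rewrite lerDl sqr_ge0.
by rewrite lerDr sqr_ge0.
Qed.

Lemma orthogonal_polygauss_eq0 (e : R -> C) : cL2 e ->
  (forall P, ip e (fun x => conjc (polygauss P x)) = 0) ->
  {ae mu, forall x, e x = 0}.
Proof.
move=> le orth.
have [rg1 rg2] := crapid_gauss s a0.
have ge1 t : l2 (fun x => cRe (gauss x) * expR (t * `|x|)).
  by apply: gaussian_exp; [exact: rg1.1|move=> x; have [] := gauss_part x].
have ge2 t : l2 (fun x => cIm (gauss x) * expR (t * `|x|)).
  by apply: gaussian_exp; [exact: rg2.1|move=> x; have [] := gauss_part x].
have herm n x : polygauss 'X^n x = (x ^+ n)%:C%C * gauss x.
  by rewrite /polygauss hornerXn rmorphXn.
have w1 : {ae mu, forall x, cRe (e x * gauss x) = 0}.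
  apply: moments_eq0 => [t|n].
    have := RintegrableB (l2M le.1 (ge1 t)) (l2M le.2 (ge2 t)).
    by congr Rintegrable; apply/funext => x; rewrite reim; ring.
  rewrite -[RHS](orth 'X^n); congr itg; apply/funext => x.
  by rewrite herm; move: (gauss x) (e x) (x ^+ n) => g1 e1 y; rewrite !reim; ring.
(* This [i] is minus the imaginary unit: orthogonality to [i *: 'X^n] gives the moments of the
   imaginary part of [e * gauss]. *)
have [i i1 i2] : exists2 i : C, cRe i = 0 & cIm i = -1 by exists (Complex 0 (-1)).
have w2 : {ae mu, forall x, cIm (e x * gauss x) = 0}.
  apply: moments_eq0 => [t|n].
    have := RintegrableD (l2M le.1 (ge2 t)) (l2M le.2 (ge1 t)).
    by congr Rintegrable; apply/funext => x; rewrite reim; ring.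
  rewrite -[RHS](orth (i *: 'X^n)); congr itg; apply/funext => x.
  rewrite polygaussZ herm; move: (gauss x) (e x) (x ^+ n) => g1 e1 y; rewrite !reim.
  by rewrite i1 i2; ring.
apply: ae_imp2 w1 w2 => x h1 h2.
have : e x * gauss x = 0 by exact: complexP.
by move/eqP; rewrite mulf_eq0 (negbTE (gauss_neq0 _ _ _)) orbF => /eqP.
Qed.

(** The projection argument: a minimising sequence for the distance to v is Cauchy by the
    parallelogram identity, and its limit m differs from v by a function orthogonal to the whole
    space. Hence m = v almost everywhere, and the minimising sequence itself approximates v. *)
Lemma polygauss_dense (v : R -> C) : cL2 v -> forall eps : R, 0 < eps ->
  exists P, nsq (fun x => polygauss P x - v x) < eps.
Proof.
move=> lv eps eps0.
pose dist P := nsq (fun x => polygauss P x - v x).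
pose D := inf (range dist).
have hD : has_inf (range dist).
  by split; [exists (dist 0), 0|exists 0 => _ [P _ <-]; exact: nsq_ge0].
have Dle P : D <= dist P by apply: ge_inf; [exact: hD.2|exists P].
(* The rate 4^-n is the one that [L2_complete] asks for. *)
have /choice[P_ HP] : forall n : nat, exists P, dist P < D + 1 / 4 ^+ n.
  move=> n; have e0 : 0 < 1 / 4 ^+ n :> R by rewrite divr_gt0// exprn_gt0.
  by have [_ [P _ <-] ?] := inf_adherent e0 hD; exists P.
have Lpg P : cL2 (fun x => polygauss P x - v x) by exact: cL2B (polygauss_cL2 P) lv.
have para n : nsq (fun x => polygauss (P_ n.+1) x - polygauss (P_ n) x) <= 4 / 4 ^+ n.
  pose f x := polygauss (P_ n.+1) x - v x; pose g x := polygauss (P_ n) x - v x.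
  have e1 : nsq (fun x => polygauss (P_ n.+1) x - polygauss (P_ n) x) =
    nsq (fun x => f x - g x).
    by apply: eq_nsq => x; rewrite /f /g; ring.
  have e2 : nsq (fun x => f x + g x) = 4 * dist ((1 / 2) *: (P_ n.+1 + P_ n)).
    rewrite -[4](_ : 2 ^+ 2 = 4); last by ring.
    rewrite -nsqZ//; apply: eq_nsq => x; rewrite /f /g polygaussZ polygaussD.
    by rewrite rmorph_nat; field.
  have h := Dle ((1 / 2) *: (P_ n.+1 + P_ n)).
  have := nsqD (Lpg (P_ n.+1)) (Lpg (P_ n)); have := nsqB (Lpg (P_ n.+1)) (Lpg (P_ n)).
  rewrite -/f -/g e1 e2 => -> Hs.
  have := HP n; have := HP n.+1; rewrite /dist -/f -/g.
  have : 1 / 4 ^+ n.+1 <= 1 / 4 ^+ n :> R.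
    by rewrite !div1r lef_pV2 ?posrE ?exprn_gt0// ler_weXn2l// ler1n.
  rewrite (_ : 4 / 4 ^+ n = 4 * (1 / 4 ^+ n)); last by ring.
  lra.
have [m lim] := L2_complete (fun n => polygauss_cL2 (P_ n)) para.
have [_ lm cm] := lim.
have le : cL2 (fun x => m x - v x) by exact: cL2B.
have lim' : L2lim (fun n x => polygauss (P_ n) x - v x) (fun x => m x - v x).
  split => //; rewrite (_ : (fun n => nsq _) = (fun n => nsq (fun x => polygauss (P_ n) x - m x)))//.
  by apply/funext => n; apply: eq_nsq => x; ring.
(* the first variation of the distance vanishes at its minimum m *)
have orth P : ip (fun x => m x - v x) (polygauss P) = 0.
  set I := ip _ _; pose N := nsq (polygauss P).
  have ic := ip_cvg lim' (polygauss_cL2 P).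
  have quad (k : R) : 0 <= 2 * k * I + k ^+ 2 * N.
    have h n : - (1 / 4 ^+ n) <= 2 * k * ip (fun x => polygauss (P_ n) x - v x) (polygauss P) + k ^+ 2 * N.
      have Lk := cL2Z k%:C%C (polygauss_cL2 P).
      have := Dle (P_ n + k%:C%C *: P); rewrite /dist.
      rewrite (_ : nsq _ = nsq (fun x => (polygauss (P_ n) x - v x) + k%:C%C * polygauss P x)); last first.
        by apply: eq_nsq => x; rewrite polygaussD polygaussZ; ring.
      rewrite nsqD// nsqZ; last exact: polygauss_cL2.
      rewrite ipC ipZl// ?[ip (polygauss P) _]ipC; last exact: polygauss_cL2.
      have := HP n; rewrite /dist -/N; lra.
    have c1 : - (1 / 4 ^+ n) @[n --> \oo] --> (- 0 : R).
      apply: cvgN; under eq_fun do rewrite div1r -exprVn.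
      by apply: cvg_expr; rewrite ger0_norm ?invr_ge0// invf_lt1// ltr1n.
    have c2 : 2 * k * ip (fun x => polygauss (P_ n) x - v x) (polygauss P) + k ^+ 2 * N
        @[n --> \oo] --> 2 * k * I + k ^+ 2 * N.
      by apply: cvgD; [apply: cvgM; [exact: cvg_cst|exact: ic]|exact: cvg_cst].
    rewrite -oppr0; apply: (ler_cvg_to c1 c2); exact: nearW.
  have N0 : 0 <= N by exact: nsq_ge0.
  apply/eqP/negPn/negP => I0.
  (* A value of k at which the quadratic is negative if I is not 0; N + 1 replaces N, which may
     vanish. *)
  have := quad (- I / (N + 1)).
  have N1 : 0 < N + 1 by rewrite ltr_wpDl.
  rewrite (_ : _ + _ = - (I ^+ 2 * (N + 2)) / (N + 1) ^+ 2); last by field; rewrite gt_eqF.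
  rewrite pmulr_lge0 ?invr_gt0 ?exprn_gt0// oppr_ge0 leNgt => /negP; apply.
  by rewrite mulr_gt0 ?exprn_even_gt0//; lra.
have ae0 : {ae mu, forall x, m x - v x = 0}.
  apply: ae_imp (orthogonal_polygauss_eq0 (cL2J le) _) => [x /eqP|P].
    by rewrite conjc_eq0 => /eqP.
  rewrite -[RHS](orth P); congr itg; apply/funext => x; rewrite !reim; ring.
have cm0 := iffLR (cvgrPdist_lt _ _) cm.
have [n _ /(_ n (leqnn n)) hn] := cm0 _ eps eps0.
exists (P_ n).
have lPm : cL2 (fun x => polygauss (P_ n) x - m x) by exact: cL2B (polygauss_cL2 _) lm.
rewrite (ae_nsq (Lpg (P_ n)) lPm); first by move: hn; rewrite sub0r normrN ger0_norm// nsq_ge0.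
by apply: ae_imp ae0 => x /eqP; rewrite subr_eq0 => /eqP ->.
Qed.

End Density.

(** * Weak derivatives and the operator *)

Section WeakDerivatives.
Context {R : realType}.
Local Notation C := R[i].
Local Notation mu := (@lebesgue_measure R).

(* bilinear, not sesquilinear: the operator is symmetric for this pairing *)
Definition cI (f g : R -> C) : C := Cintegral (fun x => f x * g x).

Lemma Re_cI f g : cL2 f -> cL2 g -> cRe (cI f g) =
  itg (fun x => cRe (f x) * cRe (g x)) - itg (fun x => cIm (f x) * cIm (g x)).
Proof.
move=> lf lg; rewrite -itgB; [|exact: l2M lf.1 lg.1|exact: l2M lf.2 lg.2].
by congr itg; apply/funext => x; rewrite reim.
Qed.

Lemma Im_cI f g : cL2 f -> cL2 g -> cIm (cI f g) =
  itg (fun x => cRe (f x) * cIm (g x)) + itg (fun x => cIm (f x) * cRe (g x)).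
Proof.
move=> lf lg; rewrite -itgD; [|exact: l2M lf.1 lg.2|exact: l2M lf.2 lg.1].
by congr itg; apply/funext => x; rewrite reim.
Qed.

Lemma cIC f g : cI f g = cI g f.
Proof. by rewrite /cI; congr Cintegral; apply/funext => x; rewrite mulrC. Qed.

Lemma cI0 f : cI f (fun=> 0) = 0.
Proof.
rewrite /cI (_ : (fun _ => _) = fun=> 0); last by apply/funext => x; rewrite mulr0.
by rewrite /Cintegral /= -/(itg _) itg0.
Qed.

Definition Cintegrable (F : R -> C) : Prop :=
  Rintegrable (fun x => cRe (F x)) /\ Rintegrable (fun x => cIm (F x)).

Lemma CintegrableM f g : cL2 f -> cL2 g -> Cintegrable (fun x => f x * g x).
Proof.
move=> lf lg; split.
  have := RintegrableB (l2M lf.1 lg.1) (l2M lf.2 lg.2).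
  by congr Rintegrable; apply/funext => x; rewrite reim.
have := RintegrableD (l2M lf.1 lg.2) (l2M lf.2 lg.1).
by congr Rintegrable; apply/funext => x; rewrite reim.
Qed.

Lemma CintegralD F G : Cintegrable F -> Cintegrable G ->
  Cintegral (fun x => F x + G x) = Cintegral F + Cintegral G.
Proof.
move=> [F1 F2] [G1 G2]; apply: complexP; rewrite [RHS]reim.
  by rewrite /= -[RHS]itgD//; congr itg; apply/funext => x; rewrite reim.
by rewrite /= -[RHS]itgD//; congr itg; apply/funext => x; rewrite reim.
Qed.

Lemma CintegralZ (k : C) F : Cintegrable F ->
  Cintegral (fun x => k * F x) = k * Cintegral F.
Proof.
move=> [F1 F2]; apply: complexP; rewrite [RHS]reim.
  transitivity (itg (fun x => cRe k * cRe (F x) - cIm k * cIm (F x))).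
    by congr itg; apply/funext => x; rewrite reim.
  by rewrite itgB ?itgZ//; exact: RintegrableZ.
transitivity (itg (fun x => cRe k * cIm (F x) + cIm k * cRe (F x))).
  by congr itg; apply/funext => x; rewrite reim.
by rewrite itgD ?itgZ//; exact: RintegrableZ.
Qed.

Lemma cIDl f g h : cL2 f -> cL2 g -> cL2 h ->
  cI (fun x => f x + g x) h = cI f h + cI g h.
Proof.
move=> lf lg lh; rewrite -CintegralD; try exact: CintegrableM.
by congr Cintegral; apply/funext => x; rewrite mulrDl.
Qed.

Lemma cIZl (k : C) f h : cL2 f -> cL2 h -> cI (fun x => k * f x) h = k * cI f h.
Proof.
move=> lf lh; rewrite -CintegralZ; last exact: CintegrableM.
by congr Cintegral; apply/funext => x; rewrite mulrA.
Qed.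

Lemma ae_cI f g h : cL2 f -> cL2 g -> cL2 h -> {ae mu, forall x, f x = g x} ->
  cI f h = cI g h.
Proof.
move=> lf lg lh fg.
have [f1 f2] := CintegrableM lf lh; have [g1 g2] := CintegrableM lg lh.
by apply: complexP; apply: ae_eq_itg;
  (try exact: Rintegrable_measurable); apply: ae_imp fg => x ->.
Qed.

Lemma compact_support_Rintegrable (u : R -> R) (M : R) : continuous u ->
  (forall x, M < `|x| -> u x = 0) -> Rintegrable u.
Proof.
move=> cu u0; have mu' := continuous_measurable_fun cu.
pose A := `[- M, M]%classic : set R.
have iA : mu.-integrable A (EFin \o u).
  apply: continuous_compact_integrable; first exact: segment_compact.
  exact: continuous_subspaceT.
have -> : u = u \_ A.
  apply/funext => x; rewrite patchE; case: ifPn => [//|].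
  rewrite notin_setE /A /= in_itv /= -ler_norml => /negP.
  by rewrite -ltNge => /u0.
rewrite /Rintegrable -restrict_EFin; have mA : measurable (A : set (measurableTypeR R)) by exact: measurable_itv.
exact: (iffLR (@integrable_mkcond _ _ R mu A (EFin \o u) mA) iA).
Qed.

Lemma compact_support_l2 (u : R -> R) (M : R) : continuous u ->
  (forall x, M < `|x| -> u x = 0) -> l2 u.
Proof.
move=> cu u0; split; first exact: continuous_measurable_fun.
apply: (@compact_support_Rintegrable _ M); last by move=> x /u0 ->; rewrite expr0n.
rewrite (_ : (fun x => u x ^+ 2) = (fun x => u x * u x)).
  by move=> x; exact: cvgM (cu x) (cu x).
by apply/funext => x; rewrite expr2.
Qed.

Lemma test_function_l2 (phi : R -> R) : test_function phi ->
  exists dphi, [/\ has_deriv phi dphi, phi^`()%classic = dphi, continuous dphi,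
    exists M : R, forall x, M < `|x| -> phi x = 0 /\ dphi x = 0 & l2 phi /\ l2 dphi].
Proof.
move=> [sm [M phi0]].
have h1 : has_deriv phi phi^`()%classic.
  by move=> x; have := sm 0%N x; rewrite derive1n0 derive1E => d; exact: DeriveDef.
have h2 : has_deriv phi^`()%classic phi^`()^`()%classic.
  by move=> x; have := sm 1%N x; rewrite derive1n1 derive1E => d; apply: DeriveDef => //; rewrite -derive1E.
have c1 := has_deriv_continuous h1; have c2 := has_deriv_continuous h2.
have d0 x : M < `|x| -> phi^`()%classic x = 0.
  move=> xM; rewrite derive1E.
  rewrite (@near_eq_derive _ _ _ phi (cst 0)) ?derive_cst//.
  have : \forall y \near x, M < `|y|.
    by apply: (@cvgr_gt R R (nbhs x) _ (fun y => `|y|) `|x|) => //; exact: norm_continuous.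
  by apply: filterS => y /phi0.
exists phi^`()%classic; split => //.
  by exists M => x xM; split; [exact: phi0|exact: d0].
by split; [exact: compact_support_l2 phi0|exact: compact_support_l2 d0].
Qed.

Lemma classical_weak_derivative (F F' : R -> C) : has_cderiv F F' ->
  continuous (fun x => cRe (F' x)) -> continuous (fun x => cIm (F' x)) ->
  is_weak_derivative F F'.
Proof.
move=> [h1 h2] c1 c2 phi /test_function_l2[dphi [hphi -> cdphi [M out] [lphi ldphi]]].
have key (u u' : R -> R) : has_deriv u u' -> continuous u' ->
    itg (fun x => u x * dphi x) = - itg (fun x => u' x * phi x).
  move=> hu cu'; have cu := has_deriv_continuous hu.
  have cphi := has_deriv_continuous hphi.
  have sm (w psi : R -> R) : continuous w -> continuous psi ->
      (forall x, M < `|x| -> psi x = 0) -> Rintegrable (fun x => w x * psi x).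
    move=> cw cpsi psi0.
    apply: (@compact_support_Rintegrable _ M); last by move=> x /psi0 ->; rewrite mulr0.
    by move=> x; exact: cvgM (cw x) (cpsi x).
  have s1 := sm _ _ cu cdphi (fun x xM => (out x xM).2).
  have s2 := sm _ _ cu' cphi (fun x xM => (out x xM).1).
  have := @itg_has_deriv R (fun x => u x * phi x) (fun x => u' x * phi x + u x * dphi x).
  rewrite itgD// => /(_ (has_derivM hu hphi)) H.
  apply/eqP; rewrite -addr_eq0 addrC; apply/eqP; apply: H.
  - by move=> x; apply: cvgD; apply: cvgM; [exact: cu'|exact: cphi|exact: cu|exact: cdphi].
  - exact: RintegrableD.
  - apply/cvgrPdist_lt => e e0; near=> x.
    have xM : M < `|x|.
      by apply: lt_le_trans (ler_norm _); near: x; apply: nbhs_pinfty_gt; exact: num_real.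
    by rewrite (out x xM).1 mulr0 subrr normr0.
  - apply/cvgrPdist_lt => e e0; near=> x.
    have xM : M < `|x|.
      rewrite -normrN; apply: lt_le_trans (ler_norm _); rewrite ltrNr.
      by near: x; apply: nbhs_ninfty_lt; exact: num_real.
    by rewrite (out x xM).1 mulr0 subrr normr0.
have k1 := key _ _ h1 c1; have k2 := key _ _ h2 c2.
apply: complexP; rewrite [RHS]reim.
  transitivity (itg (fun x => cRe (F x) * dphi x)).
    by congr itg; apply/funext => x; rewrite !reim mulr0 subr0.
  rewrite k1; congr (- _); congr itg; apply/funext => x.
  by rewrite !reim mulr0 subr0.
transitivity (itg (fun x => cIm (F x) * dphi x)).
  by congr itg; apply/funext => x; rewrite !reim mulr0 add0r.
rewrite k2; congr (- _); congr itg; apply/funext => x.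
by rewrite !reim mulr0 add0r.
Unshelve. all: by end_near. Qed.

Lemma CintegralJ F : Cintegrable F ->
  Cintegral (fun x => conjc (F x)) = conjc (Cintegral F).
Proof.
move=> [F1 F2]; apply: complexP; rewrite [RHS]reim.
  by congr itg; apply/funext => x; rewrite reim.
transitivity (itg (fun x => - cIm (F x))).
  by congr itg; apply/funext => x; rewrite reim.
by rewrite itgN.
Qed.

Lemma real_cL2 (u : R -> R) : l2 u -> cL2 (fun x => (u x)%:C%C).
Proof. by move=> lu; split => //; exact: l20. Qed.

Lemma is_weak_derivativeJ (f g : R -> C) : cL2 f -> cL2 g -> is_weak_derivative f g ->
  is_weak_derivative (fun x => conjc (f x)) (fun x => conjc (g x)).
Proof.
move=> lf lg fg phi tphi.
have [dphi [_ dphiE _ _ [lphi ldphi]]] := test_function_l2 tphi.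
have e := fg phi tphi; rewrite dphiE in e *.
have s1 := CintegrableM lf (real_cL2 ldphi); have s2 := CintegrableM lg (real_cL2 lphi).
rewrite (_ : (fun x => conjc (f x) * _) = (fun x => conjc (f x * ((dphi x)%:C)%C))); last first.
  by apply/funext => x; apply: complexP; rewrite !reim; ring.
rewrite (_ : (fun x => conjc (g x) * _) = (fun x => conjc (g x * ((phi x)%:C)%C))); last first.
  by apply/funext => x; apply: complexP; rewrite !reim; ring.
by rewrite !CintegralJ// e rmorphN.
Qed.

(** The identity for the truncated functions passes to the limit: the cut-off tends to 1, its
    derivative is of order 1 / (n + 1), and square integrability provides the dominating functions.
    Decay thus replaces compact support of the test function. *)
Lemma cut_ibp (F G u u' : R -> R) : l2 F -> l2 G -> l2 u -> l2 u' ->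
  has_deriv u u' ->
  (forall n : nat, itg (fun x => F x * (chi' (x * (n.+1%:R)^-1) * (n.+1%:R)^-1 * u x
      + chi (x * (n.+1%:R)^-1) * u' x)) =
    - itg (fun x => G x * (chi (x * (n.+1%:R)^-1) * u x))) ->
  itg (fun x => F x * u' x) = - itg (fun x => G x * u x).
Proof.
move=> lF lG lu lu' hu e.
have hr (n : nat) : has_deriv (fun x : R => x * (n.+1%:R)^-1) (fun=> (n.+1%:R)^-1).
  by apply: eq_has_deriv; [derive|move=> x /=; ring].
have mchi n : measurable_fun setT (fun x : R => chi (x * (n.+1%:R)^-1)).
  apply: continuous_measurable_fun.
  exact: has_deriv_continuous (has_deriv_comp has_deriv_chi (hr n)).
have mchi' n : measurable_fun setT (fun x : R => chi' (x * (n.+1%:R)^-1)).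
  apply: continuous_measurable_fun => x.
  apply: (@continuous_comp R R R (fun x : R => x * (n.+1%:R)^-1) chi'); last exact: continuous_chi'.
  exact: has_deriv_continuous (hr n) x.
have chi1 n x : `|chi (x * (n.+1%:R)^-1)| <= 1 :> R.
  by have /andP[c0 c1] := chi_bound (x * (n.+1%:R)^-1); rewrite ger0_norm.
pose K : R := 48 * expR 1.
have K0 : 0 <= K by rewrite mulr_ge0// expR_ge0.
have chi'1 n x : `|chi' (x * (n.+1%:R)^-1) * (n.+1%:R)^-1| <= K.
  rewrite normrM -[leRHS]mulr1 ler_pM//; first exact: chi'_bound.
  by rewrite ger0_norm ?invr_ge0// invf_le1// ler1n.
have mF := l2_measurable lF; have mG := l2_measurable lG.
have mu1 := l2_measurable lu; have mu1' := l2_measurable lu'.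
have [|||| _ cl] := @dominated_itg R (fun n x => F x * (chi' (x * (n.+1%:R)^-1) * (n.+1%:R)^-1 * u x
      + chi (x * (n.+1%:R)^-1) * u' x)) (fun x => F x * u' x)
   (fun x => K * `|F x * u x| + `|F x * u' x|).
- move=> n; apply: measurable_funM => //; apply: measurable_funD.
    by do 2 apply: measurable_funM => //.
  exact: measurable_funM.
- move=> x; apply: cvgM; first exact: cvg_cst.
  rewrite -[X in _ --> X](_ : 0 * u x + 1 * u' x = u' x); last by ring.
  apply: cvgD; last by apply: cvgM; [exact: cut_cvg|exact: cvg_cst].
  apply: cvgM; last exact: cvg_cst.
  apply/cvgr0Pnorm_le => eps eps0; near=> n.
  rewrite normrM (le_trans (ler_wpM2r (normr_ge0 _) (chi'_bound _)))// -/K.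
  rewrite ger0_norm ?invr_ge0// ler_pdivrMr// mulrC -ler_pdivrMr//.
  rewrite (@le_trans _ _ n%:R)// ?ler_nat//.
  by near: n; exact: nbhs_infty_ger.
- apply: RintegrableD; last by apply: Rintegrable_norm; exact: l2M.
  by apply: RintegrableZ; apply: Rintegrable_norm; exact: l2M.
- move=> n x; rewrite mulrDr (le_trans (ler_normD _ _))// lerD//.
    by rewrite mulrCA normrM ler_wpM2r.
  by rewrite mulrCA normrM ler_piMl.
have [|||| _ cr] := @dominated_itg R (fun n x => G x * (chi (x * (n.+1%:R)^-1) * u x))
   (fun x => G x * u x) (fun x => `|G x * u x|).
- by move=> n; do 2 apply: measurable_funM => //.
- move=> x; apply: cvgM; first exact: cvg_cst.
  rewrite -[X in _ --> X](mul1r (u x)).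
  by apply: cvgM; [exact: cut_cvg|exact: cvg_cst].
- by apply: Rintegrable_norm; exact: l2M.
- by move=> n x; rewrite mulrCA normrM ler_piMl.
move: cl; under eq_fun do rewrite e.
move=> /cvg_lim <- //; apply/cvg_lim => //; exact: cvgN.
Unshelve. all: by end_near. Qed.

Variables a s : R.
Hypothesis a0 : 0 < a.
Local Notation polygauss := (polygauss a s).
Local Notation dpoly := (dpoly a s).
Local Notation lpoly := (lpoly a s).

Let Lpg P : cL2 (polygauss P) := polygauss_cL2 s a0 P.

Lemma polygauss_ibp (f g : R -> C) P : cL2 f -> cL2 g -> is_weak_derivative f g ->
  cI f (polygauss (dpoly P)) = - cI g (polygauss P).
Proof.
move=> lf lg fg.
have [e1 e2] := elementary_polygauss a s P.
have [h1 h2] := has_cderiv_polygauss a s P.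
have parts (u u' : R -> R) : elementary u -> has_deriv u u' -> l2 u -> l2 u' ->
    itg (fun x => cRe (f x) * u' x) = - itg (fun x => cRe (g x) * u x) /\
    itg (fun x => cIm (f x) * u' x) = - itg (fun x => cIm (g x) * u x).
  move=> eu hu lu lu'.
  have key n : Cintegral (fun x => f x * ((chi' (x * (n.+1%:R)^-1) * (n.+1%:R)^-1 * u x
      + chi (x * (n.+1%:R)^-1) * u' x)%:C)%C) =
    - Cintegral (fun x => g x * ((chi (x * (n.+1%:R)^-1) * u x)%:C)%C).
    have := fg _ (cut_test_function n eu).
    by rewrite (has_deriv_derive1 (has_deriv_cut n hu)).
  split; apply: cut_ibp => //; try (by case: lf); try (by case: lg); move=> n.
    have := congr1 (fun z => cRe z) (key n); rewrite [RHS]reim => h.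
    transitivity (itg (fun x => cRe (f x * ((chi' (x * (n.+1%:R)^-1) * (n.+1%:R)^-1 * u x
      + chi (x * (n.+1%:R)^-1) * u' x)%:C)%C))).
      by congr itg; apply/funext => x; rewrite !reim; ring.
    by rewrite [LHS]h; congr (- _); congr itg; apply/funext => x; rewrite !reim; ring.
  have := congr1 (fun z => cIm z) (key n); rewrite [RHS]reim => h.
  transitivity (itg (fun x => cIm (f x * ((chi' (x * (n.+1%:R)^-1) * (n.+1%:R)^-1 * u x
      + chi (x * (n.+1%:R)^-1) * u' x)%:C)%C))).
    by congr itg; apply/funext => x; rewrite !reim; ring.
  by rewrite [LHS]h; congr (- _); congr itg; apply/funext => x; rewrite !reim; ring.
have [l1 l2] := Lpg P; have [l1' l2'] := Lpg (dpoly P).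
have [p1 p2] := parts _ _ e1 h1 l1 l1'.
have [q1 q2] := parts _ _ e2 h2 l2 l2'.
apply: complexP; rewrite [RHS]reim ?Re_cI ?Im_cI//.
  by rewrite p1 q2; ring.
by rewrite q1 p2; ring.
Qed.

Lemma cI_polygauss_eq0 (f : R -> C) : cL2 f -> (forall P, cI f (polygauss P) = 0) ->
  {ae mu, forall x, f x = 0}.
Proof.
move=> lf h; apply: (@orthogonal_polygauss_eq0 R a s a0 f lf) => P.
by rewrite -CintegralM_Re -/(cI f (polygauss P)) h.
Qed.

(** Integration by parts gives both candidates the same pairing with every Gaussian polynomial. This
    identifies the derivative picked by [weak_derivative] with any explicit one. *)
Lemma weak_derivative_unique (f g h : R -> C) : cL2 f -> cL2 g -> cL2 h ->
  is_weak_derivative f g -> is_weak_derivative f h ->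
  {ae mu, forall x, g x = h x}.
Proof.
move=> lf lg lh fg fh.
apply: ae_imp (@cI_polygauss_eq0 (fun x => g x + (-1) * h x) _ _) => [x|//|P].
- by rewrite mulN1r => /eqP; rewrite subr_eq0 => /eqP.
- by apply: cL2D => //; exact: cL2Z.
- rewrite cIDl ?cIZl//; last exact: cL2Z.
  have := polygauss_ibp P lf lg fg; rewrite (polygauss_ibp P lf lh fh).
  by move=> /oppr_inj ->; ring.
Qed.

Lemma polygauss_weak_derivative P : is_weak_derivative (polygauss P) (polygauss (dpoly P)).
Proof.
apply: classical_weak_derivative; first exact: has_cderiv_polygauss.
  by have [[]] := crapid_polygauss s a0 (dpoly P).
by have [_ []] := crapid_polygauss s a0 (dpoly P).
Qed.

Lemma weak_derivativeP (f : R -> C) : W12 f ->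
  cL2 (weak_derivative f) /\ is_weak_derivative f (weak_derivative f).
Proof.
move=> [_ [g [lg fg]]].
have := @xgetPex _ (fun=> 0) [set g | L2 g /\ is_weak_derivative f g].
case; first by exists g.
by move=> /L2P.
Qed.

(** The conjugate appears because the form is antilinear in its second argument: tested on it, the
    form becomes the bilinear pairing with [polygauss P]. *)
Lemma domain_polygauss P : oscillator_form_domain (fun x => conjc (polygauss P x)).
Proof.
have lh := cL2J (Lpg P).
split.
  split; first exact/L2P.
  exists (fun x => conjc (polygauss (dpoly P) x)); split; first exact/L2P/cL2J/Lpg.
  apply: is_weak_derivativeJ => //; exact: polygauss_weak_derivative.
have [r1 r2] := crapid_polygauss s a0 P.
have r : rapid (fun x => x ^+ 2 * (cRe (polygauss P x) ^+ 2 + cIm (polygauss P x) ^+ 2)) by rapid1.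
have sr := rapid_Rintegrable r.
rewrite (_ : (fun x => _) = (fun x => (x ^+ 2 * (cRe (polygauss P x) ^+ 2 + cIm (polygauss P x) ^+ 2))%:E)).
  by rewrite itgE// ltry.
by apply/funext => x; rewrite normc2 !reim sqrrN.
Qed.

End WeakDerivatives.

(** * Limits, duality and solvability for the oscillator *)

Section Operator.
Context {R : realType}.
Local Notation C := R[i].
Local Notation mu := (@lebesgue_measure R).

Lemma conjcMx (x : R) (w : C) : conjc (x%:C%C * w) = x%:C%C * conjc w.
Proof. by apply: complexP; rewrite !reim; ring. Qed.

Lemma Re_cI_ip (f g : R -> C) : cRe (cI f g) = ip f (fun x => conjc (g x)).
Proof. exact: CintegralM_Re. Qed.

Lemma Im_cI_ip (f g : R -> C) :
  cIm (cI f g) = ip f (fun x => Complex (cIm (g x)) (cRe (g x))).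
Proof. exact: CintegralM_Im. Qed.

Lemma nsq_sub_le (f g : R -> C) : cL2 f -> cL2 g ->
  nsq (fun x => f x - g x) <= 2 * nsq f + 2 * nsq g.
Proof.
move=> lf lg; have := nsqD lf lg; rewrite nsqB//.
have := nsq_ge0 (fun x => f x + g x); lra.
Qed.

Lemma L2limD (f_ g_ : nat -> R -> C) f g : L2lim f_ f -> L2lim g_ g ->
  L2lim (fun n x => f_ n x + g_ n x) (fun x => f x + g x).
Proof.
move=> [lf_ lf cf] [lg_ lg cg]; split; first by move=> n; exact: cL2D.
  exact: cL2D.
have c0 : 2 * nsq (fun x => f_ n x - f x) + 2 * nsq (fun x => g_ n x - g x) @[n --> \oo]
    --> (0 : R).
  rewrite -[X in _ --> X](_ : 2 * 0 + 2 * 0 = 0 :> R); last by ring.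
  by apply: cvgD; apply: cvgM => //; exact: cvg_cst.
apply: (squeeze_cvgr _ (cvg_cst 0) c0); apply: nearW => n; rewrite nsq_ge0 /=.
have l1 := cL2B (lf_ n) lf; have l2 := cL2B (lg_ n) lg.
rewrite (_ : nsq _ = nsq (fun x => (f_ n x - f x) + (g_ n x - g x))).
  rewrite nsqD//; have := nsq_ge0 (fun x => (f_ n x - f x) - (g_ n x - g x)).
  by rewrite nsqB//; lra.
by apply: eq_nsq => x; ring.
Qed.

Lemma nsqZc (k : C) (f : R -> C) : cL2 f ->
  nsq (fun x => k * f x) = (cRe k ^+ 2 + cIm k ^+ 2) * nsq f.
Proof.
move=> lf; rewrite -itgZ; last exact: RintegrableD lf.1.2 lf.2.2.
by congr itg; apply/funext => x; rewrite !reim; ring.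
Qed.

Lemma L2limZ (k : C) (f_ : nat -> R -> C) f : L2lim f_ f ->
  L2lim (fun n x => k * f_ n x) (fun x => k * f x).
Proof.
move=> [lf_ lf cf]; split; first by move=> n; exact: cL2Z.
  exact: cL2Z.
rewrite (_ : (fun n => nsq _) = (fun n => (cRe k ^+ 2 + cIm k ^+ 2) * nsq (fun x => f_ n x - f x))).
  rewrite -[X in _ --> X](mulr0 (cRe k ^+ 2 + cIm k ^+ 2)).
  by apply: cvgM => //; exact: cvg_cst.
apply/funext => n; rewrite -nsqZc; last exact: cL2B.
by apply: eq_nsq => x; ring.
Qed.

(** Three terms suffice for both identities that have to pass to the limit: the definition of the
    weak derivative and the form identity. *)
Lemma L2lim_cI3 (f_ g_ k_ : nat -> R -> C) f g k (h1 h2 h3 : R -> C) :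
  L2lim f_ f -> L2lim g_ g -> L2lim k_ k -> cL2 h1 -> cL2 h2 -> cL2 h3 ->
  (forall n, cI (f_ n) h1 + cI (g_ n) h2 + cI (k_ n) h3 = 0) ->
  cI f h1 + cI g h2 + cI k h3 = 0.
Proof.
move=> cf cg ck l1 l2 l3 e.
have sw (h : R -> C) : cL2 h -> cL2 (fun x => Complex (cIm (h x)) (cRe (h x))).
  by move=> [? ?]; split.
have lim3 (a_ b_ c_ : nat -> R) (a b c : R) : a_ n @[n --> \oo] --> a ->
    b_ n @[n --> \oo] --> b -> c_ n @[n --> \oo] --> c ->
    (forall n, a_ n + b_ n + c_ n = 0) -> a + b + c = 0.
  move=> ca cb cc abc.
  have : a_ n + b_ n + c_ n @[n --> \oo] --> a + b + c.
    by apply: cvgD => //; exact: cvgD.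
  by under eq_fun do rewrite abc; move=> /cvg_lim <- //; rewrite lim_cst.
apply: complexP.
  rewrite 2!ReD !Re_cI_ip.
  apply: (lim3 _ _ _ _ _ _ (ip_cvg cf (cL2J l1)) (ip_cvg cg (cL2J l2)) (ip_cvg ck (cL2J l3))) => n.
  by have := congr1 (fun w => cRe w) (e n); rewrite 2!ReD !Re_cI_ip.
rewrite 2!ImD !Im_cI_ip.
apply: (lim3 _ _ _ _ _ _ (ip_cvg cf (sw _ l1)) (ip_cvg cg (sw _ l2)) (ip_cvg ck (sw _ l3))) => n.
by have := congr1 (fun w => cIm w) (e n); rewrite 2!ImD !Im_cI_ip.
Qed.

Lemma second_momentP (f : R -> C) : cL2 f ->
  (\int[mu]_x (x ^+ 2 * ComplexField.Normc.normc (f x) ^+ 2)%:E < +oo)%E <->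
  cL2 (fun x => x%:C%C * f x).
Proof.
move=> [[m1 s1] [m2 s2]].
have mx : measurable_fun setT (fun x : R => x) by exact: measurable_id.
rewrite (_ : (fun x => (x ^+ 2 * _)%:E) = (fun x =>
    ((x * cRe (f x)) ^+ 2 + (x * cIm (f x)) ^+ 2)%:E)); last first.
  by apply/funext => x; rewrite normc2; congr (_%:E); ring.
have e1 : (fun x => cRe (x%:C%C * f x)) = (fun x => x * cRe (f x)).
  by apply/funext => x; rewrite !reim; ring.
have e2 : (fun x => cIm (x%:C%C * f x)) = (fun x => x * cIm (f x)).
  by apply/funext => x; rewrite !reim; ring.
rewrite /cL2 e1 e2.
have mm1 : measurable_fun setT (fun x : R => x * cRe (f x)) by exact: measurable_funM.
have mm2 : measurable_fun setT (fun x : R => x * cIm (f x)) by exact: measurable_funM.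
have p x : 0 <= (x * cRe (f x)) ^+ 2 + (x * cIm (f x)) ^+ 2 by rewrite addr_ge0 ?sqr_ge0.
have msum : measurable_fun setT (fun x : R => (x * cRe (f x)) ^+ 2 + (x * cIm (f x)) ^+ 2).
  by apply: measurable_funD; exact: measurable_funX.
split.
  move/(iffRL (ge0_Rintegrable msum p)) => sm.
  split; split => //; apply: le_Rintegrable sm; try exact: measurable_funX.
    by move=> x; rewrite ger0_norm ?sqr_ge0// lerDl sqr_ge0.
  by move=> x; rewrite ger0_norm ?sqr_ge0// lerDr sqr_ge0.
move=> [[_ t1] [_ t2]]; apply/(iffLR (ge0_Rintegrable msum p)).
exact: RintegrableD.
Qed.

Variables (a s : R) (z : C).
Hypothesis a0 : 0 < a.
Local Notation polygauss := (polygauss a s).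
Local Notation dpoly := (dpoly a s).
Local Notation lpoly := (lpoly a s z).
Local Notation c := (alpha a s ^+ 2).
Local Notation T := (complex_oscillator c).

Let Lpg P : cL2 (polygauss P) := polygauss_cL2 s a0 P.

Lemma polygaussMX2 P x : polygauss ('X^2 * P) x = (x ^+ 2)%:C%C * polygauss P x.
Proof. by rewrite /polygauss hornerM hornerXn rmorphXn -mulrA. Qed.

Lemma polygaussMX P x : polygauss ('X * P) x = x%:C%C * polygauss P x.
Proof. by rewrite /polygauss hornerM hornerX -mulrA. Qed.

Lemma dpolyB P Q : dpoly (P - Q) = dpoly P - dpoly Q.
Proof. by rewrite /dpoly derivB mulrBr scalerBr !opprB; ring. Qed.

Lemma cI_lpoly (f : R -> C) P : cL2 f -> cI f (polygauss (lpoly P)) =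
  - cI f (polygauss (dpoly (dpoly P))) + c * cI f (polygauss ('X^2 * P))
  - z * cI f (polygauss P).
Proof.
move=> lf.
have l1 := cL2Z (-1) (Lpg (dpoly (dpoly P))).
have l2 := cL2Z c (Lpg ('X^2 * P)); have l3 := cL2Z (- z) (Lpg P).
rewrite !(cIC f) (_ : polygauss (lpoly P) = (fun x => (-1 * polygauss (dpoly (dpoly P)) x +
  c * polygauss ('X^2 * P) x) + (- z) * polygauss P x)).
  by rewrite cIDl ?cIDl ?cIZl//; [ring|exact: cL2D].
by apply/funext => x; rewrite polygauss_lpoly polygaussMX2; ring.
Qed.

(** The form identity is tested on the conjugate of a Gaussian polynomial, onto which both
    derivatives are moved. The derivative that the form uses for this test function agrees with the
    explicit one only almost everywhere. *)
Lemma shift_operator_dual f v : shift_operator T z f v ->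
  [/\ cL2 f, cL2 v & forall P, cI f (polygauss (lpoly P)) = cI v (polygauss P)].
Proof.
move=> [[wf xf] /L2P lu hf].
have lf : cL2 f by have [/L2P] := wf.
have lv : cL2 v.
  by have := cL2B lu (cL2Z z lf); congr cL2; apply/funext => x; rewrite addrK.
split => // P.
have [lw fw] := weak_derivativeP wf.
have Dg := domain_polygauss s a0 P.
pose g x := conjc (polygauss P x).
have lg : cL2 g := cL2J (Lpg P).
have [lg1 gg1] := weak_derivativeP Dg.1.
have lg2 : cL2 (fun x => conjc (polygauss (dpoly P) x)) := cL2J (Lpg _).
have gg2 : is_weak_derivative g (fun x => conjc (polygauss (dpoly P) x)).
  by apply: is_weak_derivativeJ => //; exact: polygauss_weak_derivative.
have ae12 := weak_derivative_unique s a0 lg lg1 lg2 gg1 gg2.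
have := hf _ Dg; rewrite /oscillator_form /L2inner.
rewrite -/(cI (weak_derivative f) (fun x => conjc (weak_derivative g x))).
have -> : cI (weak_derivative f) (fun x => conjc (weak_derivative g x)) =
    - cI f (polygauss (dpoly (dpoly P))).
  rewrite (@polygauss_ibp R a s a0 f _ (dpoly P) lf lw fw) opprK cIC [RHS]cIC.
  apply: ae_cI; [exact: cL2J lg1|exact: Lpg|exact: lw|].
  by apply: ae_imp ae12 => x ->; rewrite conjcK.
have -> : Cintegral (fun x => (x ^+ 2)%:C%C * f x * conjc (conjc (polygauss P x))) =
    cI f (polygauss ('X^2 * P)).
  by congr Cintegral; apply/funext => x; rewrite conjcK polygaussMX2; ring.
have -> : Cintegral (fun x => (v x + z * f x) * conjc (conjc (polygauss P x))) =
    cI (fun x => v x + z * f x) (polygauss P).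
  by congr Cintegral; apply/funext => x; rewrite conjcK.
rewrite cIDl//; last exact: cL2Z.
rewrite cIZl// cI_lpoly// => ->; ring.
Qed.

Hypothesis surj : forall Q, exists P, lpoly P = Q.

(** Write L for [lpoly] and approximate the conjugate of f by L P, possible by density and
    surjectivity. In the expansion of |L P - conj f|^2 < d the cross term is the pairing of v with
    P, and twice it is at most eps^2 |v|^2 + eps^-2 |P|^2 <= eps^2 |v|^2 + |L P|^2; then |L P|^2
    cancels. *)
Lemma dual_bound (eps : R) (f v : R -> C) : 0 < eps ->
  (forall P, nsq (polygauss P) <= eps ^+ 2 * nsq (polygauss (lpoly P))) ->
  cL2 f -> cL2 v -> (forall P, cI f (polygauss (lpoly P)) = cI v (polygauss P)) ->
  nsq f <= eps ^+ 2 * nsq v.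
Proof.
move=> e0 apr lf lv dual; apply/ler_addgt0Pr => d d0.
have [Q HQ] := polygauss_dense s a0 (cL2J lf) d0.
have [P PQ] := surj Q; rewrite -PQ in HQ; move: HQ.
rewrite nsqB//; [|exact: cL2J]; rewrite nsqJ.
have e1 : ip (polygauss (lpoly P)) (fun x => conjc (f x)) = ip v (fun x => conjc (polygauss P x)).
  by rewrite -!Re_cI_ip cIC dual.
rewrite e1.
have lk := cL2J (Lpg P).
have := nsq_ge0 (fun x => eps%:C%C * v x - (eps^-1)%:C%C * conjc (polygauss P x)).
rewrite nsqB; [|exact: cL2Z|exact: cL2Z].
have -> : ip (fun x => eps%:C%C * v x) (fun x => (eps^-1)%:C%C * conjc (polygauss P x)) =
    ip v (fun x => conjc (polygauss P x)).
  rewrite ipZl//; last exact: cL2Z.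
  by rewrite [ip v _]ipC ipZl// mulrA mulfV ?gt_eqF// mul1r ipC.
rewrite !nsqZ// nsqJ.
have : eps^-1 ^+ 2 * nsq (polygauss P) <= nsq (polygauss (lpoly P)).
  by rewrite exprVn mulrC ler_pdivrMr ?exprn_gt0// mulrC.
lra.
Qed.

(** The equation is solved exactly for Gaussian polynomials that approach v at the rate 4^-n.
    Applied to differences of the solutions, the three bounds make the functions, their derivatives
    and their products with x converge in L^2. *)
Lemma resolvent_solution (K : R) : 0 <= K ->
  (forall P, [/\ nsq (polygauss P) <= K * nsq (polygauss (lpoly P)),
    nsq (polygauss (dpoly P)) <= K * nsq (polygauss (lpoly P)) &
    nsq (polygauss ('X * P)) <= K * nsq (polygauss (lpoly P))]) ->
  forall v, cL2 v -> exists f, shift_operator T z f v.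
Proof.
move=> K0 apr v lv.
have /choice[Q_ HQ] : forall n : nat, exists Q, nsq (fun x => polygauss Q x - v x) < 1 / 4 ^+ n.
  by move=> n; apply: (polygauss_dense s a0 lv); rewrite divr_gt0// exprn_gt0.
have /choice[P_ HP] : forall n, exists P, lpoly P = Q_ n by move=> n; exact: surj.
have dQ n : nsq (polygauss (Q_ n.+1 - Q_ n)) <= 4 / 4 ^+ n.
  rewrite (_ : nsq _ = nsq (fun x => (polygauss (Q_ n.+1) x - v x) - (polygauss (Q_ n) x - v x))).
    have := nsq_sub_le (cL2B (Lpg (Q_ n.+1)) lv) (cL2B (Lpg (Q_ n)) lv).
    have := HQ n; have := HQ n.+1.
    have : 1 / 4 ^+ n.+1 <= 1 / 4 ^+ n :> R.
      by rewrite !div1r lef_pV2 ?posrE ?exprn_gt0// ler_weXn2l// ler1n.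
    by rewrite (_ : 4 / 4 ^+ n = 4 * (1 / 4 ^+ n)); [lra|ring].
  by apply: eq_nsq => x; rewrite polygaussB; ring.
have dL n : nsq (polygauss (lpoly (P_ n.+1 - P_ n))) <= 4 / 4 ^+ n.
  by rewrite lpolyB !HP.
have mono n w : w <= K * nsq (polygauss (lpoly (P_ n.+1 - P_ n))) -> w <= (K * 4) / 4 ^+ n.
  by move=> /le_trans; apply; rewrite -mulrA ler_wpM2l.
have [f lim] : exists f, L2lim (fun n => polygauss (P_ n)) f.
  apply: (@L2_complete _ _ (K * 4)) => // n; apply: mono.
  have [h _ _] := apr (P_ n.+1 - P_ n); apply: le_trans h.
  by rewrite le_eqVlt; apply/orP; left; apply/eqP; apply: eq_nsq => x; rewrite polygaussB.
have [f1 lim1] : exists f1, L2lim (fun n => polygauss (dpoly (P_ n))) f1.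
  apply: (@L2_complete _ _ (K * 4)) => // n; apply: mono.
  have [_ h _] := apr (P_ n.+1 - P_ n); apply: le_trans h.
  by rewrite le_eqVlt; apply/orP; left; apply/eqP; apply: eq_nsq => x; rewrite dpolyB; exact/esym/polygaussB.
have [f2 lim2] : exists f2, L2lim (fun n => polygauss ('X * P_ n)) f2.
  apply: (@L2_complete _ _ (K * 4)) => // n; apply: mono.
  have [_ _ h] := apr (P_ n.+1 - P_ n); apply: le_trans h.
  by rewrite le_eqVlt; apply/orP; left; apply/eqP; apply: eq_nsq => x; rewrite mulrBr polygaussB.
have limv : L2lim (fun n => polygauss (Q_ n)) v.
  split => //.
  have c1 : 1 / 4 ^+ n @[n --> \oo] --> (0 : R).
    under eq_fun do rewrite div1r -exprVn.
    by apply: cvg_expr; rewrite ger0_norm ?invr_ge0// invf_lt1// ltr1n.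
  apply: (squeeze_cvgr _ (cvg_cst 0) c1); apply: nearW => n.
  by rewrite nsq_ge0 ltW.
have [_ lf cf] := lim; have [_ lf1 cf1] := lim1; have [_ lf2 cf2] := lim2.
have mxf : Cmeasurable (fun x => x%:C%C * f x).
  split.
    rewrite (_ : (fun _ => _) = (fun x : R => x * cRe (f x))).
      by apply: measurable_funM; [exact: measurable_id|exact: l2_measurable lf.1].
    by apply/funext => x; rewrite !reim; ring.
  rewrite (_ : (fun _ => _) = (fun x : R => x * cIm (f x))).
    by apply: measurable_funM; [exact: measurable_id|exact: l2_measurable lf.2].
  by apply/funext => x; rewrite !reim; ring.
(* x f_n tends to f2 and f_n to f; x f need not be square integrable a priori,
   so both limits are compared after division by 1 + x ^ 2. *)
have aef2 : {ae mu, forall x, f2 x = x%:C%C * f x}.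
  pose rho (x : R) := (1 + x ^+ 2)^-1.
  have p1 (x : R) : 0 < 1 + x ^+ 2 by rewrite ltr_pwDl// sqr_ge0.
  have crho : continuous rho by exact: continuous_oneDsqrV.
  have rho1 x : `|rho x| <= 1.
    by rewrite ger0_norm ?invr_ge0 ?(ltW (p1 x))// invf_le1// lerDl sqr_ge0.
  have rhox x : `|rho x * x| <= 1.
    rewrite normrM ger0_norm ?invr_ge0 ?(ltW (p1 x))//.
    rewrite mulrC ler_pdivrMr// mul1r ler_norml.
    by have h1 := sqr_ge0 (x - 1); have h2 := sqr_ge0 (x + 1); apply/andP; split; nra.
  have mrho : measurable_fun setT rho by exact: continuous_measurable_fun.
  have mrhox : measurable_fun setT (fun x => rho x * x).
    by apply: measurable_funM => //; exact: measurable_id.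
  have bL (b : R -> R) (g : R -> C) : measurable_fun setT b -> (forall x, `|b x| <= 1) ->
      cL2 g -> cL2 (fun x => (b x)%:C%C * g x) /\ nsq (fun x => (b x)%:C%C * g x) <= nsq g.
    move=> mb b1 [g1 g2].
    have l1 : cL2 (fun x => (b x)%:C%C * g x).
      split.
        have := l2_bM mb b1 g1; congr l2; apply/funext => x; rewrite !reim; ring.
      have := l2_bM mb b1 g2; congr l2; apply/funext => x; rewrite !reim; ring.
    split => //; apply: le_itg => [||x].
    - exact: RintegrableD l1.1.2 l1.2.2.
    - exact: RintegrableD g1.2 g2.2.
    have b2 : b x ^+ 2 <= 1 by rewrite -(real_normK (num_real (b x))) exprn_ile1.
    rewrite !reim (_ : _ + _ = b x ^+ 2 * (cRe (g x) ^+ 2 + cIm (g x) ^+ 2)); last by ring.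
    by rewrite ler_piMl// addr_ge0 ?sqr_ge0.
  have [lr _] := bL _ _ mrho rho1 lf2; have [lrx _] := bL _ _ mrhox rhox lf.
  have le := cL2B lr lrx.
  have e0 : nsq (fun x => (rho x)%:C%C * f2 x - (rho x * x)%:C%C * f x) = 0.
    apply/eqP; rewrite eq_le nsq_ge0 andbT.
    have cc : 2 * nsq (fun x => polygauss (P_ n) x - f x) + 2 * nsq (fun x => polygauss ('X * P_ n) x - f2 x)
        @[n --> \oo] --> (0 : R).
      rewrite -[X in _ --> X](_ : 2 * 0 + 2 * 0 = 0 :> R); last by ring.
      by apply: cvgD; apply: cvgM => //; exact: cvg_cst.
    apply: (ler_cvg_to (cvg_cst _) cc); apply: nearW => n.
    have [m1 h1] := bL _ _ mrhox rhox (cL2B (Lpg (P_ n)) lf).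
    have [m2 h2] := bL _ _ mrho rho1 (cL2B (Lpg ('X * P_ n)) lf2).
    rewrite (_ : nsq _ = nsq (fun x => (rho x * x)%:C%C * (polygauss (P_ n) x - f x) -
      (rho x)%:C%C * (polygauss ('X * P_ n) x - f2 x))).
      by apply: (le_trans (nsq_sub_le m1 m2)); lra.
    by apply: eq_nsq => x; rewrite polygaussMX rmorphM; ring.
  apply: ae_imp (ae_eq_nsq0 le e0) => x /eqP.
  rewrite rmorphM -mulrA -mulrBr mulf_eq0 => /orP[/eqP[]|].
    by move=> /eqP; rewrite invr_eq0 gt_eqF.
  by rewrite subr_eq0 => /eqP.
have lxf : cL2 (fun x => x%:C%C * f x).
  split; [apply: ae_eq_l2 (lf2.1)|apply: ae_eq_l2 (lf2.2)].
  - exact: mxf.1.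
  - by apply: ae_imp aef2 => x ->.
  - exact: mxf.2.
  - by apply: ae_imp aef2 => x ->.
have limx : L2lim (fun n => polygauss ('X * P_ n)) (fun x => x%:C%C * f x).
  split; [by move=> n; exact: Lpg|exact: lxf|].
  rewrite (_ : (fun n => nsq _) = (fun n => nsq (fun x => polygauss ('X * P_ n) x - f2 x))).
    exact: cf2.
  apply/funext => n; apply: ae_nsq; [exact: cL2B (Lpg _) lxf|exact: cL2B (Lpg _) lf2|].
  by apply: ae_imp aef2 => x ->.
have l0 : cL2 (fun=> 0 : C) by split; exact: l20.
have fw : is_weak_derivative f f1.
  move=> phi tphi; have [dphi [_ dE _ _ [lphi ldphi]]] := test_function_l2 tphi.
  rewrite dE; have lp := real_cL2 lphi; have ld := real_cL2 ldphi.
  have := L2lim_cI3 lim lim1 lim ld lp l0; rewrite cI0 addr0 => /(_ _)/eqP.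
  rewrite addr_eq0 => H; apply/eqP/H => n.
  have := polygauss_weak_derivative s a0 (P_ n) tphi; rewrite dE => e.
  by rewrite cI0 addr0 /cI e addNr.
have Wf : W12 f.
  by split; [exact/L2P|exists f1; split => //; exact/L2P].
have Df : oscillator_form_domain f.
  by split => //; apply/second_momentP.
exists f; split => //; first by apply/L2P; apply: cL2D => //; exact: cL2Z.
move=> g Dg.
have [lwf wf] := weak_derivativeP Wf.
have [lwg wg] := weak_derivativeP Dg.1.
have lg : cL2 g by have [/L2P] := Dg.1.
have lxg : cL2 (fun x => x%:C%C * g x) by apply/second_momentP => //; exact: Dg.2.
have lgc := cL2J lg; have lwgc := cL2J lwg; have lxgc := cL2J lxg.
have wgc := is_weak_derivativeJ lg lwg wg.
rewrite /oscillator_form /L2inner.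
have -> : Cintegral (fun x => weak_derivative f x * conjc (weak_derivative g x)) =
    cI f1 (fun x => conjc (weak_derivative g x)).
  apply: ae_cI => //.
  exact: (weak_derivative_unique s a0 lf lwf lf1 wf fw).
have -> : Cintegral (fun x => (x ^+ 2)%:C%C * f x * conjc (g x)) =
    cI (fun x => x%:C%C * f x) (fun x => conjc (x%:C%C * g x)).
  congr Cintegral; apply/funext => x; rewrite conjcMx rmorphXn; ring.
rewrite -cIZl//.
rewrite -/(cI (fun x => v x + z * f x) (fun x => conjc (g x))).
apply/eqP; rewrite -subr_eq0 -mulN1r -cIZl//; last by apply: cL2D => //; exact: cL2Z.
(* For each n the identity is an integration by parts of a Gaussian polynomial against the conjugate
   of g, whose weak derivative is square integrable. *)
apply/eqP; apply: (L2lim_cI3 lim1 (L2limZ c limx)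
  (L2limZ (-1) (L2limD limv (L2limZ z lim)))) => // n.
have lz := cL2Z z (Lpg (P_ n)).
rewrite !cIZl//; last by exact: cL2D.
rewrite cIDl// cIZl//.
have -> : cI (polygauss ('X * P_ n)) (fun x => conjc (x%:C%C * g x)) =
    cI (fun x => conjc (g x)) (polygauss ('X^2 * P_ n)).
  congr Cintegral; apply/funext => x.
  by rewrite polygaussMX polygaussMX2 conjcMx rmorphXn; ring.
rewrite !(cIC _ (fun x => conjc (g x))) -HP cI_lpoly//.
rewrite (@polygauss_ibp R a s a0 _ _ (dpoly (P_ n)) lgc lwgc wgc) cIC; ring.
Qed.

End Operator.

(** * The resolvent *)

Section Resolvent.
Context {R : realType}.
Local Notation C := R[i].

(** Only [eps] enters the conclusion. The bounds by [K] are qualitative: they place the limit of the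
    approximate solutions in the form domain. *)
Lemma resolvent_norm_le (a s : R) (z : C) (eps K : R) : 0 < a -> 0 < eps -> 0 <= K ->
  (forall Q, exists P, lpoly a s z P = Q) ->
  (forall P, [/\ nsq (polygauss a s P) <= eps ^+ 2 * nsq (polygauss a s (lpoly a s z P)),
    nsq (polygauss a s (dpoly a s P)) <= K * nsq (polygauss a s (lpoly a s z P)) &
    nsq (polygauss a s ('X * P)) <= K * nsq (polygauss a s (lpoly a s z P))]) ->
  (0 <= resolvent_norm (complex_oscillator (alpha a s ^+ 2)%R) z <= eps%:E)%E.
Proof.
move=> a0 e0 K0 surj apr.
have apr1 P : nsq (polygauss a s P) <= eps ^+ 2 * nsq (polygauss a s (lpoly a s z P)).
  by have [] := apr P.
have bound f v : shift_operator (complex_oscillator (alpha a s ^+ 2)%R) z f v ->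
    (L2norm f <= eps%:E * L2norm v)%E.
  move=> /(shift_operator_dual a0)[lf lv dual].
  rewrite !L2normE// -EFinM lee_fin.
  have h := dual_bound a0 surj e0 apr1 lf lv dual.
  apply: (le_trans (ler_wsqrtr h)).
  by rewrite sqrtrM ?sqr_ge0// sqrtr_sqr ger0_norm// ltW.
have sol v : cL2 v -> exists f, shift_operator (complex_oscillator (alpha a s ^+ 2)%R) z f v.
  have K20 : 0 <= eps ^+ 2 + K by rewrite addr_ge0// sqr_ge0.
  apply: (resolvent_solution a0 surj K20) => P; have [h1 h2 h3] := apr P.
  have n0 := nsq_ge0 (polygauss a s (lpoly a s z P)).
  have e2 : 0 <= eps ^+ 2 by exact: sqr_ge0.
  have k1 := mulr_ge0 e2 n0; have k2 := mulr_ge0 K0 n0.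
  by split; rewrite mulrDl; lra.
have res : in_resolvent_set (complex_oscillator (alpha a s ^+ 2)%R) z.
  split; first by move=> v /L2P; exact: sol.
  - move=> f1 f2 v /(shift_operator_dual a0)[l1 _ d1] /(shift_operator_dual a0)[l2 _ d2].
    apply: ae_imp (@cI_polygauss_eq0 R a s a0 (fun x => f1 x + (-1) * f2 x) _ _) => [x||Q].
    + by rewrite mulN1r => /eqP; rewrite subr_eq0 => /eqP.
    + by apply: cL2D => //; exact: cL2Z.
    + have [P <-] := surj Q.
      have lh := polygauss_cL2 s a0 (lpoly a s z P).
      by rewrite cIDl ?cIZl//; [rewrite d1 d2; ring|exact: cL2Z].
  - by exists eps.
rewrite /resolvent_norm asboolT//; apply/andP; split.
  (* The supremum is over a nonempty set of nonnegative values: a solution for v = 0 contributes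
     one. *)
  have l0 : cL2 (fun=> 0 : C) by split; exact: l20.
  have [f hf] := sol _ l0.
  apply: (@le_trans _ _ (L2norm f)); first exact: Lnorm_ge0.
  apply: ereal_sup_ubound; exists f => //; exists (fun=> 0); split => //.
  rewrite L2normE// lee_fin nsqE.
  rewrite /ip (_ : (fun _ => _) = fun=> 0); last by apply/funext => x; rewrite mulr0 addr0.
  by rewrite itg0 sqrtr0.
apply: ge_ereal_sup => _ [f [v [fv v1]] <-].
apply: (le_trans (bound _ _ fv)).
by rewrite -[leRHS]mule1 lee_pmul2l// lte_fin.
Qed.

(** Im c = 2 a s is positive, so a and s have the same sign; if it is negative, the other root is
    taken. *)
Lemma sqrt_first_quadrant (c : C) : 0 < cIm c ->
  exists a s : R, [/\ 0 < a, 0 < s & alpha a s ^+ 2 = c].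
Proof.
move=> c2; have := sqr_sqrtc c; case: (sqrtc c) => a s e.
have e2 : a * s + s * a = cIm c by rewrite -e expr2.
have [a0|a0|a0] := ltgtP a 0.
- exists (- a), (- s); split; first by rewrite oppr_gt0.
    by nra.
  by rewrite -e /alpha -[RHS]sqrrN.
- exists a, s; split => //.
  by nra.
- by move: e2; rewrite a0 mul0r mulr0 addr0 => e2; rewrite -e2 ltxx in c2.
Qed.

(** In case of equality the imaginary parts give 2 n + 1 = 2 a t, and the real parts then give ka =
    |alpha|^2 t. In the application ka is of order r^6 while t is at most r^2. *)
Lemma nonresonant (a s ka t : R) (n : nat) : 0 < s ->
  (a ^+ 2 + s ^+ 2) * t < ka ->
  alpha a s * (2 * n%:R + 1) != ka%:C%C + alpha a s ^+ 2 * t%:C%C.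
Proof.
move=> s0 h; apply/eqP => e.
have [w [wE w1 w2]] : exists w, [/\ w = alpha a s, cRe w = a & cIm w = s].
  by exists (alpha a s).
have nE : (2 * n%:R + 1 : C) = (2 * n%:R + 1 : R)%:C%C.
  by rewrite rmorphD rmorphM !rmorph_nat rmorph1.
move: e; rewrite nE -wE; set N := 2 * n%:R + 1 => e.
have e1 := congr1 (fun y => cRe y) e; have e2 := congr1 (fun y => cIm y) e.
move: e1 e2; rewrite expr2 !reim.
rewrite w1 w2 => e1 e2.
have N2 : N = 2 * a * t.
  by apply: (mulfI (lt0r_neq0 s0)); lra.
have : ka = (a ^+ 2 + s ^+ 2) * t by rewrite N2 in e1; lra.
by move=> ka0; rewrite ka0 ltxx in h.
Qed.

(** The coefficients a^2 - s^2 and 2 a s are the real and imaginary parts of c = alpha^2, so that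
    the a priori bound applies to the operator on Gaussian polynomials. *)
Lemma polygauss_rapid_solution (a s ka t : R) (P : {poly C}) : 0 < a ->
  rapid_solution (a ^+ 2 - s ^+ 2) (2 * a * s) ka t
    (fun x => cRe (polygauss a s P x)) (fun x => cIm (polygauss a s P x))
    (fun x => cRe (polygauss a s (dpoly a s P) x))
    (fun x => cIm (polygauss a s (dpoly a s P) x))
    (fun x => cRe (polygauss a s (lpoly a s (ka%:C%C + alpha a s ^+ 2 * t%:C%C) P) x))
    (fun x => cIm (polygauss a s (lpoly a s (ka%:C%C + alpha a s ^+ 2 * t%:C%C) P) x)).
Proof.
move=> a0.
exists (fun x => cRe (polygauss a s (dpoly a s (dpoly a s P)) x)).
exists (fun x => cIm (polygauss a s (dpoly a s (dpoly a s P)) x)).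
have [h1 h2] := has_cderiv_polygauss a s P.
have [k1 k2] := has_cderiv_polygauss a s (dpoly a s P).
have [r1 r2] := crapid_polygauss s a0 P.
have [r3 r4] := crapid_polygauss s a0 (dpoly a s P).
have [r5 r6] := crapid_polygauss s a0 (dpoly a s (dpoly a s P)).
have e (f'' f : C) (x : R) :
    - f'' + (alpha a s ^+ 2 * (x ^+ 2)%:C%C - (ka%:C%C + alpha a s ^+ 2 * t%:C%C)) * f =
    Complex (- cRe f'' + (x ^+ 2 + - t) * ((a ^+ 2 - s ^+ 2) * cRe f + - (2 * a * s * cIm f))
               + - (ka * cRe f))
            (- cIm f'' + (x ^+ 2 + - t) * ((a ^+ 2 - s ^+ 2) * cIm f + 2 * a * s * cRe f)
               + - (ka * cIm f)).
  by apply: complexP; case: f'' f => [f1 f2] [g1 g2]; rewrite /alpha /= expr2 /=; ring.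
split => //; apply/funext => x; rewrite polygauss_lpoly e //.
Qed.

End Resolvent.

(** * The limit along the curve of spectral parameters *)

Local Open Scope complex_scope.

Theorem mainTheorem2 (R : realType) (c : R[i]) (b p : R)
    (hRe : 0 < complex.Re c) (hIm : 0 < complex.Im c)
    (hb : 0 < b) (hp0 : 0 < p) (hp : p <= 1 / 3) :
  resolvent_norm (complex_oscillator c) ((b * eta)%:C + c * (eta `^ p)%:C)
    @[eta --> +oo] --> 0%E.
Proof.
have [a [s [a0 s0 cE]]] := sqrt_first_quadrant hIm.
have [w [wE w1 w2]] : exists w, [/\ w = alpha a s, cRe w = a & cIm w = s].
  by exists (alpha a s).
have a1 : 0 < a ^+ 2 - s ^+ 2.
  by move: hRe; rewrite -cE -wE expr2 !reim w1 w2 -!expr2.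
have a2 : 0 < 2 * a * s by rewrite !mulr_gt0.
pose be := Num.sqrt b.
have be0 : 0 < be by rewrite sqrtr_gt0.
have [K [r0 [K0 r01 apriori]]] := apriori_bound a1 a2 be0.
(* With r^6 = eta and [be] the square root of b, (be r^3)^2 = b eta. *)
pose r (eta : R) := eta `^ (1 / 6).
have powE (eta : R) (n : nat) : 0 <= eta -> r eta ^+ n = eta `^ (n%:R / 6).
  move=> eta0; rewrite -powR_mulrn ?powR_ge0// -powRrM; congr (_ `^ _); lra.
have large (A : R) : \forall eta \near +oo, 1 <= eta /\ A <= r eta.
  near=> eta.
  have eta1 : 1 <= eta by near: eta; apply: nbhs_pinfty_ge; exact: num_real.
  split => //; rewrite leNgt; apply/negP => rA.
  have : eta < (1 + `|A|) ^+ 6.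
    have -> : eta = r eta ^+ 6.
      by rewrite powE ?(le_trans ler01)// divff// powRr1// (le_trans ler01).
    rewrite ltr_pXn2r// ?nnegrE ?powR_ge0//.
    by apply: (lt_le_trans rA); rewrite (le_trans (ler_norm A))// lerDr.
  rewrite ltNge => /negP; apply.
  by near: eta; apply: nbhs_pinfty_ge; exact: num_real.
have bound (eps : R) : 0 < eps -> \forall eta \near +oo,
    (0 <= resolvent_norm (complex_oscillator c) ((b * eta)%:C + c * (eta `^ p)%:C)%R
       <= eps%:E)%E.
  move=> eps0.
  (* A threshold for r that serves three purposes, all summands being nonnegative: [r0] for the a
     priori bound, the third term to keep z off the diagonal entries, and K / eps^2 to have K r^-4
     <= eps^2. *)
  pose A := 1 + r0 + (a ^+ 2 + s ^+ 2) / b + K / eps ^+ 2.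
  apply: filterS (large A) => eta [eta1 rA].
  have eta0 : 0 <= eta by exact: le_trans ler01 eta1.
  have q1 : 0 <= (a ^+ 2 + s ^+ 2) / b by rewrite divr_ge0 ?addr_ge0 ?sqr_ge0 ?(ltW hb).
  have q2 : 0 <= K / eps ^+ 2 by rewrite divr_ge0 ?(ltW K0) ?sqr_ge0.
  have rr0 : r0 <= r eta by rewrite /A in rA; lra.
  have rK : K / eps ^+ 2 <= r eta by rewrite /A in rA; lra.
  have rs : (a ^+ 2 + s ^+ 2) / b < r eta by rewrite /A in rA; lra.
  have r1 : 1 <= r eta by exact: le_trans r01 rr0.
  have rp : 0 < r eta by exact: lt_le_trans ltr01 r1.
  have r4 : r eta <= r eta ^+ 4 by rewrite -[leLHS]expr1 ler_weXn2l.
  pose t := eta `^ p.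
  have t0 : 0 <= t by exact: powR_ge0.
  (* Here p <= 1/3 enters: eta^p <= eta^(1/3) = r^2 for eta >= 1. *)
  have tr : t <= r eta ^+ 2.
    by rewrite powE// /t ler_powR//; lra.
  have kaE : b * eta = (be * r eta ^+ 3) ^+ 2.
    by rewrite exprMn sqr_sqrtr ?(ltW hb)// -exprM powE// divff// powRr1.
  have [est [C [C0 energy]]] := apriori (r eta) t rr0 t0 tr.
  pose z := (b * eta)%:C + alpha a s ^+ 2 * t%:C.
  have sol P := polygauss_rapid_solution s (b * eta) t P a0.
  rewrite -cE; apply: (@resolvent_norm_le R a s z eps C) => //.
  - apply: lpoly_surj => n; apply: nonresonant => //.
    apply: (@le_lt_trans _ _ ((a ^+ 2 + s ^+ 2) * r eta ^+ 2)).
      by rewrite ler_wpM2l// addr_ge0 ?sqr_ge0.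
    rewrite (_ : b * eta = b * r eta ^+ 4 * r eta ^+ 2); last first.
      by rewrite -mulrA -exprD powE// divff// powRr1.
    rewrite ltr_pM2r ?exprn_gt0// mulrC -ltr_pdivrMr//.
    exact: lt_le_trans rs r4.
  - move=> P; have sP := sol P; rewrite kaE in sP.
    have h1 := est _ _ _ _ _ _ sP; have [h2 h3] := energy _ _ _ _ _ _ sP.
    rewrite -kaE -/z in h1 h2 h3.
    split => //.
      have n0 := nsq_ge0 (polygauss a s (lpoly a s z P)).
      have Kr : K <= eps ^+ 2 * r eta ^+ 4.
        rewrite mulrC -ler_pdivrMr ?exprn_gt0//; exact: le_trans rK r4.
      have := le_trans h1 (ler_wpM2r n0 Kr).
      by rewrite [eps ^+ 2 * _]mulrC -[leRHS]mulrA ler_pM2l// exprn_gt0.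
    apply: le_trans h3; rewrite le_eqVlt; apply/orP; left; apply/eqP.
    by congr itg; apply/funext => x; rewrite polygaussMX !reim; ring.
(* Convergence in the extended reals splits into eventual finiteness and convergence of the real
   values. *)
apply/fine_cvgP; split.
  apply: filterS (bound 1 ltr01) => eta /andP[h1 h2].
  by rewrite ge0_fin_numE// (le_lt_trans h2)// ltry.
apply/cvgrPdist_le => eps eps0.
apply: filterS (bound eps eps0) => eta /andP[h1 h2] /=.
have fn : resolvent_norm (complex_oscillator c) ((b * eta)%:C + c * (eta `^ p)%:C) \is a fin_num.
  by rewrite ge0_fin_numE// (le_lt_trans h2)// ltry.
rewrite sub0r normrN ger0_norm; last by rewrite fine_ge0.
by rewrite -lee_fin fineK.
Unshelve. all: by end_near. Qed.
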